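(* Let $A,B\colon\mathcal H\to2^{\mathcal H}$ be maximally monotone operators such that the graph of $B$ is convex. Let $\tau>0$ and let $C\colon\mathcal H\to\mathcal H$ be $\tau$-cocoercive, with $Cx=\mathbb E_{\xi\sim\mathcal D}[C_\xi x]$ for all $x\in\mathcal H$, where $C_\xi\colon\mathcal H\to\mathcal H$ is $\tau$-cocoercive for $\mathcal D$-almost all $\xi$, and $\xi\mapsto C_\xi x$ is $\mathcal D$-measurable with finite expectation for all $x\in\mathcal H$. Assume $\mathrm{Zer}(A+B+C)\neq\emptyset$. Let $\rho\in(0,2\tau)$, and define $$T_\xi=I-J_{\rho A}+J_{\rho B}\circ(2J_{\rho A}-I-\rho C_\xi\circ J_{\rho A}),\qquad T=\mathbb E_{\xi\sim\mathcal D}[T_\xi].$$ Assume that for some $p_0\in\mathrm{Fix}(T)$, $\mathbb E[\|(C-C_\xi)J_{\rho A}p_0\|^2]\le\sigma_*^2<+\infty$. Let $x_0\in\mathcal H$ and let $(x_k,y_k,z_k)$ be generated, for $k\ge0$, by $$\begin{cases}y_k=J_{\rho A}x_k,\\ z_k=J_{\rho B}(2y_k-x_k-\rho C_{\xi_k}y_k),\quad\xi_k\overset{\text{iid}}{\sim}\mathcal D,\\ x_{k+1}=x_k-\lambda_k(y_k-z_k).\end{cases}$$ Then, for any constant $\bar\lambda\in(0,1)$, $$\mathbb E[\|Tx_{N_K}-x_{N_K}\|]\le\begin{cases}\mathcal O(K^{-\frac14})&\text{if }\lambda_k\equiv\bar\lambda K^{-\frac12},\\ \mathcal O(\ln(K)^{\frac12}K^{-\frac14})&\text{if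 }\lambda_k=\bar\lambda(k+1)^{-\frac12}\ln(k+e)^{-1},\end{cases}$$ where $N_K$ is the random index defined in the context, and $$\mathbb E[\|Tx_K-x_K\|]\le\begin{cases}\mathcal O(K^{-\frac16})&\text{if }\lambda_k\equiv\bar\lambda K^{-\frac23},\\ \mathcal O(\ln(K)^{\frac12}K^{-\frac16})&\text{if }\lambda_k=\bar\lambda(k+1)^{-\frac23}.\end{cases}$$ Moreover, for each of the two schedules that do not depend on the horizon, namely $\lambda_k=\bar\lambda(k+1)^{-\frac12}\ln(k+e)^{-1}$ and $\lambda_k=\bar\lambda(k+1)^{-\frac23}$, $(x_k)$ converges weakly almost surely to a point $p\in\mathrm{Fix}(T)$ such that $J_{\rho A}p\in\mathrm{Zer}(A+B+C)$, and $\|Tx_k-x_k\|\to0$ almost surely.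
   Context: $\mathcal H$ is a real separable Hilbert space with inner product $\langle\cdot,\cdot\rangle$ and norm $\|\cdot\|$, and $\mathcal D$ is a probability distribution. $I$ is the identity; $J_{\rho A}=(I+\rho A)^{-1}$ is the resolvent. $C$ is $\tau$-cocoercive if $\langle Cx-Cy,x-y\rangle\ge\tau\|Cx-Cy\|^2$ for all $x,y$. $\mathrm{Zer}(M)=\{x\colon0\in Mx\}$; $\mathrm{Fix}(T)=\{x\colon Tx=x\}$. Expectations of $\mathcal H$-valued maps are Bochner integrals. Define $\Lambda_k=\prod_{i=0}^{k-1}(1+2\lambda_i^2)^{-1}$. The random index $N_K\in\{0,\dots,K-1\}$ is independent of the algorithmic randomness $(\xi_k)$ and satisfies $$\mathbb P(N_K=k)=\frac{\Lambda_{k+1}\lambda_k(1-\lambda_k)}{\sum_{k'=0}^{K-1}\Lambda_{k'+1}\lambda_{k'}(1-\lambda_{k'})},\quad k=0,\dots,K-1.$$ $\mathbb E$ is over all sources of randomness. For the schedules $\lambda_k\equiv\bar\lambda K^{-1/2}$ and $\lambda_k\equiv\bar\lambda K^{-2/3}$, for each horizon $K$ the algorithm is run afresh for $K$ iterations with that constant parameter. $\mathcal O(\cdot)$ is understood as $K\to\infty$ with constants not depending on $K$. The starting point $x_0$ is deterministic, and the weak limit may be random. *)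

(* Defs.v *)
From HB Require Import structures.
From mathcomp Require Import all_boot all_order all_algebra finmap.
From mathcomp Require Import all_classical all_reals all_analysis.

Set Implicit Arguments.
Unset Strict Implicit.
Unset Printing Implicit Defensive.

Import Order.TTheory GRing.Theory Num.Theory.
Import numFieldNormedType.Exports.

Local Open Scope classical_set_scope.
Local Open Scope ring_scope.

Section HilbertSpace.
Context (R : realType) (H : completeNormedModType R).
Implicit Type ip : {dot H for idfun}.

(* A real Hilbert space is a complete normed space whose norm is induced by an
   inner product. *)
Definition hilbert_norm ip := forall x : H, `|x| = Num.sqrt (ip x x).

Definition separable := exists2 S : set H, countable S & dense S.

Definition weakly_converges ip (u : nat -> H) (p : H) :=
  forall v : H, ip (u n) v @[n --> \oo] --> ip p v.

Definition cocoercive ip (tau : R) (C : H -> H) :=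
  forall x y, tau * `|C x - C y| ^+ 2 <= ip (C x - C y) (x - y).

End HilbertSpace.

Section SetValuedOperators.
Context (R : realType) (H : completeNormedModType R).
Implicit Types (ip : {dot H for idfun}) (M N : H -> set H).

Definition graph M : set (H * H) := [set z | M z.1 z.2].

Definition op_fun (f : H -> H) : H -> set H := fun x => [set f x].

Definition op_add M N : H -> set H :=
  fun x => [set u + v | u in M x & v in N x].

Definition op_scale (rho : R) M : H -> set H :=
  fun x => [set rho *: u | u in M x].

Definition op_inv M : H -> set H := fun u => [set x | M x u].

Definition zer M : set H := [set x | M x 0].

Definition fix_set (T : H -> H) : set H := [set x | T x = x].

Definition monotone_op ip M :=
  forall x y u v, M x u -> M y v -> 0 <= ip (u - v) (x - y).

Definition maximally_monotone ip M :=
  monotone_op ip M /\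
  forall N, monotone_op ip N -> graph M `<=` graph N -> graph N = graph M.

(* The set-valued resolvent (I + rho M)^-1, read as a map: for M maximally
   monotone and rho > 0 every value of it is a singleton (Minty), so that the
   default value 0 is never used. *)
Definition resolvent (rho : R) M (x : H) : H :=
  xget 0 (op_inv (op_add (op_fun idfun) (op_scale rho M)) x).

End SetValuedOperators.

Section Bochner.
Context d (X : measurableType d) (R : realType) (V : completeNormedModType R).
Variable mu : probability X R.
Local Open Scope ereal_scope.

Definition simple_map (s : X -> V) :=
  finite_set (range s) /\ forall v, measurable (s @^-1` [set v]).

Definition simple_integral (s : X -> V) : V :=
  (\sum_(v \in range s) fine (mu (s @^-1` [set v])) *: v)%R.

(* Measurability is strong measurability: f is the mu-almost everywhere limit
   of simple maps. *)
Definition has_bochner_integral (f : X -> V) (v : V) :=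
  exists s : nat -> X -> V,
  [/\ forall n, simple_map (s n),
      {ae mu, forall x, s n x @[n --> \oo] --> f x},
      \int[mu]_x (`|f x - s n x|%R)%:E @[n --> \oo] --> 0
    & simple_integral (s n) @[n --> \oo] --> v].

Definition bochner_integrable (f : X -> V) :=
  exists v, has_bochner_integral f v.

(* The limit v does not depend on the approximating maps; the value is 0 when f
   is not integrable. *)
Definition bochner_integral (f : X -> V) : V :=
  xget 0%R [set v | has_bochner_integral f v].

End Bochner.

Section Probability.
Context dO dX (Omega : measurableType dO) (Xi : measurableType dX).
Context (R : realType) (P : probability Omega R).
Implicit Types (I : set nat) (xi : nat -> {RV P >-> Xi}).
Local Open Scope ereal_scope.

Definition identically_distributed (D : probability Xi R) I xi :=
  forall k, I k ->
  forall E, measurable E -> distribution P (xi k) E = D E.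

Definition mutually_independent I xi :=
  forall (J : {fset nat}) (E : nat -> set Xi),
    [set` J] `<=` I -> (forall k, measurable (E k)) ->
    P (\bigcap_(k in [set` J]) (xi k @^-1` E k)) =
    \prod_(k <- J) P (xi k @^-1` E k).

Definition iid (D : probability Xi R) I xi :=
  identically_distributed D I xi /\ mutually_independent I xi.

Definition sigma_generated I xi : set (set Omega) :=
  <<s \bigcup_(k in I) preimage_set_system setT (xi k) measurable >>.

Definition independent_of I xi (N : {RV P >-> nat}) :=
  forall (F : set Omega) (S : set nat), sigma_generated I xi F ->
    P (F `&` N @^-1` S) = P F * P (N @^-1` S).

Definition Lambda (l : nat -> R) (k : nat) : R :=
  (\prod_(i < k) (1 + 2 * l i ^+ 2)^-1)%R.

Definition index_weight (l : nat -> R) (k : nat) : R :=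
  (Lambda l k.+1 * l k * (1 - l k))%R.

(* N is the random index of horizon K for the parameters l, drawn
   independently of the samples (xi_k), k in I. *)
Definition random_index I xi (l : nat -> R) (K : nat) (N : {RV P >-> nat}) :=
  [/\ forall w, (N w < K)%N,
      independent_of I xi N
    & forall k, (k < K)%N ->
      P (N @^-1` [set k]) =
      (index_weight l k / \sum_(j < K) index_weight l j)%:E].

End Probability.

Section Algorithm.
Context dX (Xi : measurableType dX) (R : realType).
Context (H : completeNormedModType R).
Context (A B : H -> set H) (Cxi : Xi -> H -> H) (rho : R).

Definition T_xi (xi : Xi) (x : H) : H :=
  let JA := resolvent rho A in
  let JB := resolvent rho B in
  x - JA x + JB (2 *: JA x - x - rho *: Cxi xi (JA x)).

Definition T_mean (D : probability Xi R) (x : H) : H :=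
  bochner_integral D (fun xi => T_xi xi x).

Fixpoint iterate (x0 : H) (l : nat -> R) (s : nat -> Xi) (k : nat) : H :=
  if k is j.+1 then
    let x := iterate x0 l s j in
    let y := resolvent rho A x in
    let z := resolvent rho B (2 *: y - x - rho *: Cxi (s j) y) in
    x - l j *: (y - z)
  else x0.

End Algorithm.

(* u K <= O(v K) as K tends to infinity. *)
Definition le_bigO (R : realType) (u : nat -> \bar R) (v : nat -> R) :=
  exists c : R, \forall K \near \oo, (u K <= (c * v K)%:E)%E.

(* Main.v *)
Require Import Defs.
From HB Require Import structures.
From mathcomp Require Import all_boot all_order all_algebra finmap.
From mathcomp Require Import all_classical all_reals all_analysis.
From mathcomp Require Import measurable_realfun ring lra.

(** Because the graph of [B] is convex, its resolvent is affine, so it commutes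
    with the expectation over [xi]: the mean [T] of the maps [T_xi] is the
    Davis-Yin operator of the mean operator [C]. Each [T_xi] is nonexpansive,
    and [|T_xi p0 - p0|] is at most [rho |(C - C_xi) (JA p0)|]. Hence, for any
    [y] determined by the samples drawn before step [k], with
    [x' = x_k - l (x_k - T_xi x_k)] and [y' = y - l (y - T y)],

      [E|x' - y'|^2 + l (1 - l) E|(T x_k - x_k) - (T y - y)|^2
         <= E|x_k - y|^2 + l^2 (2 E|x_k - p0|^2 + 2 rho^2 sigma^2)].

    - [y = p0] bounds the second moments of [x_k] and the weighted sum of
      [E|T x_k - x_k|^2], which gives the rates for the random index.
    - If [y] is the deterministic iteration of [T] restarted at [x_m] (the
      "shadow" of [x]), then [E|x_(m+j) - y_j|^2] is of the order of the tail sum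
      of the [l_k^2], while [|T y_j - y_j|^2] is at most [|x_m - p0|^2] over the
      sum of the [l_k (1 - l_k)]: these are the rates for the last iterate, with
      [m = 0] for the constant schedule and [m = K / 2] for the decreasing one.
    - The maximal version of the same bound shows that almost surely [x]
      is shadowed, from some [m] on, up to any accuracy. Each shadow is Fejer
      monotone with vanishing residual, so [|x_n - q|] converges for every fixed
      point [q] and [T x_n - x_n -> 0]; weak convergence is then Opial's argument,
      with asymptotic centres in place of weak sequential compactness. *)

Set Implicit Arguments.
Unset Strict Implicit.
Unset Printing Implicit Defensive.

Import Order.TTheory GRing.Theory Num.Theory.
Import numFieldNormedType.Exports HBNNSimple.

Local Open Scope classical_set_scope.
Local Open Scope ring_scope.

(** * Inner products *)

(** The Fejer-type inequality for [x_k] alone only makes a weighted sum of squared residuals finite,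
    so it gives a vanishing lower limit and no rate for the last iterate: the residual of the
    stochastic iterate is not monotone. That of a deterministic orbit is, and the one-step
    inequality with a moving [y] compares the two orbits. It also makes the almost sure part
    pathwise: one null set serves all fixed points, with no martingale convergence theorem and no
    dense set of fixed points. The constants come from the variance being controlled at [p0] only:
    nonexpansiveness of [T_xi] transports the bound to [x] at the price of [2 |x - p0|^2], hence the
    factors [1 + 2 l_k^2] whose inverses form [Lambda]. The samples are cocoercive and measurable
    only up to null sets. The argument runs on a version [Cv] of [Cxi] that is cocoercive everywhere
    and measurable; the original iterates agree with the resulting ones almost surely. Conditional
    expectations are replaced by integrals over the product of the past and the fresh sample. *)

Section Hilbert.
Context (R : realType) (H : completeNormedModType R) (ip : {dot H for idfun}).
Hypothesis ipH : hilbert_norm ip.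
Implicit Types (x y z u v : H) (a b t : R).

Lemma ipDl x y z : ip (x + y) z = ip x z + ip y z.
Proof. exact: linearDl. Qed.
Lemma ipDr x y z : ip z (x + y) = ip z x + ip z y.
Proof. exact: linearDr. Qed.
Lemma ipNl x z : ip (- x) z = - ip x z.
Proof. exact: linearNl. Qed.
Lemma ipNr x z : ip z (- x) = - ip z x.
Proof. exact: linearNr. Qed.
Lemma ipZl a x z : ip (a *: x) z = a * ip x z.
Proof. exact: linearZl_LR. Qed.
Lemma ipZr a x z : ip z (a *: x) = a * ip z x.
Proof. by rewrite linearZr. Qed.
Lemma ip0l z : ip 0 z = 0.
Proof. exact: linear0l. Qed.
Lemma ip0r z : ip z 0 = 0.
Proof. exact: linear0r. Qed.
Lemma ipC x y : ip x y = ip y x.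
Proof. by rewrite hermC /= expr0 mul1r. Qed.

Definition ipE := (ipDl, ipDr, ipNl, ipNr, ipZl, ipZr, ip0l, ip0r).

Lemma ip_ge0 x : 0 <= ip x x.
Proof. by have [->|/neq0_dnorm_gt0/ltW//] := eqVneq x 0; rewrite ip0l. Qed.

Lemma normsq x : `|x| ^+ 2 = ip x x.
Proof. by rewrite ipH sqr_sqrtr ?ip_ge0. Qed.

Lemma ip_ext x y : (forall v, ip x v = ip y v) -> x = y.
Proof.
move=> xy; apply/eqP; rewrite -subr_eq0 -normr_eq0 -sqrf_eq0 normsq ipDl ipNl.
by rewrite xy subrr.
Qed.

Lemma ip_le_norm x y : ip x y <= `|x| * `|y|.
Proof.
have [->|y0] := eqVneq y 0; first by rewrite ip0r normr0 mulr0.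
have [->|x0] := eqVneq x 0; first by rewrite ip0l normr0 mul0r.
have := ip_ge0 (`|y| *: x - `|x| *: y); rewrite !ipE -!normsq (ipC y x).
have : 0 < `|x| by rewrite normr_gt0.
have : 0 < `|y| by rewrite normr_gt0.
move: `|x| `|y| (ip x y) => a b c b0 a0.
set X := (X in 0 <= X); have -> : X = 2 * (a * b) * (a * b - c) by rewrite /X; ring.
by rewrite pmulr_rge0 ?subr_ge0// mulr_gt0 ?mulr_gt0.
Qed.

Lemma abs_ip_le x y : `|ip x y| <= `|x| * `|y|.
Proof.
by rewrite ler_norml ip_le_norm andbT lerNl -ipNl (le_trans (ip_le_norm _ _))// normrN.
Qed.

Lemma normsqD x y : `|x + y| ^+ 2 = `|x| ^+ 2 + 2 * ip x y + `|y| ^+ 2.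
Proof. by rewrite !normsq !ipE (ipC y x); ring. Qed.

Lemma normsqB x y : `|x - y| ^+ 2 = `|x| ^+ 2 - 2 * ip x y + `|y| ^+ 2.
Proof. by rewrite normsqD ipNr normrN; ring. Qed.

Lemma normsqD_le x y : `|x + y| ^+ 2 <= 2 * `|x| ^+ 2 + 2 * `|y| ^+ 2.
Proof. by have := ip_ge0 (x - y); rewrite -normsq normsqB normsqD; lra. Qed.

Lemma normsqZ a x : `|a *: x| ^+ 2 = a ^+ 2 * `|x| ^+ 2.
Proof. by rewrite normrZ exprMn real_normK ?num_real. Qed.

Lemma ler_sqr_norm x y : `|x| ^+ 2 <= `|y| ^+ 2 -> `|x| <= `|y|.
Proof. by rewrite ler_sqr ?nnegrE. Qed.

Lemma ip_continuous_l v : continuous (fun x => ip x v).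
Proof.
move=> x; apply/cvgrPdist_le => /= e e0.
have v1 : 0 < `|v| + 1 by rewrite ltr_wpDl.
near=> y.
rewrite -ipNl -ipDl (le_trans (abs_ip_le _ _))//.
have : `|x - y| <= e / (`|v| + 1).
  near: y; apply: cvgr_dist_le => //; exact: divr_gt0.
rewrite ler_pdivlMr// => /(le_trans _); apply.
by rewrite ler_wpM2l// lerDl.
Unshelve. all: by end_near. Qed.

Lemma cvg_ip (T : Type) (F : set_system T) {FF : Filter F} (u : T -> H) x v :
  u @ F --> x -> ip (u n) v @[n --> F] --> ip x v.
Proof. by move=> ux; apply: (cvg_comp u (fun y => ip y v) ux); exact: ip_continuous_l. Qed.

Lemma cvg_normsq (T : Type) (F : set_system T) {FF : Filter F} (u : T -> H) x :
  u @ F --> x -> `|u n| ^+ 2 @[n --> F] --> `|x| ^+ 2.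
Proof. by move=> /cvg_norm ux; rewrite expr2; under eq_fun do rewrite expr2; exact: cvgM. Qed.

End Hilbert.

(* Linear identities between vectors, checked by pairing with a vector. *)
Ltac vec ipH := apply: (ip_ext ipH) => ?; rewrite !ipE; first [ring | lra].

(** Divide by [t] and let [t] tend to 0; the explicit [t = g / (g + k + 1)] already gives the
    contradiction. This turns minimality along segments into a first-order condition, in
    [minty_zero] and in [opial]. *)
Lemma first_order_le0 (R : realType) (g k : R) :
  (forall t, 0 < t -> t <= 1 -> t * g <= t ^+ 2 * k) -> g <= 0.
Proof.
move=> h; rewrite leNgt; apply/negP => g0.
have k0 : 0 <= k by have := h 1 ltr01 (lexx _); rewrite expr1n !mul1r; lra.
have s0 : 0 < g + k + 1 by lra.
have t0 : 0 < g / (g + k + 1) by exact: divr_gt0.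
have := h _ t0; rewrite ler_pdivrMr// mul1r expr2 -mulrA ler_pM2l//.
have -> : g <= g + k + 1 by lra.
by move=> /(_ isT); rewrite mulrAC ler_pdivlMr//; nra.
Qed.

(** * Minty's theorem and resolvents *)

(** The relation [Q] is the epigraph of a function that may be infinite: [Q a r] stands for
    [f a <= r]. Strong midpoint convexity makes every minimising sequence Cauchy, and the last
    hypothesis is lower semicontinuity along it. Completeness is a hypothesis on sequences because
    the space is [H] in one use and the product [H * H] in the other. *)
Lemma strongly_convex_min (R : realType) (V : normedModType R)
    (Q : V -> R -> Prop) (k : R) :
  (forall u : nat -> V, cauchy (u @ \oo) -> cvg (u @ \oo)) ->
  0 < k -> (exists a r, Q a r) -> (forall a r, Q a r -> 0 <= r) ->
  (forall a r s, Q a r -> r <= s -> Q a s) ->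
  (forall a b r s, Q a r -> Q b s ->
     Q (2^-1 *: (a + b)) ((r + s) / 2 - k * `|a - b| ^+ 2)) ->
  (forall (u : nat -> V) a r, u @ \oo --> a ->
     (forall n, Q (u n) (r + n.+1%:R^-1)) -> Q a r) ->
  exists c r, Q c r /\ forall b s, Q b s -> r <= s.
Proof.
move=> Vc k0 [a0 [r0 Q0]] Qge0 Qmono Qmid Qcl.
pose S : set R := [set r | exists a, Q a r].
have Sinf : has_inf S.
  by split; [exists r0, a0|exists 0 => r [a /Qge0]].
pose r := inf S.
have rle s b : Q b s -> r <= s by move=> Qb; apply: ge_inf; [exact: Sinf.2|exists b].
have /choice[u uQ] (n : nat) : exists a, Q a (r + n.+1%:R^-1).
  have n0 : 0 < n.+1%:R^-1 :> R by rewrite invr_gt0.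
  have [s [a Qa] sr] := inf_adherent n0 Sinf.
  by exists a; apply: Qmono Qa _; exact: ltW.
have uc : cvg (u @ \oo).
  apply: Vc; apply: cauchy_exP => e e0.
  have ke0 : 0 < k * e ^+ 2 by rewrite mulr_gt0// exprn_gt0.
  have [N _ HN] := near_infty_natSinv_lt (PosNum ke0).
  exists (u N), N => // n /= Nn; rewrite -ball_normE /=.
  have uQn : Q (u n) (r + N.+1%:R^-1).
    by apply: Qmono (uQ n) _; rewrite lerD2l lef_pV2 ?posrE// ler_nat.
  have /rle := Qmid _ _ _ _ (uQ N) uQn.
  have /= := HN N (leqnn N); set d := N.+1%:R^-1 => d1 d2.
  have : k * `|u N - u n| ^+ 2 < k * e ^+ 2 by lra.
  by rewrite ltr_pM2l// ltr_sqr ?nnegrE// ltW.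
exists (lim (u @ \oo)), r; split; last by move=> b s /rle.
exact: Qcl uc uQ.
Qed.

(** The Fitzpatrick function of [M] dominates the pairing of the two components ([FQ]), so with half
    the squared norm added it is nonnegative and strongly convex, and its minimum is reached by norm
    convergence alone. At the minimiser [(x0, u0)], optimality towards the points of [M] ([opt])
    says that [(- u0, - x0)] is monotonically related to [M], hence belongs to it; optimality at
    that point then forces [u0 = - x0]. *)
Lemma minty_zero (R : realType) (H : completeNormedModType R)
    (ip : {dot H for idfun}) (ipH : hilbert_norm ip) (M : set (H * H)) :
  M !=set0 ->
  (forall z z', M z -> M z' -> 0 <= ip (z.2 - z'.2) (z.1 - z'.1)) ->
  (forall x u, (forall z, M z -> 0 <= ip (u - z.2) (x - z.1)) -> M (x, u)) ->
  exists x, M (x, - x).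
Proof.
move=> M0 Mmon Mmax.
(* [Q z r]: the Fitzpatrick function of [M] at [z] plus [|z|^2 / 2] is at most [r]. *)
pose Q (z : H * H) (r : R) := forall m, M m ->
  ip z.1 m.2 + ip m.1 z.2 - ip m.1 m.2 + (`|z.1| ^+ 2 + `|z.2| ^+ 2) / 2 <= r.
have FQ z r : Q z r -> ip z.1 z.2 + (`|z.1| ^+ 2 + `|z.2| ^+ 2) / 2 <= r.
  move=> Qz; case: (pselect (M z)) => [/Qz|nM].
    by apply: le_trans; rewrite lerD2r; lra.
  have : exists2 m, M m & ip (z.2 - m.2) (z.1 - m.1) < 0.
    apply: contrapT => nm; apply: nM; case: z {Qz} nm => x u nm.
    apply: Mmax => m Mm; rewrite leNgt; apply/negP => neg; apply: nm.
    by exists m.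
  move=> [m /Qz Qm]; rewrite !ipE.
  rewrite (ipC ip z.2 z.1) (ipC ip m.2 z.1) (ipC ip z.2 m.1) (ipC ip m.2 m.1); lra.
have Qge0 z r : Q z r -> 0 <= r.
  move/FQ; apply: le_trans; have := ip_ge0 ip (z.1 + z.2).
  by rewrite -(normsq ipH) (normsqD ipH); lra.
have [z0 [r0 [Q0 Qmin]]] : exists c r, Q c r /\ forall b s, Q b s -> r <= s.
  apply: (@strongly_convex_min R (H * H)%type Q (1 / 8)) => //.
  - move=> u cu.
    have c1 : cvg ((fun n => (u n).1) @ \oo).
      apply: cauchy_cvg; apply: cauchy_exP => e e0.
      move/cauchyP : cu => /(_ _ e0)[x [N _ HN]]; exists x.1, N => // n /HN[].
      by [].
    have c2 : cvg ((fun n => (u n).2) @ \oo).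
      apply: cauchy_cvg; apply: cauchy_exP => e e0.
      move/cauchyP : cu => /(_ _ e0)[x [N _ HN]]; exists x.2, N => // n /HN[].
      by [].
    apply/cvg_ex; exists (lim ((fun n => (u n).1) @ \oo), lim ((fun n => (u n).2) @ \oo)).
    rewrite [X in X @ _ --> _](_ : u = fun n => ((u n).1, (u n).2)); last first.
      by apply/funext => n; case: (u n).
    exact: cvg_pair.
  - have [m Mm] := M0.
    exists m, (ip m.1 m.2 + (`|m.1| ^+ 2 + `|m.2| ^+ 2) / 2) => m' /(Mmon _ _ Mm).
    rewrite !ipE (ipC ip m.2 m.1) (ipC ip m'.2 m.1) (ipC ip m.2 m'.1).
    by rewrite (ipC ip m'.2 m'.1); lra.
  - by move=> a r s Qa rs m /Qa /le_trans; apply.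
  - move=> a b r s Qa Qb m Mm; have := Qa _ Mm; have := Qb _ Mm => /=.
    rewrite !(normsqZ, ipE) !(normsqD ipH).
    (* The product carries the maximum norm, whose square is at most the sum of the two squares. The
       constant 1/8 is the exact midpoint gain of half of that sum. *)
    have : `|a - b| ^+ 2 <= `|a.1 - b.1| ^+ 2 + `|a.2 - b.2| ^+ 2.
      rewrite prod_normE /= maxEle.
      by case: ifP => _; [rewrite lerDr|rewrite lerDl]; exact: sqr_ge0.
    by rewrite !(normsqB ipH); lra.
  - move=> u a r ua Qu m Mm.
    have u1 : (u n).1 @[n --> \oo] --> a.1 by exact: cvg_comp ua cvg_fst.
    have u2 : (u n).2 @[n --> \oo] --> a.2 by exact: cvg_comp ua cvg_snd.
    pose f n := ip (u n).1 m.2 + ip (u n).2 m.1 - ip m.1 m.2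
         + (`|(u n).1| ^+ 2 + `|(u n).2| ^+ 2) / 2 - n.+1%:R^-1.
    have : f n @[n --> \oo] --> ip a.1 m.2 + ip a.2 m.1 - ip m.1 m.2
         + (`|a.1| ^+ 2 + `|a.2| ^+ 2) / 2 - 0.
      apply: cvgB; last exact: cvg_harmonic.
      apply: cvgD.
        apply: cvgB; last exact: cvg_cst.
        by apply: cvgD; exact: cvg_ip.
      by apply: cvgMl; apply: cvgD; exact: cvg_normsq.
    move=> fc; rewrite (ipC ip m.1 a.2) -[X in X <= _]subr0.
    apply: (cvgr_to_le fc).
    apply: nearW => n; have := Qu n m Mm; rewrite /f (ipC ip m.1 (u n).2).
    by move: n.+1%:R^-1 => d; lra.
have Fz0 := FQ _ _ Q0.
have opt m : M m -> 
  ip z0.1 z0.2 + (`|z0.1| ^+ 2 + `|z0.2| ^+ 2) <= ip m.1 m.2 + ip z0.1 m.1 + ip z0.2 m.2.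
  move=> Mm; set c := ip m.1 m.2.
  set n0 := `|z0.1| ^+ 2 + `|z0.2| ^+ 2.
  suff : r0 + n0 / 2 - (c + ip z0.1 m.1 + ip z0.2 m.2) <= 0 by rewrite -/n0 in Fz0; lra.
  apply: (@first_order_le0 _ _ ((`|z0.1 - m.1| ^+ 2 + `|z0.2 - m.2| ^+ 2) / 2)) => t t0 t1.
  (* Convexity of the Fitzpatrick function: its value at [z0] is at most [r0 - n0 / 2], and at the
     point [m] of [M] it is at most [c], by monotonicity. *)
  have : Q ((1 - t) *: z0 + t *: m) ((1 - t) * (r0 - n0 / 2) + t * c
      + (`|(1 - t) *: z0.1 + t *: m.1| ^+ 2 + `|(1 - t) *: z0.2 + t *: m.2| ^+ 2) / 2).
    move=> m' Mm'; rewrite lerD2r /= !ipE.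
    have h1 := Q0 _ Mm'; have := Mmon _ _ Mm Mm'; rewrite !ipE => h2.
    have {}h2 : ip m.1 m'.2 + ip m'.1 m.2 - ip m'.1 m'.2 <= c.
      by rewrite /c (ipC ip m'.1 m.2) (ipC ip m.1 m'.2) (ipC ip m'.1 m'.2) (ipC ip m.1); lra.
    have {}h1 : ip z0.1 m'.2 + ip m'.1 z0.2 - ip m'.1 m'.2 <= r0 - n0 / 2.
      by move: h1; rewrite -/n0; lra.
    have t2 : 0 <= 1 - t by lra.
    have := ler_wpM2l t2 h1; have := ler_wpM2l (ltW t0) h2; lra.
  move/Qmin; rewrite !(normsqB ipH) !(normsqD ipH) !normsqZ !ipE /n0.
  by move: `|z0.1| `|z0.2| `|m.1| `|m.2| => x1 x2 x3 x4; lra.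
case: z0 => x0 u0 /= in Fz0 opt Q0 *.
have Mz : M (- u0, - x0).
  apply: Mmax => m Mm; have := opt _ Mm; have := ip_ge0 ip (x0 + u0).
  rewrite !ipE -!(normsq ipH) !(ipC ip u0 x0) (ipC ip m.2 m.1) (ipC ip m.2 u0); lra.
have := opt _ Mz; rewrite /= !ipE !(ipC ip u0 x0) => h.
have /eqP : `|x0 + u0| ^+ 2 = 0.
  by apply/eqP; rewrite eq_le sqr_ge0 andbT (normsqD ipH); lra.
rewrite sqrf_eq0 normr_eq0 addr_eq0 => /eqP x0u0.
by exists x0; move: Mz; rewrite {1}x0u0 opprK x0u0 opprK.
Qed.

Section Resolvent.
Context (R : realType) (H : completeNormedModType R) (ip : {dot H for idfun}).
Hypothesis ipH : hilbert_norm ip.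
Implicit Types (M : H -> set H) (x y u v : H).

Lemma maximally_monotone_mem M x u : maximally_monotone ip M ->
  (forall y v, M y v -> 0 <= ip (u - v) (x - y)) -> M x u.
Proof.
move=> [Mmon Mmax] xu.
pose N y : set H := M y `|` [set v | y = x /\ v = u].
have Nmon : monotone_op ip N.
  move=> y y' v v' [Mv|[-> ->]] [Mv'|[-> ->]].
  - exact: Mmon.
  - by rewrite -opprB -[y - x]opprB !ipE opprK -!ipE; have := xu _ _ Mv; rewrite !ipE; lra.
  - exact: xu.
  - by rewrite subrr ip0l.
have MN : graph M `<=` graph N by move=> z Mz; left.
have : graph N (x, u) by right.
by rewrite (Mmax _ Nmon MN).
Qed.

Lemma maximally_monotone_neq0 M : maximally_monotone ip M ->
  exists x u, M x u.
Proof.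
move=> Mm; have [//|M0] := pselect (exists x u, M x u); exists 0, 0.
apply: (maximally_monotone_mem Mm) => y v Mv; case: M0.
by exists y, v.
Qed.

Variables (M : H -> set H) (rho : R).
Hypotheses (Mm : maximally_monotone ip M) (rho0 : 0 < rho).
Local Notation J := (resolvent rho M).

Lemma minty x : exists y, M y (rho^-1 *: (x - y)).
Proof.
have [y [v Myv]] := maximally_monotone_neq0 Mm.
(* Scaling by [rho] and translating by [x] turns the inclusion into [- y] belonging to [M' y]. *)
pose M' : set (H * H) := [set z | exists2 w, M z.1 w & z.2 = rho *: w - x].
have [|z z'|p q pq|z] := @minty_zero R H ip ipH M'.
- by exists (y, rho *: v - x), v.
- move=> [w Mw ->] [w' Mw' ->]; have := Mm.1 _ _ _ _ Mw Mw'.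
  rewrite !ipE => h; have := mulr_ge0 (ltW rho0) h; lra.
- exists (rho^-1 *: (q + x)); last by rewrite /= scalerA divff ?gt_eqF// scale1r addrK.
  apply: (maximally_monotone_mem Mm) => p' w Mw.
  have := pq (p', rho *: w - x) (ex_intro2 _ _ w Mw erefl) => /= h.
  rewrite -(pmulr_rge0 _ rho0) -ipZl scalerBr scalerA divff ?gt_eqF// scale1r.
  by rewrite opprB addrA addrAC in h *.
- move=> [w /= Mw zw]; exists z; congr M : Mw.
  by rewrite zw addrC subrK scalerA mulVf ?gt_eqF// scale1r.
Qed.

Lemma mem_op_invE x y :
  op_inv (op_add (op_fun idfun) (op_scale rho M)) x y <-> M y (rho^-1 *: (x - y)).
Proof.
split=> [[_ -> [_ [w Mw <-] <-]]|My].
  by rewrite addrC addKr scalerA mulVf ?gt_eqF// scale1r.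
exists y => //; exists (x - y); last by rewrite addrC subrK.
by exists (rho^-1 *: (x - y)) => //; rewrite scalerA divff ?gt_eqF// scale1r.
Qed.

Lemma resolventP x : M (J x) (rho^-1 *: (x - J x)).
Proof.
apply/mem_op_invE; rewrite /resolvent; case: xgetP => // nM.
by have [y /mem_op_invE /nM] := minty x.
Qed.

Lemma resolvent_firm x y : `|J x - J y| ^+ 2 <= ip (J x - J y) (x - y).
Proof.
have := Mm.1 _ _ _ _ (resolventP x) (resolventP y).
rewrite -scalerBr ipZl pmulr_rge0 ?invr_gt0// (normsq ipH) !ipE.
by rewrite !(ipC ip _ (J x)) !(ipC ip _ (J y)) (ipC ip (J y) (J x)); lra.
Qed.

Lemma resolvent_nonexpansive x y : `|J x - J y| <= `|x - y|.
Proof.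
have := le_trans (resolvent_firm x y) (ip_le_norm ipH _ _).
have [->|Jxy] := eqVneq (J x - J y) 0; first by rewrite normr0.
by rewrite expr2 ler_pM2l// normr_gt0.
Qed.

Lemma resolvent_unique x y : M y (rho^-1 *: (x - y)) -> J x = y.
Proof.
move=> My; have := Mm.1 _ _ _ _ (resolventP x) My.
rewrite -scalerBr ipZl pmulr_rge0 ?invr_gt0//.
have -> : x - J x - (x - y) = - (J x - y) by rewrite !opprB addrC addrA subrK.
rewrite ipNl oppr_ge0 -(normsq ipH) => h.
apply/eqP; rewrite -subr_eq0 -normr_eq0 -sqrf_eq0.
by rewrite eq_le h sqr_ge0.
Qed.

(** Convexity of the graph puts the convex combination of the points [(J x, (x - J x) / rho)] and
    [(J y, (y - J y) / rho)] in it, and this combination is exactly the pair that characterises the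
    resolvent of the combined argument. *)
Lemma resolvent_affine : convex_set (graph M) -> forall t x y, 0 <= t -> t <= 1 ->
  J (t *: x + (1 - t) *: y) = t *: J x + (1 - t) *: J y.
Proof.
move=> Mconv t x y t0 t1; apply: resolvent_unique.
have := @Mconv (J x, rho^-1 *: (x - J x)) (J y, rho^-1 *: (y - J y)) (Itv01 t0 t1).
move=> /(_ (mem_set (resolventP x)) (mem_set (resolventP y)))/set_mem.
rewrite /graph; set z := conv _ _ _ => Mz.
have zE : z = (t *: J x + (1 - t) *: J y,
    t *: (rho^-1 *: (x - J x)) + (1 - t) *: (rho^-1 *: (y - J y))) by [].
rewrite zE /= in Mz; congr (M _ _) : Mz.
rewrite !(scalerA _ rho^-1) !(mulrC _ rho^-1) -!scalerA -scalerDr; congr (_ *: _).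
by rewrite !scalerBr opprD addrACA.
Qed.

End Resolvent.

Definition affine_map (R : realType) (H : lmodType R) (J : H -> H) := forall t x y,
  0 <= t -> t <= 1 -> J (t *: x + (1 - t) *: y) = t *: J x + (1 - t) *: J y.

(** Homogeneity for [t > 1] follows from the case [t^-1] applied to [t *: x]; additivity is the
    midpoint identity scaled by 2. Only nonnegative scalars are needed, since the scalars will be
    probabilities. *)
Lemma affine_map_linear (R : realType) (H : lmodType R) (J : H -> H) : affine_map J ->
  (forall t x, 0 <= t -> J (t *: x) - J 0 = t *: (J x - J 0)) /\
  (forall x y, J (x + y) - J 0 = (J x - J 0) + (J y - J 0)).
Proof.
move=> Jconv.
have J01 t x : 0 <= t -> t <= 1 -> J (t *: x) - J 0 = t *: (J x - J 0).
  move=> t0 t1; have := Jconv _ x 0 t0 t1; rewrite scaler0 addr0 => ->.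
  by rewrite scalerBl scale1r scalerBr -addrA addrAC subrr add0r.
have JZ t x : 0 <= t -> J (t *: x) - J 0 = t *: (J x - J 0).
  move=> t0; have [|/ltW t1] := leP t 1; first exact: J01.
  have tn0 : t != 0 by rewrite gt_eqF// (lt_le_trans ltr01).
  have ti0 : 0 <= t^-1 by rewrite invr_ge0.
  have ti1 : t^-1 <= 1 by rewrite invf_le1// (lt_le_trans ltr01).
  have := J01 _ (t *: x) ti0 ti1; rewrite scalerA mulVf// scale1r => ->.
  by rewrite scalerA divff// scale1r.
split=> // x y.
have h0 : 0 <= 2^-1 :> R by rewrite invr_ge0.
have h1 : 2^-1 <= 1 :> R by rewrite invf_le1// ler1n.
have := Jconv _ x y h0 h1; have -> : 1 - 2^-1 = 2^-1 :> R by lra.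
have -> : 2^-1 *: x + 2^-1 *: y = 2^-1 *: (x + y) by rewrite scalerDr.
move=> /(congr1 (fun z => z - J 0)); rewrite JZ// => /(congr1 (fun z => 2 *: z)).
rewrite scalerA divff ?pnatr_eq0// scale1r => ->.
rewrite scalerBr scalerDr !scalerA divff ?pnatr_eq0// !scale1r.
by rewrite scaler_nat mulr2n opprD addrACA.
Qed.

Lemma affine_map_sum (R : realType) (H : lmodType R) (J : H -> H) (I : Type) (r : seq I)
    (m : I -> R) (v : I -> H) : affine_map J ->
  (forall i, 0 <= m i) -> \sum_(i <- r) m i = 1 ->
  J (\sum_(i <- r) m i *: v i) = \sum_(i <- r) m i *: J (v i).
Proof.
move=> /affine_map_linear[JZ JD] m0 m1.
have h s : J (\sum_(i <- s) m i *: v i) - J 0 = \sum_(i <- s) m i *: (J (v i) - J 0).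
  elim: s => [|i s IH]; first by rewrite !big_nil subrr.
  by rewrite !big_cons JD JZ// IH.
apply/eqP; rewrite -(inj_eq (addIr (- J 0))) h.
under eq_bigr do rewrite scalerBr.
by rewrite sumrB -scaler_suml m1 scale1r.
Qed.

(** * The Davis-Yin operator *)

Definition nonexpansive (R : realType) (H : normedModType R) (T : H -> H) :=
  forall x y, `|T x - T y| <= `|x - y|.

Section DavisYin.
Context (R : realType) (H : completeNormedModType R) (ip : {dot H for idfun}).
Hypothesis ipH : hilbert_norm ip.
Variables (A B : H -> set H) (tau rho : R).
Hypotheses (Am : maximally_monotone ip A) (Bm : maximally_monotone ip B).
Hypotheses (rho0 : 0 < rho) (rho2 : rho <= 2 * tau).
Local Notation JA := (resolvent rho A).
Local Notation JB := (resolvent rho B).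
Implicit Types (x y z : H) (c : H -> H).

Definition davis_yin c x := x - JA x + JB (2 *: JA x - x - rho *: c (JA x)).

Lemma davis_yin_nonexpansive c : cocoercive ip tau c -> nonexpansive (davis_yin c).
Proof.
move=> cc x x'; apply: ler_sqr_norm.
have := resolvent_firm ipH Am rho0 x x'; have := cc (JA x) (JA x').
rewrite /davis_yin; set w := (X in JB X); set w' := (X in _ - (_ + JB X)).
have := resolvent_firm ipH Bm rho0 w w'.
set y := JA x - JA x'; set d := c (JA x) - c (JA x'); set z := JB w - JB w'.
have -> : w - w' = 2 *: y - (x - x') - rho *: d.
  rewrite /w /w' /y /d !scalerBr !opprD !opprK.
  by rewrite addrACA; congr (_ + _); rewrite addrACA; congr (_ + _).
have -> : x - JA x + JB w - (x' - JA x' + JB w') = (x - x') - y + z.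
  by rewrite opprD addrACA /y /z; congr (_ + _); rewrite opprD addrACA -opprD.
move: (x - x') => a; move: y d z => y d z h1 h2 h3.
(* Twice the two firm inequalities bound [|a - y + z|^2] by [|a|^2 - |y - z - rho d|^2 + rho^2 |d|^2
   - 2 rho <y, d>]. Cocoercivity and [rho <= 2 tau] make the sum of the last two terms
   nonpositive. *)
have h4 := sqr_ge0 (`|y - z - rho *: d|).
move: h1 h2 h3 h4; rewrite !(normsqB ipH, normsqD ipH) normsqZ !ipE.
rewrite (ipC ip z y) (ipC ip z a) (ipC ip y a) (ipC ip d y) (ipC ip z d) => h1 h2 h3 h4.
have h5 : rho * (tau * `|d| ^+ 2) <= rho * ip y d by rewrite ler_pM2l.
have h6 : rho * (rho * `|d| ^+ 2) <= rho * (2 * tau * `|d| ^+ 2).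
  by rewrite ler_pM2l// ler_wpM2r// sqr_ge0.
move: rho0 rho2 h1 h2 h3 h4 h5 h6; clear; rewrite !(ipC ip d z); move: `|_| `|d| => n1 n2; lra.
Qed.

Lemma zer_davis_yin c p : davis_yin c p = p ->
  zer (op_add (op_add A B) (op_fun c)) (JA p).
Proof.
rewrite /davis_yin; set y := JA p => /(congr1 (fun z => z - (p - y))).
rewrite [X in X = _]addrC addKr opprB addrCA subrr addr0 => JBw.
have Ay := resolventP ipH Am rho0 p; rewrite -/y in Ay.
have := resolventP ipH Bm rho0 (2 *: y - p - rho *: c y); rewrite JBw => By.
exists (- c y); last by exists (c y) => //; rewrite addNr.
exists (rho^-1 *: (p - y)) => //; exists (rho^-1 *: (2 *: y - p - rho *: c y - y)) => //.
rewrite -scalerDr scaler_nat mulr2n (addrAC _ (- (rho *: _))) (addrAC _ (- p)) addrK.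
by rewrite addrA subrKA subrr add0r scalerN scalerA mulVf ?gt_eqF// scale1r.
Qed.
End DavisYin.

(** * Krasnoselskii-Mann iterations *)

Section Krasnoselskii.
Context (R : realType) (H : completeNormedModType R) (ip : {dot H for idfun}).
Hypothesis ipH : hilbert_norm ip.
Variable T : H -> H.
Hypothesis Tne : nonexpansive T.
Implicit Types (x y z p v : H) (t e : R) (l : nat -> R).

Definition km (t : R) x := x - t *: (x - T x).

(** The index [m] is the restart time: going from [j] to [j + 1] uses [l (m + j)], the parameter
    that the stochastic iteration uses between times [m + j] and [m + j + 1]. *)
Fixpoint km_iter l m x j :=
  if j is i.+1 then km (l (m + i)%N) (km_iter l m x i) else x.

Lemma residual_lipschitz x y :
  `|T x - x| <= `|T y - y| + 2 * `|x - y|.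
Proof.
have -> : T x - x = (T y - y) + (T x - T y) - (x - y).
  by vec ipH.
have := ler_normB ((T y - y) + (T x - T y)) (x - y).
have := ler_normD (T y - y) (T x - T y); have := Tne x y.
lra.
Qed.

(** With [a = x - y] and [d] the difference of the two residuals, nonexpansiveness reads
    [2 <a, d> <= - |d|^2]; substitute this in the expansion of [|a + t d|^2]. *)
Lemma km_dist t x y : 0 <= t ->
  `|km t x - km t y| ^+ 2 + t * (1 - t) * `|(T x - x) - (T y - y)| ^+ 2 <=
  `|x - y| ^+ 2.
Proof.
move=> t0; have : `|T x - T y| ^+ 2 <= `|x - y| ^+ 2 by rewrite ler_sqr ?nnegrE.
have -> : T x - T y = (x - y) + ((T x - x) - (T y - y)).
  by vec ipH.
have -> : km t x - km t y = (x - y) + t *: ((T x - x) - (T y - y)).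
  by rewrite /km; vec ipH.
move: (x - y) ((T x - x) - _) => a d; rewrite !(normsqD ipH) normsqZ ipZr.
by have := sqr_ge0 `|d|; nra.
Qed.

Lemma km_residual t x : 0 <= t -> t <= 1 ->
  `|T (km t x) - km t x| <= `|T x - x|.
Proof.
move=> t0 t1.
have -> : T (km t x) - km t x = (T (km t x) - T x) + (1 - t) *: (T x - x).
  by move: (T (km t x)) => Tk; rewrite /km; vec ipH.
rewrite (le_trans (ler_normD _ _))// (le_trans (lerD (Tne _ _) (lexx _)))//.
have -> : km t x - x = t *: (T x - x) by rewrite /km; vec ipH.
rewrite !normrZ (ger0_norm t0) ger0_norm ?subr_ge0//.
by lra.
Qed.

(** Residuals decrease along the orbit ([km_residual]), so the last one may replace all the earlier
    ones in the telescoped sum of [km_dist]. *)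
Lemma km_iter_residual l m x p j : T p = p -> (forall n, 0 <= l n <= 1) ->
  `|km_iter l m x j - p| ^+ 2 +
  (\sum_(m <= k < m + j) l k * (1 - l k)) *
    `|T (km_iter l m x j) - km_iter l m x j| ^+ 2 <= `|x - p| ^+ 2.
Proof.
move=> Tp l01; elim: j => [|j IH] /=; first by rewrite addn0 big_geq// mul0r addr0.
apply: le_trans IH; rewrite addnS big_nat_recr ?leq_addr//=.
set x' := km_iter l m x j; have /andP[t0 t1] := l01 (m + j)%N.
move: (l (m + j)%N) t0 t1 => t t0 t1.
have := km_dist x' p t0; rewrite {2}/km Tp subrr scaler0 !subr0.
have s0 : 0 <= \sum_(m <= k < m + j) l k * (1 - l k).
  by apply: sumr_ge0 => k _; have /andP[? ?] := l01 k; rewrite mulr_ge0// subr_ge0.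
have : `|T (km t x') - km t x'| ^+ 2 <= `|T x' - x'| ^+ 2.
  by rewrite ler_sqr ?nnegrE// km_residual.
move=> h1 h2; have := ler_wpM2l s0 h1.
have t2 : 0 <= t * (1 - t) by rewrite mulr_ge0// subr_ge0.
have := ler_wpM2l t2 h1; lra.
Qed.

Lemma km_iter_dist l m x p : T p = p -> (forall n, 0 <= l n <= 1) ->
  nonincreasing_seq (fun j => `|km_iter l m x j - p|).
Proof.
move=> Tp l01; apply/nonincreasing_seqP => j /=; apply: ler_sqr_norm.
have /andP[t0 t1] := l01 (m + j)%N.
have := km_dist (km_iter l m x j) p t0; rewrite {2}/km Tp subrr scaler0 !subr0.
apply: le_trans; rewrite lerDl mulr_ge0 ?sqr_ge0// mulr_ge0// subr_ge0//.
Qed.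

End Krasnoselskii.

(** * Asymptotic centres and weak convergence *)

Section Opial.
Context (R : realType) (H : completeNormedModType R) (ip : {dot H for idfun}).
Hypothesis ipH : hilbert_norm ip.
Implicit Types (u x : nat -> H) (y z p v c : H) (r s e K : R).

(* [limsup_n |u n - y|^2 <= r] *)
Definition asymptotic_le u y r :=
  forall e, 0 < e -> \forall n \near \oo, `|u n - y| ^+ 2 <= r + e.

Lemma sqr_perturb_le (a a' d k r e : R) : 0 <= a -> 0 <= a' -> 0 <= d -> d <= 1 ->
  a <= k -> d * (2 * k + 1) <= e / 2 -> a ^+ 2 <= r + e / 2 -> a' <= a + d ->
  a' ^+ 2 <= r + e.
Proof.
move=> a0 a'0 d0 d1 ak dk ar a'a.
have : a' ^+ 2 <= (a + d) ^+ 2 by rewrite ler_sqr ?nnegrE// addr_ge0.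
have : d * a <= d * k by rewrite ler_wpM2l.
have : d ^+ 2 <= d by rewrite expr2 ler_piMl.
lra.
Qed.

Lemma asymptotic_le_perturb u y z r (d : nat -> R) (b : R) :
  asymptotic_le u y r -> (forall n, `|u n| <= b) ->
  (forall n, `|u n - z| <= `|u n - y| + `|d n|) ->
  d n @[n --> \oo] --> 0 -> asymptotic_le u z r.
Proof.
move=> uyr ub ud d0 e e0.
pose k := b + `|y|.
have b0 : 0 <= b by rewrite (le_trans _ (ub 0%N)).
have k0 : 0 < 2 * k + 1 by rewrite /k; have := normr_ge0 y; lra.
have e2 : 0 < e / 2 by rewrite divr_gt0.
have ek : 0 < Num.min 1 (e / 2 / (2 * k + 1)) by rewrite lt_min ltr01 divr_gt0.
near=> n.
have : `|d n| <= Num.min 1 (e / 2 / (2 * k + 1)).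
  by near: n; exact: cvgr0_norm_le ek.
rewrite le_min ler_pdivlMr// => /andP[d1 d2].
apply: (sqr_perturb_le _ _ _ d1 _ d2 _ (ud n)) => //.
- by rewrite (le_trans (ler_normB _ _))// lerD2r.
- by near: n; exact: uyr.
Unshelve. all: by end_near. Qed.

(** The upper limit of [|u n - y|^2] is strongly convex in [y], so it has a unique minimiser [c]. As
    [u] is asymptotically fixed by the nonexpansive [T], the point [T c] does at least as well as
    [c]; the midpoint of the two would do strictly better unless [T c = c]. This also takes the
    place of demiclosedness. *)
Lemma asymptotic_center u (T : H -> H) b : nonexpansive T ->
  (forall n, `|u n| <= b) -> `|T (u n) - u n| @[n --> \oo] --> 0 ->
  exists c r, [/\ T c = c, asymptotic_le u c r
    & forall y s, asymptotic_le u y s -> r <= s].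
Proof.
move=> Tne ub uT.
have mono a r s : asymptotic_le u a r -> r <= s -> asymptotic_le u a s.
  by move=> ua rs e /ua; apply: filterS => n /le_trans; apply; rewrite lerD2r.
have mid a c r s : asymptotic_le u a r -> asymptotic_le u c s ->
     asymptotic_le u (2^-1 *: (a + c)) ((r + s) / 2 - 4^-1 * `|a - c| ^+ 2).
  move=> ua uc e e0; near=> n.
  have : `|u n - a| ^+ 2 <= r + e by near: n; exact: ua.
  have : `|u n - c| ^+ 2 <= s + e by near: n; exact: uc.
  have -> : u n - 2^-1 *: (a + c) = 2^-1 *: ((u n - a) + (u n - c)) by vec ipH.
  have -> : a - c = (u n - c) - (u n - a) by vec ipH.
  move: (u n - a) (u n - c) => p q.
  by rewrite normsqZ (normsqB ipH) (normsqD ipH) (ipC ip q); lra.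
have [c [r [cr rmin]]] : exists c r, asymptotic_le u c r /\
    forall y s, asymptotic_le u y s -> r <= s.
  apply: (@strongly_convex_min R H (asymptotic_le u) 4^-1 _ _ _ _ mono mid _).
  - by move=> w; exact: cauchy_cvg.
  - by rewrite invr_gt0.
  - exists 0, (b ^+ 2) => e e0; apply: nearW => n; rewrite subr0.
    by have := normr_ge0 (u n); have := ub n; move: e0; move: `|u n| => a; nra.
  - move=> a r ur; rewrite leNgt; apply/negP => r0.
    have /ur[N _ /(_ N (leqnn N))] /= : 0 < - r / 2 by rewrite divr_gt0// oppr_gt0.
    by have := sqr_ge0 `|u N - a|; lra.
  - move=> w a r wa wr e e0.
    pose k := b + (`|a| + 1).
    have b0 : 0 <= b by rewrite (le_trans _ (ub 0%N)).
    have k0 : 0 < 2 * k + 1 by rewrite /k; have := normr_ge0 a; lra.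
    have e4 : 0 < e / 4 by rewrite divr_gt0.
    have ek : 0 < Num.min 1 (e / 2 / (2 * k + 1)) by rewrite lt_min ltr01 !divr_gt0.
    have [N [N1 N2]] : exists N, `|a - w N| <= Num.min 1 (e / 2 / (2 * k + 1)) /\
        N.+1%:R^-1 < e / 4.
      have [N1 _ h1] := @cvgr_dist_le _ _ _ _ _ _ _ wa _ ek.
      have [N2 _ h2] := near_infty_natSinv_lt (PosNum e4).
      exists (maxn N1 N2); split; first by apply: h1; rewrite /= leq_maxl.
      by apply: h2; rewrite /= leq_maxr.
    move: N1; rewrite le_min ler_pdivlMr// => /andP[d1 d2].
    have := wr N _ e4; apply: filterS => n un.
    apply: (@sqr_perturb_le `|u n - w N| _ `|a - w N| k) => //.
    + rewrite (le_trans (ler_normB _ _))// lerD//.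
      rewrite -[w N](subrK a) (le_trans (ler_normD _ _))// addrC lerD2l.
      by rewrite distrC.
    + by move: N.+1%:R^-1 N2 un => d; lra.
    + have -> : u n - a = (u n - w N) - (a - w N) by vec ipH.
      exact: ler_normB.
exists c, r; split=> //.
have Tcr : asymptotic_le u (T c) r.
  apply: (asymptotic_le_perturb cr ub _ uT) => n /=; rewrite normr_id.
  have -> : u n - T c = (T (u n) - T c) - (T (u n) - u n) by vec ipH.
  by rewrite (le_trans (ler_normB _ _))// lerD2r.
have := mid _ _ _ _ Tcr cr => /rmin h.
apply/eqP; rewrite -subr_eq0 -normr_eq0 -sqrf_eq0 eq_le sqr_ge0 andbT; lra.
Unshelve. all: by end_near. Qed.

(** The selection [f] need not be increasing: [n <= f n] is all that passing to the limit
    requires. *)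
Lemma infinitely_often_subseq (P : nat -> Prop) :
  ~ (\forall n \near \oo, ~ P n) -> exists f : nat -> nat, forall n, (n <= f n)%N /\ P (f n).
Proof.
move=> nP; suff /choice[f fP] : forall n, exists m, (n <= m)%N /\ P m by exists f.
move=> n; apply: contrapT => h; apply: nP; exists n => // m /= nm Pm; apply: h.
by exists m.
Qed.

Lemma cvg_subseq_le (V : topologicalType) (w : nat -> V) (a : V) (f : nat -> nat) :
  (forall n, (n <= f n)%N) -> w n @[n --> \oo] --> a -> w (f n) @[n --> \oo] --> a.
Proof.
move=> fn wa A /wa [N _ HN]; exists N => // n /= Nn; apply: HN => /=.
exact: leq_trans (fn n).
Qed.

(** If [<x n - c, v> >= d > 0] infinitely often, let [c'] be the centre of that subsequence. It is a
    fixed point, so [|x n - c'|] converges to some [L], and minimality of [c] gives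
    [r <= L^2 <= r']. But along the subsequence [c + t v] has asymptotic value at most
    [r - 2 t d + t^2 |v|^2], which is below [r] for small [t] and contradicts the minimality of
    [r']. *)
Lemma opial x (T : H -> H) b : nonexpansive T ->
  (forall n, `|x n| <= b) -> `|T (x n) - x n| @[n --> \oo] --> 0 ->
  (forall p, T p = p -> cvg (`|x n - p| @[n --> \oo])) ->
  exists c, T c = c /\ weakly_converges ip x c.
Proof.
move=> Tne xb xT xp.
have [c [r [Tc cr rmin]]] := asymptotic_center Tne xb xT.
have lt v d : 0 < d -> \forall n \near \oo, ip (x n - c) v < d.
  move=> d0; apply: contrapT => h.
  have [f fP] : exists f : nat -> nat, forall n, (n <= f n)%N /\ d <= ip (x (f n) - c) v.
    apply: (@infinitely_often_subseq (fun n => d <= ip (x n - c) v)) => h'; apply: h.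
    apply: filterS h' => n.
    by move/negP; rewrite -ltNge.
  have fn n := (fP n).1.
  have xT' := cvg_subseq_le fn xT.
  have [c' [r' [Tc' cr' rmin']]] := asymptotic_center Tne (fun n => xb (f n)) xT'.
  have /cvg_ex[L xL] := xp _ Tc'.
  have xL2 : `|x n - c'| ^+ 2 @[n --> \oo] --> L ^+ 2.
    by rewrite expr2; under eq_fun do rewrite expr2; exact: cvgM.
  have rL : r <= L ^+ 2.
    apply: (rmin c') => e e0; near=> n.
    by near: n; apply: (cvgr_le _ xL2); rewrite ltrDl.
  have Lr' : L ^+ 2 <= r'.
    apply/ler_addgt0Pr => e e0.
    exact: (cvgr_to_le (cvg_subseq_le fn xL2) (cr' e e0)).
  have : 2 * d <= 0.
    apply: (@first_order_le0 _ _ (`|v| ^+ 2)) => t t0 t1.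
    suff : r' <= r - 2 * t * d + t ^+ 2 * `|v| ^+ 2 by lra.
    apply: (rmin' (c + t *: v)) => e e0.
    have [N _ HN] := cr e e0; exists N => // n /= Nn.
    have := HN (f n) (leq_trans Nn (fn n)) => /= h1.
    have -> : x (f n) - (c + t *: v) = (x (f n) - c) - t *: v by vec ipH.
    rewrite (normsqB ipH) normsqZ ipZr.
    have : t * d <= t * ip (x (f n) - c) v by rewrite ler_pM2l// (fP n).2.
    lra.
  lra.
exists c; split=> // v; apply/cvgrPdist_lt => e e0; near=> n.
have h1 : ip (x n - c) v < e by near: n; exact: lt.
have h2 : ip (x n - c) (- v) < e by near: n; exact: lt.
by rewrite ltr_norml; move: h1 h2; rewrite !ipE; lra.
Unshelve. all: by end_near. Qed.

(** No probability is left here: the lemma is applied to each trajectory. Divergence of the step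
    sizes is required from every [m] because the restart time depends on the accuracy and on the
    trajectory. *)
Lemma shadowing_cvg x (T : H -> H) (l : nat -> R) p0 : nonexpansive T -> T p0 = p0 ->
  (forall n, 0 <= l n <= 1) ->
  (forall m (M : R), exists j, M <= \sum_(m <= k < m + j) l k * (1 - l k)) ->
  (forall e, 0 < e -> exists m, forall j, `|x (m + j)%N - km_iter T l m (x m) j| <= e) ->
  `|T (x n) - x n| @[n --> \oo] --> 0 /\
  exists c, T c = c /\ weakly_converges ip x c.
Proof.
move=> Tne Tp0 l01 ldiv sh.
have sum_homo m : nondecreasing_seq (fun j => \sum_(m <= k < m + j) l k * (1 - l k)).
  apply/nondecreasing_seqP => j; rewrite addnS big_nat_recr ?leq_addr//= lerDl.
  by have /andP[? ?] := l01 (m + j)%N; rewrite mulr_ge0// subr_ge0.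
have res : `|T (x n) - x n| @[n --> \oo] --> 0.
  apply/cvgrPdist_le => e e0.
  have e4 : 0 < e / 4 by rewrite divr_gt0.
  have [m xm] := sh _ e4.
  (* This threshold forces the residual of the shadow below [e / 2], the added 1 providing
     strictness; passing from the shadow to [x] costs twice the tracking error [e / 4]. *)
  have [j0 Hj] := ldiv m (`|x m - p0| ^+ 2 / (e / 2) ^+ 2 + 1).
  exists (m + j0)%N => // n /= mn; rewrite sub0r normrN normr_id.
  have -> : n = (m + (n - m))%N by rewrite subnKC// (leq_trans _ mn)// leq_addr.
  have j0n : (j0 <= n - m)%N by rewrite leq_subRL// (leq_trans _ mn)// leq_addr.
  move: (n - m)%N j0n => j j0j.
  apply: (le_trans (residual_lipschitz ipH Tne _ (km_iter T l m (x m) j))).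
  have := xm j; have := km_iter_residual ipH Tne m (x m) j Tp0 l01.
  have := le_trans Hj (sum_homo m _ _ j0j).
  rewrite -lerBrDr ler_pdivrMr ?exprn_gt0 ?divr_gt0//.
  set S := \sum_(_ <= _ < _) _; set q := `|T _ - _| => h1 h2 h3.
  suff : q <= e / 2 by lra.
  rewrite leNgt; apply/negP => qe.
  have S0 : 0 <= S by rewrite (le_trans _ (sum_homo m _ _ (leq0n j)))// addn0 big_geq.
  have q2 : (e / 2) ^+ 2 < q ^+ 2 by move: e0 qe; clear; move: q => q; nra.
  have := sqr_ge0 `|km_iter T l m (x m) j - p0|.
  have : 0 < (e / 2) ^+ 2 by rewrite exprn_gt0// divr_gt0.
  have := ler_wpM2l S0 (ltW q2); move: h1 h2.
  by move: (_ ^+ 2) (q ^+ 2) (_ ^+ 2) (_ ^+ 2) => a1 a2 a3 a4; lra.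
have dist p : T p = p -> cvg (`|x n - p| @[n --> \oo]).
  move=> Tp; apply: cauchy_cvg; apply: cauchy_exP => e e0.
  have e4 : 0 < e / 4 by rewrite divr_gt0.
  have [m xm] := sh _ e4.
  have noninc := km_iter_dist ipH Tne m (x m) Tp l01.
  have lb : has_lbound (range (fun j => `|km_iter T l m (x m) j - p|)).
    by exists 0 => _ [j _ <-].
  have := nonincreasing_is_cvgn noninc lb.
  set a := fun j => _; set L := limn a => aL.
  have {}aL : a j @[j --> \oo] --> L by exact: aL.
  move/cvgrPdist_lt : aL => /(_ _ e4)[N _ HN].
  exists L, (m + N)%N => // n /= mn; rewrite /ball /=.
  have -> : n = (m + (n - m))%N by rewrite subnKC// (leq_trans _ mn)// leq_addr.
  have j0n : (N <= n - m)%N by rewrite leq_subRL// (leq_trans _ mn)// leq_addr.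
  move: (n - m)%N j0n => j j0j; have := HN j j0j; rewrite /a => h.
  have := xm j; set y := km_iter _ _ _ _ _ in h * => h'.
  have := ler_dist_dist (x (m + j)%N - p) (y - p).
  have -> : x (m + j)%N - p - (y - p) = x (m + j)%N - y by vec ipH.
  move: h; rewrite !ltr_norml ler_norml; move: `|_ - p| `|y - p| => a1 a2; lra.
split=> //.
have [b xb] : exists b, forall n, `|x n| <= b.
  have /cvg_seq_bounded[M [_ HM]] := dist _ Tp0.
  exists (M + 1 + `|p0|) => n; rewrite -[x n](subrK p0).
  rewrite (le_trans (ler_normD _ _))// lerD2r.
  by have := HM (M + 1) (ltr_pwDr ltr01 (lexx _)) n I; rewrite /= normr_id.
exact: opial Tne xb res dist.
Qed.
End Opial.

(** * Measurable maps into a separable space *)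

Section Hmeasurable.
Context (R : realType) (H : completeNormedModType R).
Hypothesis Hsep : separable H.

(* As H is separable, this is strong measurability. *)
Definition hmeasurable d (X : measurableType d) (f : X -> H) :=
  forall v, measurable_fun setT (fun x => `|f x - v|).

Lemma dense_sequence : exists h : nat -> H, forall x e, 0 < e -> exists n, `|x - h n| < e.
Proof.
have [S cS dS] := Hsep.
have /pfcard_geP[S0|/unsquash h] := cS.
  have [|s []] := dS setT _ openT; first by exists 0.
  by rewrite S0.
exists h => x e e0; have [||s [xs Ss]] := dS (ball x e); last 1 first.
- have [n _ hn] := @surj _ _ _ _ h _ Ss.
  by exists n; rewrite hn; move: xs; rewrite -ball_normE.
- by exists x; exact: ballxx.
- exact: ball_open.
Qed.

Section fixed_space.
Context d (X : measurableType d).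
Implicit Types f g : X -> H.

Lemma hmeasurable_ball f v r : hmeasurable f -> measurable [set x | `|f x - v| < r].
Proof.
move=> mf; have := mf v measurableT `]-oo, r[%classic (measurable_itv _).
rewrite setTI; congr measurable; apply/seteqP; split => x /=; by rewrite in_itv.
Qed.

(** An open subset of [H * H] is a countable union of products of balls centred on the dense
    sequence. This is where separability makes sums and other continuous operations measurable,
    although [hmeasurable] only tests distances to points. *)
Lemma hmeasurable_open2 f g (U : set (H * H)) : hmeasurable f -> hmeasurable g ->
  open U -> measurable [set x | U (f x, g x)].
Proof.
move=> mf mg oU; have [h hd] := dense_sequence.
pose D i j : set nat := [set k | forall y z, `|y - h i| < k.+1%:R^-1 ->
  `|z - h j| < k.+1%:R^-1 -> U (y, z)].
have -> : [set x | U (f x, g x)] = \bigcup_i \bigcup_j \bigcup_(k in D i j)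
    ([set x | `|f x - h i| < k.+1%:R^-1] `&` [set x | `|g x - h j| < k.+1%:R^-1]).
  apply/seteqP; split => [x /= Ux|x [i _ [j _ [k Dk [fx gx]]]]]; last exact: Dk.
  have /nbhs_ballP[e /= e0 He] := open_nbhs_nbhs (conj oU Ux).
  have e2 : 0 < e / 2 by rewrite divr_gt0.
  have [k _ /(_ k (leqnn k)) /= ke] := near_infty_natSinv_lt (PosNum e2).
  have k0 : 0 < k.+1%:R^-1 :> R by rewrite invr_gt0.
  have [i fi] := hd (f x) _ k0; have [j gj] := hd (g x) _ k0.
  exists i => //; exists j => //; exists k => // y z yi zj; apply: He.
  split; rewrite -ball_normE /=.
    rewrite (_ : f x - y = (f x - h i) - (y - h i)); last by rewrite opprB addrA subrK.
    by rewrite (le_lt_trans (ler_normB _ _))// (splitr e) ltrD// (lt_trans _ ke).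
  rewrite (_ : g x - z = (g x - h j) - (z - h j)); last by rewrite opprB addrA subrK.
  by rewrite (le_lt_trans (ler_normB _ _))// (splitr e) ltrD// (lt_trans _ ke).
apply: bigcupT_measurable => i; apply: bigcupT_measurable => j.
by apply: bigcup_measurable => k _; apply: measurableI; exact: hmeasurable_ball.
Qed.

Lemma hmeasurable_continuous2 f g (F : H * H -> R) : hmeasurable f -> hmeasurable g ->
  continuous F -> measurable_fun setT (fun x => F (f x, g x)).
Proof.
move=> mf mg /continuousP cF; apply: (measurability _ (RGenOpens.measurableE R)).
move=> _ [_ [a [b ->] <-]]; rewrite setTI.
exact: (hmeasurable_open2 mf mg (cF _ (interval_open _ _))).
Qed.

Lemma hmeasurable_comp2 f g (F : H * H -> H) : hmeasurable f -> hmeasurable g ->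
  continuous F -> hmeasurable (fun x => F (f x, g x)).
Proof.
move=> mf mg cF v.
apply: (@hmeasurable_continuous2 f g (fun z => `|F z - v|) mf mg) => z.
by apply: cvg_norm; apply: cvgB; [exact: cF|exact: cvg_cst].
Qed.

Lemma hmeasurable_comp f (F : H -> H) : hmeasurable f -> continuous F ->
  hmeasurable (F \o f).
Proof.
move=> mf cF; apply: (@hmeasurable_comp2 f f (fun z => F z.1)) => // z.
by apply: (@cvg_comp _ _ _ fst); [exact: cvg_fst|exact: cF].
Qed.

Lemma hmeasurable_cst v : hmeasurable (fun _ : X => v).
Proof. by move=> w; exact: measurable_cst. Qed.

Lemma hmeasurableD f g : hmeasurable f -> hmeasurable g -> hmeasurable (fun x => f x + g x).
Proof.
move=> mf mg; apply: (hmeasurable_comp2 mf mg (F := fun z => z.1 + z.2)) => z.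
exact: add_continuous.
Qed.

Lemma hmeasurableZ (a : R) f : hmeasurable f -> hmeasurable (fun x => a *: f x).
Proof. by move=> mf; apply: (hmeasurable_comp mf); exact: scaler_continuous. Qed.

Lemma hmeasurableN f : hmeasurable f -> hmeasurable (fun x => - f x).
Proof. by move=> mf; apply: (hmeasurable_comp mf); exact: opp_continuous. Qed.

Lemma hmeasurableB f g : hmeasurable f -> hmeasurable g -> hmeasurable (fun x => f x - g x).
Proof. by move=> mf /hmeasurableN; exact: hmeasurableD. Qed.

Lemma hmeasurable_norm f : hmeasurable f -> measurable_fun setT (fun x => `|f x|).
Proof. by move=> /(_ 0); under eq_fun do rewrite subr0. Qed.

Lemma hmeasurable_cvg (u : nat -> X -> H) f : (forall n, hmeasurable (u n)) ->
  (forall x, u n x @[n --> \oo] --> f x) -> hmeasurable f.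
Proof.
move=> mu uf v.
apply: (@measurable_fun_cvg _ _ _ _ (fun n x => `|u n x - v|)).
  by move=> n; exact: mu.
by move=> x _; apply: cvg_norm; apply: cvgB; [exact: uf|exact: cvg_cst].
Qed.

Lemma hmeasurable_finite_range f : finite_set (range f) ->
  (forall v, measurable (f @^-1` [set v])) -> hmeasurable f.
Proof.
move=> finf mf v _ Y mY; rewrite setTI.
have -> : (fun x => `|f x - v|) @^-1` Y =
    \bigcup_(w in range f `&` [set w | Y `|w - v|]) f @^-1` [set w].
  apply/seteqP; split => [x /= Yx|x [w [_ /= Yw] /= fx]]; last by rewrite fx.
  by exists (f x).
apply: fin_bigcup_measurable => // ; exact: finite_setIl.
Qed.

End fixed_space.

Lemma hmeasurable_precomp d d' (X : measurableType d) (Y : measurableType d')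
  (g : X -> Y) (f : Y -> H) : measurable_fun setT g -> hmeasurable f ->
  hmeasurable (f \o g).
Proof. by move=> mg mf v; apply: (measurableT_comp (mf v)). Qed.

(** Replace [f x] by the first point of the dense sequence within [1 / (n + 1)] of it. The composite
    is then measurable on countably many pieces, and continuity of [F y] recovers the limit. *)
Lemma hmeasurable_caratheodory d d' (X : measurableType d) (Y : measurableType d')
  (f : X -> H) (g : X -> Y) (F : Y -> H -> H) : hmeasurable f -> measurable_fun setT g ->
  (forall v, hmeasurable (F ^~ v)) -> (forall y, continuous (F y)) ->
  hmeasurable (fun x => F (g x) (f x)).
Proof.
move=> mf mg mF cF; have [h hd] := dense_sequence.
have ex n x : exists i, `|f x - h i| < n.+1%:R^-1.
  by apply: hd; rewrite invr_gt0.
pose idx n x := ex_minn (ex n x).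
apply: (@hmeasurable_cvg _ _ (fun n x => F (g x) (h (idx n x)))); last first.
  move=> x; apply: (@cvg_comp _ _ _ (fun n => h (idx n x)) (F (g x)) \oo (nbhs (f x))) => //; last exact: cF.
  apply/cvgrPdist_lt => e e0; have [N _ HN] := near_infty_natSinv_lt (PosNum e0).
  exists N => // n /= Nn; apply: lt_trans (HN _ Nn).
  by rewrite /idx; case: ex_minnP.
move=> n v _ Z mZ; rewrite setTI.
have midx i : measurable [set x | idx n x = i].
  have -> : [set x | idx n x = i] = [set x | `|f x - h i| < n.+1%:R^-1] `\`
      \bigcup_(j < i) [set x | `|f x - h j| < n.+1%:R^-1].
    apply/seteqP; split => x /=; rewrite /idx; case: ex_minnP => k kx kmin.
      by move=> <-; split=> // -[j /= jk]; apply/negP; rewrite -leNgt leNgt;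
        apply/negP => /kmin; rewrite leqNgt jk.
    move=> [ix nj]; apply/eqP; rewrite eqn_leq kmin// leqNgt; apply/negP => ki.
    by apply: nj; exists k.
  apply: measurableD; first exact: hmeasurable_ball.
  by apply: bigcup_measurable => j _; exact: hmeasurable_ball.
have -> : (fun x => `|F (g x) (h (idx n x)) - v|) @^-1` Z =
    \bigcup_i ([set x | idx n x = i] `&` (fun x => `|F (g x) (h i) - v|) @^-1` Z).
  apply/seteqP; split => [x /= Zx|x [i _ [/= ix]]]; last by rewrite ix.
  by exists (idx n x).
apply: bigcupT_measurable => i; apply: measurableI => //.
have mh := hmeasurable_precomp mg (mF (h i)).
by rewrite -[X in measurable X]setTI; exact: mh.
Qed.

End Hmeasurable.

(** * Bochner integrals *)

(* No measurability is assumed: the integral of a nonnegative function is a lower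
   integral, and the residuals need only be almost surely measurable. *)
Lemma ae_ge0_le_integral d (X : measurableType d) (R : realType)
    (mu : {measure set X -> \bar R}) (f g : X -> \bar R) :
  (forall x, 0 <= f x)%E -> (forall x, 0 <= g x)%E ->
  {ae mu, forall x, (f x <= g x)%E} ->
  (\int[mu]_x f x <= \int[mu]_x g x)%E.
Proof.
move=> f0 g0 [N [mN N0 fgN]].
rewrite [leLHS]ge0_integralE//; apply: ge_ereal_sup => _ [h /= hf <-].
rewrite -integralT_nnsfun [leRHS]ge0_integralE//.
have mNC : measurable (~` N) by exact: measurableC.
apply: ereal_sup_ubound; exists (proj_nnsfun h mNC).
  move=> x; rewrite -mrestrict patch_setT /patch; case: ifPn => [|_]; last first.
    exact: g0.
  rewrite inE => nNx; apply: (le_trans (hf x)); rewrite patch_setT.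
  by apply: contrapT => fg; apply: nNx; apply: fgN.
rewrite -integralT_nnsfun; apply: ge0_ae_eq_integral => //.
- by apply/measurable_EFinP; exact: measurable_funPT.
- by apply/measurable_EFinP; exact: measurable_funPT.
- by move=> x _; rewrite lee_fin.
- by move=> x _; rewrite lee_fin.
exists N; split=> // x /= hx; apply: contrapT => nNx; apply: hx => _.
by rewrite /= /mindic indicE mem_set// mulr1.
Qed.

Lemma ae_eq_ge0_integral d (X : measurableType d) (R : realType)
    (mu : {measure set X -> \bar R}) (f g : X -> \bar R) :
  (forall x, 0 <= f x)%E -> (forall x, 0 <= g x)%E ->
  {ae mu, forall x, f x = g x} ->
  (\int[mu]_x f x = \int[mu]_x g x)%E.
Proof.
move=> f0 g0 fg; apply/eqP; rewrite eq_le; apply/andP.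
by split; apply: ae_ge0_le_integral => //; apply: filterS fg => x ->.
Qed.

Lemma lipschitz_continuous (R : realType) (H : normedModType R) (k : R) (F : H -> H) : 0 <= k ->
  (forall x y, `|F x - F y| <= k * `|x - y|) -> continuous F.
Proof.
move=> k0 Fk x; apply/cvgrPdist_le => e e0; near=> y.
apply: (le_trans (Fk _ _)).
have : `|x - y| <= e / (k + 1).
  by near: y; apply: cvgr_dist_le => //; rewrite divr_gt0// ltr_wpDl.
rewrite ler_pdivlMr ?ltr_wpDl// => /(le_trans _); apply.
by rewrite mulrC ler_wpM2l// lerDl.
Unshelve. all: by end_near. Qed.

Section BochnerTheory.
Context (R : realType) (H : completeNormedModType R) (ip : {dot H for idfun}).
Hypothesis ipH : hilbert_norm ip.
Hypothesis Hsep : separable H.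
Context d (X : measurableType d) (mu : probability X R).
Implicit Types (f g s : X -> H) (u v w : H).

Lemma simple_map_hmeasurable s : simple_map s -> hmeasurable s.
Proof. by move=> [? ?]; exact: hmeasurable_finite_range. Qed.

Lemma simple_map_comp s (F : H -> H) : simple_map s -> simple_map (F \o s).
Proof.
move=> [fs ms]; split.
  apply: (sub_finite_set _ (finite_image F fs)) => _ [x _ <-].
  by exists (s x) => //; exists x.
move=> v; rewrite comp_preimage.
have -> : s @^-1` (F @^-1` [set v]) = \bigcup_(w in range s `&` F @^-1` [set v]) s @^-1` [set w].
  apply/seteqP; split => [x /= Fx|x [w [_ /= Fw] /= sx]]; last by rewrite sx.
  by exists (s x).
by apply: fin_bigcup_measurable => //; exact: finite_setIl.
Qed.

Lemma integral_simple_map s (F : H -> R) : simple_map s ->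
  mu.-integrable setT (EFin \o (F \o s)) /\
  (\int[mu]_x (F (s x))%:E)%E =
  (\sum_(v <- fset_set (range s)) fine (mu (s @^-1` [set v])) * F v)%:E.
Proof.
move=> [fs ms].
pose h v x := ((F v)%:E * (\1_(s @^-1` [set v]) x)%:E)%E.
have Fs x : (F (s x))%:E = (\sum_(v <- fset_set (range s)) h v x)%E.
  rewrite (bigD1_seq (s x)) ?fset_uniq//=; last first.
    by rewrite in_fset_set// inE; exists x.
  rewrite big1 ?adde0; first by rewrite /h indicE mem_set// mule1.
  move=> v vs; rewrite /h indicE memNset ?mule0// => /= sx.
  by rewrite sx eqxx in vs.
have ih v : mu.-integrable setT (h v).
  apply: integrableZl => //; apply: integrable_indic => //.
have -> : EFin \o (F \o s) = (fun x => \sum_(v <- fset_set (range s)) h v x)%E.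
  by apply/funext => x; rewrite /= Fs.
split; first exact: integrable_sum.
under eq_integral do rewrite Fs.
rewrite integral_sum// -sumEFin; apply: eq_bigr => v _.
rewrite integralZl//; last exact: integrable_indic.
rewrite integral_indic// setIT muleC EFinM fineK// fin_num_measure//.
Qed.

Lemma simple_integralE s : simple_map s ->
  simple_integral mu s = \sum_(v <- fset_set (range s)) fine (mu (s @^-1` [set v])) *: v.
Proof. by move=> [fs _]; rewrite /simple_integral fsbig_finite. Qed.

Lemma ip_sumZ (I : Type) (r : seq I) (m : I -> R) (v : I -> H) u :
  ip (\sum_(i <- r) m i *: v i) u = \sum_(i <- r) m i * ip (v i) u.
Proof.
elim: r => [|i r IH]; first by rewrite !big_nil ip0l.
by rewrite !big_cons ipDl ipZl IH.
Qed.

Lemma ip_simple_integral s u : simple_map s ->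
  (\int[mu]_x (ip (s x) u)%:E)%E = (ip (simple_integral mu s) u)%:E.
Proof.
move=> ss; rewrite (integral_simple_map (ip^~ u) ss).2 simple_integralE//.
by rewrite ip_sumZ.
Qed.

Lemma simple_integral_affine s (F : H -> H) : simple_map s -> affine_map F ->
  simple_integral mu (F \o s) = F (simple_integral mu s).
Proof.
move=> ss aF; apply: (ip_ext ipH) => u; apply/EFin_inj.
rewrite -ip_simple_integral; last exact: simple_map_comp.
rewrite (integral_simple_map (fun v => ip (F v) u) ss).2 simple_integralE//.
rewrite affine_map_sum//; first by rewrite ip_sumZ.
  by move=> v; rewrite fine_ge0.
(* The masses of the fibres add up to 1: integrate the constant 1. An affine map commutes with
   finite combinations of total mass 1 only. *)
apply/EFin_inj; have := (integral_simple_map (cst 1) ss).2.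
have -> : (\int[mu]_x (cst 1 (s x))%:E)%E = 1%E.
  have := @integral_cst _ _ _ mu _ measurableT 1; rewrite mul1e => ->.
  exact: probability_setT.
move=> ->.
by congr EFin; apply: eq_bigr => v _; rewrite mulr1.
Qed.



Lemma has_bochner_integral_ae f g v : {ae mu, forall x, f x = g x} ->
  has_bochner_integral mu f v -> has_bochner_integral mu g v.
Proof.
move=> fg [s [ss sf If Iv]]; exists s; split=> //.
  by apply: filterS2 fg sf => x ->.
have -> : (fun n => \int[mu]_x (`|g x - s n x|%R)%:E)%E =
          (fun n => \int[mu]_x (`|f x - s n x|%R)%:E)%E.
  apply/funext => n; apply: ae_eq_ge0_integral => //.
  by apply: filterS fg => x ->.
exact: If.
Qed.

(** The images by [F] of the approximating simple maps approximate [F \o f], since [F] is Lipschitz,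
    and their integrals are the images of the integrals, since [F] is affine. This is how the
    expectation passes through [JB]. *)
Lemma has_bochner_integral_comp f v (F : H -> H) (k : R) : hmeasurable f -> affine_map F -> 0 <= k ->
  (forall x y, `|F x - F y| <= k * `|x - y|) ->
  has_bochner_integral mu f v -> has_bochner_integral mu (F \o f) (F v).
Proof.
move=> mf aF k0 Fk [s [ss sf If Iv]].
have cF := lipschitz_continuous k0 Fk.
exists (fun n => F \o s n); split.
- by move=> n; exact: simple_map_comp.
- by apply: filterS sf => x sfx; exact: (cvg_comp _ _ sfx (cF _)).
- have kI : (k%:E * \int[mu]_x (`|f x - s n x|%R)%:E)%E @[n --> \oo] --> 0%E.
    by rewrite -(mule0 k%:E); exact: cvgeZl.
  apply: (squeeze_cvge _ (cvg_cst 0%E) kI); apply: nearW => n /=.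
  apply/andP; split; first by apply: integral_ge0 => x _; rewrite lee_fin.
  apply: (@le_trans _ _ (\int[mu]_x (k * `|f x - s n x|)%:E)%E).
    apply: ae_ge0_le_integral => [x|x|]; first by rewrite lee_fin.
    - by rewrite lee_fin mulr_ge0.
    - by apply: nearW => x; rewrite lee_fin.
  under eq_integral do rewrite EFinM.
  rewrite ge0_integralZl//; apply/measurable_EFinP/hmeasurable_norm/hmeasurableB => //.
  exact: simple_map_hmeasurable.
- under eq_fun do rewrite simple_integral_affine//.
  exact: (cvg_comp _ _ Iv (cF _)).
Qed.

Lemma measurable_ip f u : hmeasurable f -> measurable_fun setT (fun x => ip (f x) u).
Proof.
move=> mf; apply: (hmeasurable_continuous2 Hsep mf mf (F := fun z => ip z.1 u)) => z.
by apply: (cvg_ip ipH); exact: cvg_fst.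
Qed.

(** From here on only scalar integrals against a fixed [u] are used: they determine the Bochner
    integral, and they are what cancels the cross terms of the squared norms. *)
Lemma has_bochner_integral_weak f v : hmeasurable f -> has_bochner_integral mu f v ->
  mu.-integrable setT (fun x => `|f x|%:E) /\
  forall u, mu.-integrable setT (fun x => (ip (f x) u)%:E) /\
    (\int[mu]_x (ip (f x) u)%:E)%E = (ip v u)%:E.
Proof.
move=> mf [s [ss sf If Iv]].
have ms n := simple_map_hmeasurable (ss n).
have mfs n : hmeasurable (fun x => f x - s n x) by exact: hmeasurableB.
have /fine_cvgP[[N _ finI] cvI] := If.
have intfs n : (N <= n)%N -> mu.-integrable setT (fun x => `|f x - s n x|%:E).
  move=> Nn; apply/integrableP; split.
    by apply/measurable_EFinP; exact: hmeasurable_norm.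
  under eq_integral do rewrite abse_EFin normr_id.
  by have := finI n Nn; rewrite /= ge0_fin_numE// integral_ge0//= => x _; rewrite lee_fin.
have intf : mu.-integrable setT (fun x => `|f x|%:E).
  have is_ := (integral_simple_map (fun v => `|v|) (ss N)).1.
  have := integrableD measurableT (intfs N (leqnn N)) is_.
  apply: le_integrable => //; first by apply/measurable_EFinP; exact: hmeasurable_norm.
  move=> x _; rewrite /= lee_fin normr_id ger0_norm ?addr_ge0//.
  by rewrite -{1}[f x](subrK (s N x)) ler_normD.
split=> // u.
have ipint g : hmeasurable g -> mu.-integrable setT (fun x => `|g x|%:E) ->
    mu.-integrable setT (fun x => (ip (g x) u)%:E) /\
    (`|\int[mu]_x (ip (g x) u)%:E| <= `|u|%:E * \int[mu]_x `|g x|%:E)%E.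
  move=> mg ig.
  have igu : mu.-integrable setT (fun x => `|u|%:E * `|g x|%:E)%E by exact: integrableZl.
  have igip : mu.-integrable setT (fun x => (ip (g x) u)%:E).
    apply: le_integrable igu => //.
      by apply/measurable_EFinP; exact: measurable_ip.
    move=> x _; rewrite abse_EFin -EFinM abse_EFin lee_fin normrM !normr_id mulrC.
    exact: abs_ip_le.
  split=> //; apply: (le_trans (le_abse_integral _ _ _)) => //.
    by apply/measurable_EFinP; exact: measurable_ip.
  rewrite -integralZl//; apply: ge0_le_integral => //.
  - apply/measurable_EFinP; apply: measurableT_comp => //; exact: measurable_ip.
  - by apply/measurable_EFinP; apply: measurable_funM => //; exact: hmeasurable_norm.
  - by move=> x _; rewrite abse_EFin -EFinM lee_fin mulrC; exact: abs_ip_le.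
have [ifu _] := ipint f mf intf.
split=> //; have finf := integrable_fin_num measurableT ifu.
rewrite -(fineK finf); congr EFin; apply/eqP; rewrite -subr_eq0 -normr_le0.
apply/ler_addgt0Pr => e e0; rewrite add0r.
have e2 : 0 < e / 2 by rewrite divr_gt0.
have uu : 0 < `|u| + 1 by rewrite ltr_wpDl.
have Iv2 : ip (simple_integral mu (s n)) u @[n --> \oo] --> ip v u by exact: cvg_ip.
near \oo => n.
have Nn : (N <= n)%N by near: n; exact: nbhs_infty_ge.
have h1 : fine (\int[mu]_x (`|f x - s n x|%:E))%E <= e / 2 / (`|u| + 1).
  by near: n; apply: (cvgr_le _ cvI); rewrite divr_gt0.
have h2 : `|ip (simple_integral mu (s n)) u - ip v u| <= e / 2.
  by rewrite distrC; near: n; move/cvgrPdist_le : Iv2; apply.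
have [ifs_ hfs] := ipint _ (mfs n) (intfs n Nn).
have fins := integrable_fin_num measurableT ifs_.
have : fine (\int[mu]_x (ip (f x) u)%:E)%E = ip (simple_integral mu (s n)) u +
     fine (\int[mu]_x (ip (f x - s n x) u)%:E)%E.
  apply: EFin_inj; rewrite EFinD (fineK finf) (fineK fins) -ip_simple_integral//.
  have [is1 _] := integral_simple_map (ip^~ u) (ss n).
  rewrite -integralD//; apply: eq_integral => x _ /=.
  by rewrite -EFinD -ipDl addrC subrK.
move=> ->.
have : `|fine (\int[mu]_x (ip (f x - s n x) u)%:E)%E| <= e / 2.
  have fin2 := integrable_fin_num measurableT (intfs n Nn).
  move: hfs; rewrite -(fineK fins) -(fineK fin2) -EFinM abse_EFin lee_fin => /le_trans; apply.
  move: h1; rewrite ler_pdivlMr// mulrC => /(le_trans _); apply.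
  by rewrite ler_wpM2r ?lerDl// fine_ge0// integral_ge0// => x _; rewrite lee_fin.
move: h2; move: (fine _) (ip _ u) (ip v u) => a1 a2 a3 h2 h3.
have -> : a2 + a1 - a3 = (a2 - a3) + a1 by ring.
by rewrite (le_trans (ler_normD _ _))// (splitr e) lerD.
Unshelve. all: by end_near. Qed.

Lemma hmeasurable_off (N : set X) (s : nat -> X -> H) f : measurable N ->
  (forall n, simple_map (s n)) -> (forall x, ~ N x -> s n x @[n --> \oo] --> f x) ->
  hmeasurable (fun x => if x \in N then 0 else f x).
Proof.
move=> mN ss sf.
apply: (@hmeasurable_cvg _ _ _ _ (fun n x => if x \in N then 0 else s n x)) => [n v|x].
  have -> : (fun x => `|(if x \in N then 0 else s n x) - v|) =
      (fun x => if x \in N then `|0 - v| else `|s n x - v|).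
    by apply/funext => x; case: ifP.
  have ms := simple_map_hmeasurable (ss n) v.
  apply: measurable_fun_ifT => //.
  apply: (@measurable_fun_bool _ _ _ _ true); rewrite setTI.
  by rewrite (_ : _ @^-1` _ = N)//; apply/seteqP; split => x /=;
    [exact: set_mem|exact: mem_set].
case: ifPn => [_|/negP xN]; first exact: cvg_cst.
by apply: sf => Nx; apply: xN; rewrite inE.
Qed.

Lemma bochner_integrable_simple f : bochner_integrable mu f ->
  exists N (s : nat -> X -> H), [/\ measurable N, mu N = 0, forall n, simple_map (s n)
    & forall x, ~ N x -> s n x @[n --> \oo] --> f x].
Proof.
move=> [v [s [ss [N [mN N0 sf]] _ _]]]; exists N, s; split=> // x Nx.
by apply: contrapT => h; apply: Nx; exact: sf.
Qed.

Lemma has_bochner_integral_unique f v v' : has_bochner_integral mu f v ->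
  has_bochner_integral mu f v' -> v = v'.
Proof.
move=> fv fv'.
have [N [s [mN N0 ss sf]]] : exists N (s : nat -> X -> H), [/\ measurable N, mu N = 0,
    forall n, simple_map (s n) & forall x, ~ N x -> s n x @[n --> \oo] --> f x].
  by apply: bochner_integrable_simple; exists v.
(* A Bochner integrable map is a limit of simple maps only off a null set; putting 0 there makes it
   measurable. *)
pose g x := if x \in N then 0 else f x.
have mg : hmeasurable g := hmeasurable_off mN ss sf.
have fg : {ae mu, forall x, f x = g x}.
  exists N; split=> // x /= fgx; apply: contrapT => Nx; apply: fgx.
  by rewrite /g memNset.
have [_ gv] := has_bochner_integral_weak mg (has_bochner_integral_ae fg fv).
have [_ gv'] := has_bochner_integral_weak mg (has_bochner_integral_ae fg fv').
by apply: (ip_ext ipH) => u; apply: EFin_inj; rewrite -(gv u).2 -(gv' u).2.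
Qed.

Lemma bochner_integralE f v : has_bochner_integral mu f v -> bochner_integral mu f = v.
Proof.
move=> fv; apply: has_bochner_integral_unique (fv).
by rewrite /bochner_integral; case: xgetP => [w _ //|/(_ v)].
Qed.

Lemma has_bochner_integralP f : bochner_integrable mu f ->
  has_bochner_integral mu f (bochner_integral mu f).
Proof. by move=> [v fv]; rewrite (bochner_integralE fv). Qed.

Lemma cocoercive_lipschitz tau (c : H -> H) : 0 < tau -> cocoercive ip tau c ->
  forall x y, `|c x - c y| <= tau^-1 * `|x - y|.
Proof.
move=> tau0 cc x y; rewrite -(ler_pM2l tau0) mulrA divff ?gt_eqF// mul1r.
have := le_trans (cc x y) (ip_le_norm ipH _ _).
have [->|cxy] := eqVneq (c x - c y) 0; first by rewrite normr0 mulr0.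
by rewrite expr2 mulrCA ler_pM2l// normr_gt0.
Qed.

(* Cocoercive maps are continuous, so strong measurability on a dense sequence
   suffices and a single null set can be discarded for all [x] at once. *)
Lemma cocoercive_version tau (C : X -> H -> H) : 0 < tau ->
  (forall x, bochner_integrable mu (C ^~ x)) ->
  {ae mu, forall xi, cocoercive ip tau (C xi)} ->
  exists N C', [/\ measurable N, mu N = 0, forall xi, ~ N xi -> C' xi = C xi,
    forall xi, cocoercive ip tau (C' xi) & forall x, hmeasurable (C' ^~ x)].
Proof.
move=> tau0 Cint [N0 [mN0 N00 Ccoco]].
have [h hd] := dense_sequence Hsep.
have /choice[N' /choice[s NsP]] n := bochner_integrable_simple (Cint (h n)).
have [N [mN N_0 NS]] : mu.-negligible (N0 `|` \bigcup_n N' n).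
  apply: negligibleU; first by apply/negligibleP.
  by apply: negligible_bigcup => n; have [? ? _ _] := NsP n; apply/negligibleP.
have CN xi : ~ N xi -> cocoercive ip tau (C xi).
  move=> Nxi; apply: contrapT => nC; apply: Nxi; apply: NS; left.
  exact: Ccoco.
(* On the null set the zero map serves, which is cocoercive for every constant. *)
pose C' xi x := if xi \in N then 0 else C xi x.
have C'N xi : ~ N xi -> C' xi = C xi.
  by move=> Nxi; apply/funext => x; rewrite /C' memNset.
have C'coco xi : cocoercive ip tau (C' xi).
  have [Nxi|Nxi] := pselect (N xi); last by rewrite C'N//; exact: CN.
  by move=> x y; rewrite /C' mem_set// subrr normr0 expr0n mulr0 ip0l.
exists N, C'; split=> // x.
have mh n : hmeasurable (C' ^~ (h n)).
  have [_ _ ssn sn] := NsP n.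
  apply: (hmeasurable_off mN ssn) => xi Nxi; apply: sn => N'xi; apply: Nxi.
  by apply: NS; right; exists n.
have /choice[i hi] (n : nat) : exists i, `|x - h i| < n.+1%:R^-1.
  by apply: hd; rewrite invr_gt0.
apply: (@hmeasurable_cvg _ _ _ _ (fun n xi => C' xi (h (i n)))) => [n|xi]; first exact: mh.
have cC : continuous (C' xi).
  apply: lipschitz_continuous (cocoercive_lipschitz tau0 (C'coco xi)).
  by rewrite invr_ge0 ltW.
apply: (@cvg_comp _ _ _ (fun n => h (i n)) (C' xi) \oo (nbhs x)); last exact: cC.
apply/cvgrPdist_lt => e e0; have [M _ HM] := near_infty_natSinv_lt (PosNum e0).
by exists M => // n /= Mn; apply: lt_trans (hi n) (HM _ Mn).
Qed.

End BochnerTheory.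

(** * Mean square estimates for one step *)

Section SquareMean.
Context (R : realType) (H : completeNormedModType R) (ip : {dot H for idfun}).
Hypothesis ipH : hilbert_norm ip.
Hypothesis Hsep : separable H.
Context d (X : measurableType d) (mu : probability X R).

Lemma integral_cst_probability (r : \bar R) : (\int[mu]_x r)%E = r.
Proof.
apply: etrans (@integral_cst _ _ _ mu _ measurableT r) _.
by rewrite -[RHS]mule1; congr (r * _)%E; exact: probability_setT.
Qed.

Lemma measurable_normsq (f : X -> H) : hmeasurable f ->
  measurable_fun setT (fun x => (`|f x| ^+ 2)%:E).
Proof.
by move=> mf; apply/measurable_EFinP; apply: measurable_funX; exact: hmeasurable_norm.
Qed.

(** Pythagoras in mean square: the cross term vanishes because [g] is centred. With [t = 1] it also
    shows that centring does not increase the second moment. *)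
Lemma integral_normsq_shift (g : X -> H) (b : H) (t : R) : hmeasurable g ->
  mu.-integrable setT (fun x => (`|g x| ^+ 2)%:E) ->
  (forall u, (\int[mu]_x (ip (g x) u)%:E)%E = 0%E) ->
  (\int[mu]_x (`|b + t *: g x| ^+ 2)%:E =
   (`|b| ^+ 2)%:E + (t ^+ 2)%:E * \int[mu]_x (`|g x| ^+ 2)%:E)%E.
Proof.
move=> mg g2 g0.
have ig : mu.-integrable setT (fun x => (ip (g x) b)%:E).
  have ib : mu.-integrable setT (fun x => (`|b| ^+ 2)%:E).
    exact: finite_measure_integrable_cst.
  apply: le_integrable (integrableD measurableT g2 ib) => //.
    by apply/measurable_EFinP; exact: (measurable_ip ipH).
  move=> x _ /=; rewrite lee_fin (ger0_norm (addr_ge0 _ _)) ?sqr_ge0//.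
  apply: (le_trans (abs_ip_le ipH _ _)).
  by move: `|g x| `|b| => p q; have := sqr_ge0 (p - q); nra.
have -> : (fun x => (`|b + t *: g x| ^+ 2)%:E) = (fun x => (`|b| ^+ 2)%:E +
    ((2 * t)%:E * (ip (g x) b)%:E + (t ^+ 2)%:E * (`|g x| ^+ 2)%:E))%E.
  apply/funext => x; rewrite -!EFinM -!EFinD (normsqD ipH) normsqZ ipZr (ipC ip b).
  by congr EFin; ring.
rewrite integralD//; last 2 first.
- exact: finite_measure_integrable_cst.
- by apply: integrableD => //; exact: integrableZl.
rewrite integral_cst_probability integralD//; [|exact: integrableZl..].
by rewrite !integralZl// g0 mule0 add0e.
Qed.

End SquareMean.

Section OneStep.
Context (R : realType) (H : completeNormedModType R) (ip : {dot H for idfun}).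
Hypothesis ipH : hilbert_norm ip.
Hypothesis Hsep : separable H.
Context d (X : measurableType d) (mu : probability X R).
Variables (T : X -> H -> H) (Tbar : H -> H) (p : H) (s2 : R).
Hypothesis Tne : forall xi, nonexpansive (T xi).
Hypothesis Tm : forall x, hmeasurable (T ^~ x).
Hypothesis Tbarne : nonexpansive Tbar.
Hypothesis TE : forall x u, mu.-integrable setT (fun xi => (ip (T xi x) u)%:E) /\
  (\int[mu]_xi (ip (T xi x) u)%:E = (ip (Tbar x) u)%:E)%E.
Hypothesis Tp : Tbar p = p.
Hypothesis Tvar : (\int[mu]_xi (`|T xi p - p| ^+ 2)%:E <= s2%:E)%E.
Implicit Types (x y u : H) (t : R).

Lemma bounded_normsq_integrable (g : X -> H) (b : R) : hmeasurable g ->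
  (forall xi, `|g xi| <= b) -> mu.-integrable setT (fun xi => (`|g xi| ^+ 2)%:E).
Proof.
move=> mg gb; apply: (@le_integrable _ _ _ _ _ measurableT _ (cst (b ^+ 2)%:E)).
- exact: measurable_normsq.
- move=> xi _ /=; rewrite lee_fin ger0_norm ?sqr_ge0// ger0_norm ?sqr_ge0//.
  by rewrite ler_sqr ?nnegrE// (le_trans _ (gb xi)).
- exact: finite_measure_integrable_cst.
Qed.

Lemma integral_ip_centered x u : (\int[mu]_xi (ip (T xi x - Tbar x) u)%:E)%E = 0%E.
Proof.
have [iT ET] := TE x u; under eq_integral do rewrite ipDl ipNl EFinD.
rewrite integralD//; last exact: finite_measure_integrable_cst.
by rewrite ET integral_cst_probability -EFinD subrr.
Qed.

(** Split the noise at [x] into the noise at [p] and the centred increment [G - m]. Centring does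
    not increase the second moment of [G], and [|G| <= |x - p|], hence the constant 2; the cruder
    bound [2 |x - p|] on [|G - m|] serves for integrability. *)
Lemma variance_le x :
  (\int[mu]_xi (`|T xi x - Tbar x| ^+ 2)%:E <= (2 * `|x - p| ^+ 2 + 2 * s2)%:E)%E.
Proof.
pose G xi := T xi x - T xi p; pose m := Tbar x - Tbar p.
have mG : hmeasurable G by exact: hmeasurableB.
have mGm : hmeasurable (fun xi => G xi - m).
  by apply: hmeasurableB => //; exact: hmeasurable_cst.
have Gm0 u : (\int[mu]_xi (ip (G xi - m) u)%:E)%E = 0%E.
  have [i1 E1] := TE x u; have [i2 E2] := TE p u.
  have -> : (fun xi => (ip (G xi - m) u)%:E) = (fun xi => (ip (T xi x) u)%:E -
      ((ip (T xi p) u)%:E + (ip m u)%:E))%E.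
    apply/funext => xi; rewrite -EFinD -EFinB !ipE; congr EFin; ring.
  rewrite integralB//; last first.
    by apply: integrableD => //; exact: finite_measure_integrable_cst.
  rewrite integralD//; last exact: finite_measure_integrable_cst.
  rewrite E1 E2 integral_cst_probability.
  have h : ip (Tbar x) u - (ip (Tbar p) u + ip m u) = 0 by rewrite /m !ipE; ring.
  exact: (congr1 EFin h).
have Gb xi : `|G xi| <= `|x - p| by exact: Tne.
have Gmb xi : `|G xi - m| <= 2 * `|x - p|.
  rewrite (le_trans (ler_normB _ _))//.
  by rewrite mulr_natl mulr2n lerD// /m; exact: Tbarne.
have iGm := bounded_normsq_integrable mGm Gmb.
have vG : (\int[mu]_xi (`|G xi - m| ^+ 2)%:E <= (`|x - p| ^+ 2)%:E)%E.
  have := integral_normsq_shift ipH Hsep m 1 mGm iGm Gm0.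
  rewrite expr1n mul1e => E.
  apply: (@le_trans _ _ (\int[mu]_xi (`|m + 1 *: (G xi - m)| ^+ 2)%:E)%E).
    by rewrite E leeDr// lee_fin sqr_ge0.
  apply: (@le_trans _ _ (\int[mu]_xi (`|x - p| ^+ 2)%:E)%E).
    apply: ae_ge0_le_integral => [xi|xi|]; rewrite ?lee_fin ?sqr_ge0//.
    apply: nearW => xi; rewrite lee_fin scale1r addrC subrK.
    by rewrite ler_sqr ?nnegrE.
  by rewrite integral_cst_probability.
have mTp : hmeasurable (fun xi => T xi p - p).
  by apply: hmeasurableB => //; exact: hmeasurable_cst.
apply: (@le_trans _ _ (\int[mu]_xi ((2%:E * (`|G xi - m| ^+ 2)%:E) +
    (2%:E * (`|T xi p - p| ^+ 2)%:E)))%E).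
  apply: ae_ge0_le_integral => [xi|xi|]; rewrite ?lee_fin ?sqr_ge0//.
  apply: nearW => xi; rewrite -!EFinM -EFinD lee_fin.
  have -> : T xi x - Tbar x = (G xi - m) + (T xi p - p).
    by rewrite /G /m Tp; vec ipH.
  exact: normsqD_le.
rewrite ge0_integralD//; [|by apply: measurable_funeM; exact: measurable_normsq..].
rewrite !ge0_integralZl//; [|exact: measurable_normsq..].
by rewrite [leRHS]EFinD (EFinM 2 s2) (EFinM 2 (_ ^+ 2)); apply: leeD; apply: lee_wpmul2l.
Qed.

(** The left point differs from the deterministic step [km Tbar t x] by the centred vector [t g], so
    its mean square splits into the contraction of [km_dist] and [t^2] times the variance. Both [x]
    and [y] are frozen here. *)
Lemma one_step x y t : 0 <= t ->
  (\int[mu]_xi (`|km (T xi) t x - km Tbar t y| ^+ 2)%:E +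
     (t * (1 - t) * `|(Tbar x - x) - (Tbar y - y)| ^+ 2)%:E <=
   (`|x - y| ^+ 2 + t ^+ 2 * (2 * `|x - p| ^+ 2 + 2 * s2))%:E)%E.
Proof.
move=> t0; pose g xi := T xi x - Tbar x.
have mg : hmeasurable g by apply: hmeasurableB => //; exact: hmeasurable_cst.
have vg := variance_le x.
have ig : mu.-integrable setT (fun xi => (`|g xi| ^+ 2)%:E).
  apply/integrableP; split; first exact: measurable_normsq.
  under eq_integral do rewrite abse_EFin ger0_norm ?sqr_ge0//.
  by rewrite (le_lt_trans vg)// ltry.
have E := integral_normsq_shift ipH Hsep (km Tbar t x - km Tbar t y) t mg ig
  (integral_ip_centered x).
have -> : (fun xi => (`|km (T xi) t x - km Tbar t y| ^+ 2)%:E) =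
    (fun xi => (`|(km Tbar t x - km Tbar t y) + t *: g xi| ^+ 2)%:E).
  apply/funext => xi; congr (`|_| ^+ 2)%:E; rewrite /km /g; vec ipH.
rewrite E addeAC [leRHS]EFinD; apply: leeD.
  by rewrite -[leLHS]EFinD lee_fin; exact: km_dist.
by rewrite [leRHS]EFinM; apply: lee_wpmul2l => //; rewrite lee_fin sqr_ge0.
Qed.

End OneStep.

(** * Independence of the past *)

Section IndependentIntegral.
Context (R : realType) (dO d1 d2 : measure_display) (Omega : measurableType dO) (P : probability Omega R).
Context (O1 : measurableType d1) (Y : measurableType d2).
Variables (i : {mfun Omega >-> O1}) (Z : {mfun Omega >-> Y}).
Hypothesis iZ : forall F E, measurable F -> measurable E ->
  P (i @^-1` F `&` Z @^-1` E) = (P (i @^-1` F) * P (Z @^-1` E))%E.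

(** The joint law of [i] and [Z] is the product of their laws. With [i] the identity of [Omega] onto
    [past xi k], this stands for conditioning: the past is frozen while the fresh variable is
    integrated. *)
Lemma integral_independent (f : O1 * Y -> \bar R) : measurable_fun setT f ->
  (forall z, 0 <= f z)%E ->
  (\int[P]_w f (i w, Z w) = \int[P]_w \int[distribution P Z]_y f (i w, y))%E.
Proof.
move=> mf f0.
have mphi : measurable_fun setT (fun w => (i w, Z w)).
  by apply: measurable_fun_pair; exact: measurable_funPT.
pose phi : {mfun Omega >-> (O1 * Y)%type} :=
  HB.pack (fun w => (i w, Z w)) (isMeasurableFun.Build _ _ _ _ _ mphi).
rewrite -[LHS](@ge0_integral_distribution _ _ _ _ _ P phi f mf f0).
transitivity (\int[distribution P i \x distribution P Z]_z f z)%E.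
  apply: eq_measure_integral => A mA _; apply/esym; apply: product_measure_unique mA.
  by move=> F E mF mE; exact: iZ.
rewrite fubini_tonelli1// /fubini_F ge0_integral_distribution//.
- exact: (measurable_fun_fubini_tonelli_F f).
- by move=> w; exact: integral_ge0.
Qed.

End IndependentIntegral.

Section Past.
Context (R : realType) (dO dX : measure_display) (Omega : measurableType dO) (P : probability Omega R).
Context (Xi : measurableType dX) (D : probability Xi R).
Implicit Types (xi : nat -> {RV P >-> Xi}) (k : nat).

(** Intersections over all [j < k], rather than single preimages, form a class stable under
    intersection, as the uniqueness theorem for measures demands. *)
Definition past_system xi k : set (set Omega) :=
  [set F | exists2 E : nat -> set Xi, (forall j, measurable (E j)) &
     F = \bigcap_(j in `I_k) xi j @^-1` E j].

(* [Omega] with the sigma-algebra generated by the first [k] samples. *)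
Definition past xi k := g_sigma_algebraType (past_system xi k).

Lemma past_system_measurable xi k : past_system xi k `<=` measurable.
Proof.
move=> _ [E mE ->]; by apply: bigcap_measurableType => j _; exact: measurable_funPTI.
Qed.

Lemma past_measurable xi k (F : set Omega) :
  measurable (F : set (past xi k)) -> measurable F.
Proof.
move: F; apply: smallest_sub; last exact: past_system_measurable.
exact: sigma_algebra_measurable.
Qed.

Lemma measurable_past_id xi k :
  measurable_fun setT (id : Omega -> past xi k).
Proof. by move=> _ F mF; rewrite setTI; exact: past_measurable mF. Qed.

Definition past_id xi k : {mfun Omega >-> past xi k} :=
  HB.pack (id : Omega -> past xi k)
    (isMeasurableFun.Build _ _ _ _ _ (@measurable_past_id xi k)).

Lemma measurable_past_sample xi k j : (j < k)%N ->
  measurable_fun setT (xi j : past xi k -> Xi).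
Proof.
move=> jk _ E mE; rewrite setTI; apply: sub_sigma_algebra.
exists (fun i => if i == j then E else setT); first by move=> i; case: ifP.
apply/seteqP; split => [w Ew i _ /=|w /(_ j jk)]; last by rewrite /= eqxx.
by case: eqP => [->|].
Qed.

Lemma measurable_past_subset xi k (I : set nat) (F : set Omega) : `I_k `<=` I ->
  measurable (F : set (past xi k)) -> sigma_generated I xi F.
Proof.
move=> kI; move: F; apply: smallest_sub; first exact: smallest_sigma_algebra.
move=> _ [E mE ->].
pose S := g_sigma_algebraType
  (\bigcup_(j in I) preimage_set_system setT (xi j) measurable).
apply: (@bigcap_measurableType _ S) => j jk; apply: sub_sigma_algebra.
by exists j; [exact: kI|exists (E j); rewrite ?setTI].
Qed.

Lemma iid_distribution (I : set nat) xi k E : iid D I xi -> I k -> measurable E ->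
  P (xi k @^-1` E) = D E.
Proof. by move=> [idd _] Ik mE; rewrite -(idd k Ik E mE). Qed.

Lemma iid_bigcap (I : set nat) xi k (E : nat -> set Xi) : iid D I xi -> `I_k `<=` I ->
  (forall j, measurable (E j)) ->
  P (\bigcap_(j in `I_k) xi j @^-1` E j) = (\prod_(j < k) P (xi j @^-1` E j))%E.
Proof.
move=> [_ indep] kI mE.
pose J := [fset j in iota 0 k]%fset.
have JE : [set` J] = `I_k.
  by apply/seteqP; split => j /=; rewrite !inE mem_iota add0n.
rewrite -JE indep//; last by rewrite JE.
rewrite (perm_big (iota 0 k)) /=; last first.
  apply: uniq_perm; [exact: fset_uniq|exact: iota_uniq|move=> j].
  by rewrite !inE.
by rewrite -(big_mkord xpredT (fun j => P (xi j @^-1` E j))) /index_iota subn0.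
Qed.

(** As functions of [F], both sides are finite measures, and they agree on [past_system], where the
    identity is the mutual independence of [k + 1] samples. *)
Lemma past_independent (I : set nat) xi k (F : set Omega) (E : set Xi) :
  iid D I xi -> `I_k.+1 `<=` I -> measurable (F : set (past xi k)) -> measurable E ->
  P (F `&` xi k @^-1` E) = (P F * P (xi k @^-1` E))%E.
Proof.
move=> iidxi kI mF mE; set A := xi k @^-1` E.
have mA : measurable A by exact: measurable_funPTI.
have PA : P A \is a fin_num by exact: fin_num_measure.
have PA0 : 0 <= fine (P A) by exact: fine_ge0.
pose m1 := mrestr P mA; pose m2 := mscale (NngNum PA0) P.
suff : m1 F = m2 F by rewrite /m1 /m2 /mrestr /mscale /= fineK// muleC.
apply: (@g_sigma_algebra_measure_unique _ _ _ (past_system xi k) _ (fun=> setT)) => //.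
- exact: past_system_measurable.
- by move=> _; exists (fun=> setT) => //; rewrite bigcapT.
- by rewrite bigcup_const//; exists 0%N.
- move=> _ _ [E1 mE1 ->] [E2 mE2 ->]; exists (fun j => E1 j `&` E2 j).
    by move=> j; exact: measurableI.
  by rewrite -bigcapI.
- move=> _ [E1 mE1 ->].
  change (P ((\bigcap_(j < k) xi j @^-1` E1 j) `&` A) =
    (fine (P A))%:E * P (\bigcap_(j < k) xi j @^-1` E1 j))%E.
  rewrite fineK// muleC.
  pose E' j := if j == k then E else E1 j.
  have mE' j : measurable (E' j) by rewrite /E'; case: ifP.
  have -> : (\bigcap_(j < k) xi j @^-1` E1 j) `&` A = \bigcap_(j < k.+1) xi j @^-1` E' j.
    apply/seteqP; split => [w [wE wA] j|w wE].
      rewrite /= ltnS leq_eqVlt => /orP[/eqP ->|jk]; first by rewrite /E' eqxx.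
      by rewrite /E' ltn_eqF//; exact: wE.
    split; last by have := wE k (ltnSn k); rewrite /= /E' eqxx.
    by move=> j /= jk; have := wE j (ltnW jk); rewrite /= /E' ltn_eqF.
  rewrite (iid_bigcap iidxi)// big_ord_recr /= {2}/E' eqxx (iid_bigcap iidxi)//.
    congr (_ * _)%E; apply: eq_bigr => j _.
    by rewrite /E' ltn_eqF.
  by move=> j jk; apply: kI; exact: ltnW.
- by move=> _; rewrite (@le_lt_trans _ _ 1%E) ?ltry//; apply: probability_le1; exact: measurableI.
Qed.

Lemma integral_past_sample (I : set nat) xi k (f : past xi k * Xi -> \bar R) :
  iid D I xi -> `I_k.+1 `<=` I -> measurable_fun setT f -> (forall z, 0 <= f z)%E ->
  (\int[P]_w f (w, xi k w) = \int[P]_w \int[D]_y f (w, y))%E.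
Proof.
move=> iidxi kI mf f0.
have := @integral_independent R _ _ _ Omega P (past xi k) Xi (past_id xi k) (xi k) _ f mf f0.
rewrite /= => ->; last first.
  by move=> F E mF mE; exact: (past_independent iidxi kI).
apply: eq_integral => w _; apply: eq_measure_integral => E mE _.
by apply: (iid_distribution iidxi) => //; apply: kI => /=.
Qed.

End Past.

(** * The stochastic iteration *)

Fixpoint stochastic_km (R : realType) (H : completeNormedModType R) (Xi : Type)
    (T : Xi -> H -> H) (l : nat -> R) (x0 : H) (s : nat -> Xi) (k : nat) : H :=
  if k is j.+1 then km (T (s j)) (l j) (stochastic_km T l x0 s j) else x0.

Section StochasticKM.
Context (R : realType) (H : completeNormedModType R) (ip : {dot H for idfun}).
Hypothesis ipH : hilbert_norm ip.
Hypothesis Hsep : separable H.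
Context (dO dX : measure_display) (Omega : measurableType dO) (P : probability Omega R).
Context (Xi : measurableType dX) (D : probability Xi R).
Variables (T : Xi -> H -> H) (Tbar : H -> H) (p : H) (s2 : R).
Hypothesis Tne : forall xi, nonexpansive (T xi).
Hypothesis Tm : forall x, hmeasurable (T ^~ x).
Hypothesis Tbarne : nonexpansive Tbar.
Hypothesis TE : forall x u, D.-integrable setT (fun xi => (ip (T xi x) u)%:E) /\
  (\int[D]_xi (ip (T xi x) u)%:E = (ip (Tbar x) u)%:E)%E.
Hypothesis Tp : Tbar p = p.
Hypothesis Tvar : (\int[D]_xi (`|T xi p - p| ^+ 2)%:E <= s2%:E)%E.
Variables (l : nat -> R) (x0 : H) (xi : nat -> {RV P >-> Xi}) (I : set nat).
Hypothesis l01 : forall k, 0 <= l k <= 1.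
Hypothesis iidxi : iid D I xi.

Lemma nonexpansive_continuous (F : H -> H) : nonexpansive F -> continuous F.
Proof.
by move=> Fne; apply: (lipschitz_continuous ler01) => x y; rewrite mul1r.
Qed.

Lemma km_continuous (F : H -> H) t : nonexpansive F -> continuous (km F t).
Proof.
move=> /nonexpansive_continuous Fc x; apply: cvgB; first exact: cvg_id.
by apply: cvgZr; apply: cvgB; [exact: cvg_id|exact: Fc].
Qed.

Lemma hmeasurable_km_sample t v : hmeasurable (fun y => km (T y) t v).
Proof.
apply: (hmeasurableB Hsep); first exact: hmeasurable_cst.
by apply/(hmeasurableZ Hsep)/(hmeasurableB Hsep) => //; exact: hmeasurable_cst.
Qed.

Lemma km_iter_continuous m j : continuous (fun x => km_iter Tbar l m x j).
Proof.
elim: j => [|j IH] x /=; first exact: cvg_id.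
by apply: (continuous_comp (IH x)); exact: km_continuous.
Qed.

Lemma hmeasurable_stochastic_km d (Z : measurableType d) (s : nat -> Z -> Xi) k :
  (forall j, (j < k)%N -> measurable_fun setT (s j)) ->
  hmeasurable (fun z => stochastic_km T l x0 (fun j => s j z) k).
Proof.
elim: k => [|k IH] ms /=; first exact: hmeasurable_cst.
apply: (hmeasurable_caratheodory Hsep (F := fun y => km (T y) (l k))).
- by apply: IH => j jk; apply: ms; exact: ltnW.
- exact: ms.
- by move=> v; exact: hmeasurable_km_sample.
- by move=> y; exact: km_continuous.
Qed.

Let X k (w : Omega) := stochastic_km T l x0 (fun j => xi j w) k.

Lemma hmeasurable_past_km j k : (j <= k)%N -> hmeasurable (X j : past xi k -> H).
Proof.
move=> jk; apply: hmeasurable_stochastic_km => i ij.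
exact: measurable_past_sample (leq_trans ij jk).
Qed.

Lemma hmeasurable_km k : hmeasurable (X k).
Proof. by apply: hmeasurable_stochastic_km => i _; exact: measurable_funPT. Qed.

(** This is [one_step] with the past frozen, then integrated over the past. The past event [F] is
    what allows [shadow_maximal] to stop the comparison once the gap has become large. *)
Lemma stochastic_step k (Y : Omega -> H) (F : set Omega) : `I_k.+1 `<=` I ->
  hmeasurable (Y : past xi k -> H) -> measurable (F : set (past xi k)) ->
  (\int[P]_w (\1_F w * (`|X k.+1 w - km Tbar (l k) (Y w)| ^+ 2 +
     l k * (1 - l k) * `|(Tbar (X k w) - X k w) - (Tbar (Y w) - Y w)| ^+ 2))%:E <=
   \int[P]_w (\1_F w * (`|X k w - Y w| ^+ 2 +
     l k ^+ 2 * (2 * `|X k w - p| ^+ 2 + 2 * s2)))%:E)%E.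
Proof.
move=> kI mY mF; have /andP[l0 l1] := l01 k.
have ll : 0 <= l k * (1 - l k) by rewrite mulr_ge0// subr_ge0.
have mX := hmeasurable_past_km (leqnn k).
have mRX : hmeasurable ((fun w => (Tbar (X k w) - X k w) - (Tbar (Y w) - Y w)) : past xi k -> H).
  have mT (Z : past xi k -> H) : hmeasurable Z -> hmeasurable (fun w => Tbar (Z w)).
    by move=> mZ; apply: (hmeasurable_comp Hsep mZ); exact: nonexpansive_continuous.
  by do 2?apply: hmeasurableB => //; exact: mT.
pose f (z : past xi k * Xi) : \bar R :=
  (\1_F z.1 * (`|km (T z.2) (l k) (X k z.1) - km Tbar (l k) (Y z.1)| ^+ 2 +
     l k * (1 - l k) * `|(Tbar (X k z.1) - X k z.1) - (Tbar (Y z.1) - Y z.1)| ^+ 2))%:E.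
have f0 z : (0 <= f z)%E.
  by rewrite lee_fin mulr_ge0// ?addr_ge0 ?sqr_ge0// mulr_ge0 ?sqr_ge0.
have mf : measurable_fun setT f.
  apply/measurable_EFinP; apply: measurable_funM.
    apply: (measurableT_comp _ measurable_fst); exact: measurable_indic.
  apply: measurable_funD; last first.
    apply: measurable_funM => //; apply: measurable_funX; apply: hmeasurable_norm.
    exact: (hmeasurable_precomp measurable_fst mRX).
  apply: measurable_funX; apply: hmeasurable_norm; apply: hmeasurableB => //.
    apply: (hmeasurable_caratheodory Hsep (F := fun y => km (T y) (l k))).
    - exact: (hmeasurable_precomp measurable_fst mX).
    - exact: measurable_snd.
    - by move=> v; exact: hmeasurable_km_sample.
    - by move=> y; exact: km_continuous.
  have mkY : hmeasurable ((fun w => km Tbar (l k) (Y w)) : past xi k -> H).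
    by apply: (hmeasurable_comp Hsep mY); exact: km_continuous.
  exact: (hmeasurable_precomp measurable_fst mkY).
rewrite [leLHS](_ : _ = \int[P]_w f (w, xi k w))%E//.
rewrite (integral_past_sample iidxi kI mf f0).
apply: ae_ge0_le_integral => [w|w|].
- exact: integral_ge0.
- rewrite lee_fin mulr_ge0// addr_ge0 ?sqr_ge0// mulr_ge0 ?sqr_ge0//.
  rewrite addr_ge0 ?mulr_ge0// ?sqr_ge0//.
  by rewrite -lee_fin (le_trans _ Tvar)// integral_ge0// => y _; rewrite lee_fin sqr_ge0.
apply: nearW => w; rewrite /f /=.
under eq_integral do rewrite EFinM.
have mnm : measurable_fun setT
    (fun y => (`|km (T y) (l k) (X k w) - km Tbar (l k) (Y w)| ^+ 2)%:E).
  apply: measurable_normsq; apply: (hmeasurableB Hsep); last exact: hmeasurable_cst.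
  exact: hmeasurable_km_sample.
rewrite ge0_integralZl//; last 2 first.
- by under eq_fun do rewrite EFinD; apply: emeasurable_funD.
- move=> y _; rewrite lee_fin addr_ge0 ?sqr_ge0// mulr_ge0 ?sqr_ge0//.
rewrite [leRHS]EFinM; apply: lee_wpmul2l => //.
under eq_integral do rewrite EFinD.
rewrite ge0_integralD//; last by move=> y _; rewrite lee_fin mulr_ge0 ?sqr_ge0.
rewrite integral_cst_probability.
exact: one_step.
Qed.



(** * Second moments of the distance to the fixed point and of the residual *)

Let sqdist k := (\int[P]_w (`|X k w - p| ^+ 2)%:E)%E.
Let sqres k := (\int[P]_w (`|Tbar (X k w) - X k w| ^+ 2)%:E)%E.

Lemma variance_bound_ge0 : 0 <= s2.
Proof.
by rewrite -lee_fin (le_trans _ Tvar)// integral_ge0// => y _; rewrite lee_fin sqr_ge0.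
Qed.

Lemma hmeasurable_nonexpansive d (Z : measurableType d) (f : Z -> H) (F : H -> H) :
  nonexpansive F -> hmeasurable f -> hmeasurable (fun z => F (f z)).
Proof.
by move=> Fne mf; apply: (hmeasurable_comp Hsep mf); exact: nonexpansive_continuous.
Qed.

Lemma measurable_sqdist k : measurable_fun setT (fun w => (`|X k w - p| ^+ 2)%:E).
Proof.
apply: measurable_normsq; apply: (hmeasurableB Hsep); first exact: hmeasurable_km.
exact: hmeasurable_cst.
Qed.

Lemma measurable_sqres k : measurable_fun setT (fun w => (`|Tbar (X k w) - X k w| ^+ 2)%:E).
Proof.
apply: measurable_normsq; apply: (hmeasurableB Hsep); last exact: hmeasurable_km.
by apply: hmeasurable_nonexpansive => //; exact: hmeasurable_km.
Qed.

Lemma stepsize_ge0 k : 0 <= l k * (1 - l k).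
Proof. by have /andP[? ?] := l01 k; rewrite mulr_ge0// subr_ge0. Qed.

Lemma moment_step k : `I_k.+1 `<=` I ->
  (sqdist k.+1 + (l k * (1 - l k))%:E * sqres k <=
   (1 + 2 * l k ^+ 2)%:E * sqdist k + (2 * l k ^+ 2 * s2)%:E)%E.
Proof.
move=> kI; have := stochastic_step (Y := fun=> p) kI (@hmeasurable_cst R H _ (past xi k) p) measurableT.
have -> : km Tbar (l k) p = p by rewrite /km Tp subrr scaler0 subr0.
have ll := stepsize_ge0 k; have s20 := variance_bound_ge0.
have -> : (fun w => (\1_setT w * (`|X k.+1 w - p| ^+ 2 + l k * (1 - l k) *
      `|Tbar (X k w) - X k w - (Tbar p - p)| ^+ 2))%:E) =
    (fun w => (`|X k.+1 w - p| ^+ 2)%:E +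
      (l k * (1 - l k))%:E * (`|Tbar (X k w) - X k w| ^+ 2)%:E)%E.
  by apply/funext => w; rewrite indicT mul1r Tp subrr subr0.
rewrite ge0_integralD//; last 3 first.
- exact: measurable_sqdist.
- by move=> w _; rewrite lee_fin mulr_ge0// sqr_ge0.
- by apply: measurable_funeM; exact: measurable_sqres.
rewrite ge0_integralZl//; last exact: measurable_sqres.
move=> /le_trans; apply.
have -> : (fun w => (\1_setT w * (`|X k w - p| ^+ 2 + l k ^+ 2 * (2 * `|X k w - p| ^+ 2 + 2 * s2)))%:E) =
   (fun w => (1 + 2 * l k ^+ 2)%:E * (`|X k w - p| ^+ 2)%:E + (2 * l k ^+ 2 * s2)%:E)%E.
  by apply/funext => w; rewrite indicT mul1r -EFinM -EFinD; congr EFin; ring.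
have t0 : 0 <= 1 + 2 * l k ^+ 2 by rewrite addr_ge0// mulr_ge0// sqr_ge0.
rewrite ge0_integralD//; last 3 first.
- by move=> w _; rewrite lee_fin mulr_ge0// sqr_ge0.
- by apply: measurable_funeM; exact: measurable_sqdist.
- by move=> w _; rewrite lee_fin mulr_ge0// mulr_ge0 ?sqr_ge0.
rewrite ge0_integralZl// ?integral_cst_probability//; exact: measurable_sqdist.
Qed.

Lemma sqdist_ge0 k : (0 <= sqdist k)%E.
Proof. by apply: integral_ge0 => w _; rewrite lee_fin sqr_ge0. Qed.

Lemma sqres_ge0 k : (0 <= sqres k)%E.
Proof. by apply: integral_ge0 => w _; rewrite lee_fin sqr_ge0. Qed.

Lemma sqdist0 : sqdist 0 = (`|x0 - p| ^+ 2)%:E.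
Proof. by rewrite /sqdist /X /= integral_cst_probability. Qed.

Lemma sqdist_fin k : `I_k `<=` I -> sqdist k \is a fin_num.
Proof.
elim: k => [|k IH] kI; first by rewrite sqdist0.
have /IH finIH : `I_k `<=` I by move=> j /= jk; apply: kI; exact: ltnW.
rewrite ge0_fin_numE ?sqdist_ge0//.
apply: (@le_lt_trans _ _ (sqdist k.+1 + (l k * (1 - l k))%:E * sqres k)%E).
  by rewrite leeDl// mule_ge0 ?sqres_ge0// lee_fin stepsize_ge0.
by apply: le_lt_trans (moment_step kI) _; rewrite -(fineK finIH) -EFinM -EFinD ltry.
Qed.

Lemma sqres_fin k : `I_k `<=` I -> sqres k \is a fin_num.
Proof.
move=> kI; rewrite ge0_fin_numE ?sqres_ge0//.
apply: (@le_lt_trans _ _ (4%:E * sqdist k)%E); last first.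
  by rewrite -(fineK (sqdist_fin kI)) -EFinM ltry.
rewrite -ge0_integralZl//; last exact: measurable_sqdist.
apply: ae_ge0_le_integral => [w|w|]; rewrite ?lee_fin ?sqr_ge0//.
apply: nearW => w; rewrite -EFinM lee_fin.
have := residual_lipschitz ipH Tbarne (X k w) p; rewrite Tp subrr normr0 add0r.
by have := normr_ge0 (Tbar (X k w) - X k w); move: `|_| `|X k w - p| => a b; nra.
Qed.

Lemma moment_step_fine k : `I_k.+1 `<=` I ->
  fine (sqdist k.+1) + l k * (1 - l k) * fine (sqres k) <=
  (1 + 2 * l k ^+ 2) * fine (sqdist k) + 2 * l k ^+ 2 * s2.
Proof.
move=> kI; have kI' : `I_k `<=` I by move=> j /= jk; apply: kI; exact: ltnW.
have := moment_step kI.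
rewrite -(fineK (sqdist_fin kI)) -(fineK (sqdist_fin kI')) -(fineK (sqres_fin kI')).
by rewrite -!EFinM -!EFinD lee_fin.
Qed.

(** A discrete Gronwall inequality; each noise term is simply put under the whole product, which is
    at least 1. *)
Lemma moment_bound k : `I_k `<=` I -> fine (sqdist k) <=
  \prod_(i < k) (1 + 2 * l i ^+ 2) * (`|x0 - p| ^+ 2 + 2 * s2 * \sum_(i < k) l i ^+ 2).
Proof.
elim: k => [|k IH] kI; first by rewrite sqdist0 !big_ord0 mulr0 addr0 mul1r.
have /IH h : `I_k `<=` I by move=> j /= jk; apply: kI; exact: ltnW.
have h2 := moment_step_fine kI.
have h3 : 0 <= l k * (1 - l k) * fine (sqres k).
  by rewrite mulr_ge0 ?stepsize_ge0// fine_ge0// sqres_ge0.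
rewrite !big_ord_recr /=; set Pi := \prod_(i < k) _ in h *; set S := \sum_(i < k) _ in h *.
have Pi1 : 1 <= Pi.
  rewrite /Pi; elim/big_ind : _ => // [a b a1 b1|i _].
    by rewrite -[1]mulr1 ler_pM.
  by rewrite lerDl mulr_ge0// sqr_ge0.
have t0 : 0 <= 2 * l k ^+ 2 by rewrite mulr_ge0// sqr_ge0.
have ts : 0 <= 2 * l k ^+ 2 * s2 by rewrite mulr_ge0// variance_bound_ge0.
have := ler_wpM2l (addr_ge0 ler01 t0) h.
have : 2 * l k ^+ 2 * s2 <= Pi * (1 + 2 * l k ^+ 2) * (2 * l k ^+ 2 * s2).
  by apply: ler_peMl => //; apply: mulr_ege1 => //; rewrite lerDl.
lra.
Qed.

(** [Lambda] is the integrating factor of [moment_step_fine]: multiplied by [Lambda l k.+1], the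
    inequality telescopes, and the residuals appear with exactly the weights by which the random
    index is drawn. *)
Lemma weighted_residual_sum K : `I_K `<=` I ->
  \sum_(k < K) index_weight l k * fine (sqres k) <=
  `|x0 - p| ^+ 2 + 2 * s2 * \sum_(k < K) l k ^+ 2.
Proof.
move=> KI.
have t1 k : 1 <= 1 + 2 * l k ^+ 2 by rewrite lerDl mulr_ge0// sqr_ge0.
have t0 k : 0 < 1 + 2 * l k ^+ 2 by exact: lt_le_trans (t1 k).
have Lam0 k : 0 < Lambda l k by apply: prodr_gt0 => i _; rewrite invr_gt0.
have Lam1 k : Lambda l k <= 1.
  by apply: prodr_ile1 => i _; rewrite invr_ge0 ltW//= invf_le1.
suff h : forall k, `I_k `<=` I -> Lambda l k * fine (sqdist k) +
    \sum_(i < k) index_weight l i * fine (sqres i) <=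
    `|x0 - p| ^+ 2 + 2 * s2 * \sum_(i < k) l i ^+ 2.
  apply: le_trans (h K KI); rewrite lerDr mulr_ge0 ?(ltW (Lam0 _))//.
  by rewrite fine_ge0// sqdist_ge0.
elim=> [|k IH] kI.
  by rewrite !big_ord0 mulr0 !addr0 sqdist0 /Lambda big_ord0 mul1r.
have /IH h : `I_k `<=` I by move=> j /= jk; apply: kI; exact: ltnW.
have h2 := ler_wpM2l (ltW (Lam0 k.+1)) (moment_step_fine kI).
rewrite !big_ord_recr /=.
have LE : Lambda l k.+1 * (1 + 2 * l k ^+ 2) = Lambda l k.
  by rewrite /Lambda big_ord_recr /= mulfVK// gt_eqF.
have : Lambda l k.+1 * (2 * l k ^+ 2 * s2) <= 2 * l k ^+ 2 * s2.
  by rewrite ler_piMl// mulr_ge0 ?variance_bound_ge0// mulr_ge0// sqr_ge0.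
move: h2; rewrite mulrDr [X in _ <= X]mulrDr (mulrA (Lambda _ _) (1 + _)) LE /index_weight.
by move: h; lra.
Qed.

(** * Deterministic shadows of the iterates *)

Let shadow m j (w : Omega) := km_iter Tbar l m (X m w) j.
Let gap m j (w : Omega) := `|X (m + j)%N w - shadow m j w|.

Lemma hmeasurable_past_shadow m j n : (m <= n)%N -> hmeasurable (shadow m j : past xi n -> H).
Proof.
move=> mn; have mX : hmeasurable (X m : past xi n -> H) by exact: hmeasurable_past_km.
by apply: (hmeasurable_comp Hsep mX (F := fun x => km_iter Tbar l m x j)); exact: km_iter_continuous.
Qed.

Lemma hmeasurable_shadow m j : hmeasurable (shadow m j).
Proof.
have mX : hmeasurable (X m) by exact: hmeasurable_km.
by apply: (hmeasurable_comp Hsep mX (F := fun x => km_iter Tbar l m x j)); exact: km_iter_continuous.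
Qed.

Lemma hmeasurable_gap m j : hmeasurable (fun w => X (m + j)%N w - shadow m j w).
Proof.
by apply: (hmeasurableB Hsep); [exact: hmeasurable_km|exact: hmeasurable_shadow].
Qed.

Lemma measurable_gap m j (F : set Omega) : measurable F ->
  measurable_fun setT (fun w => (\1_F w * gap m j w ^+ 2)%:E).
Proof.
move=> mF; apply/measurable_EFinP; apply: measurable_funM; first exact: measurable_indic.
by apply: measurable_funX; apply: hmeasurable_norm; exact: hmeasurable_gap.
Qed.

Lemma shadow_step m j (F : set Omega) M : `I_(m + j).+1 `<=` I ->
  measurable (F : set (past xi (m + j))) -> fine (sqdist (m + j)) <= M ->
  (\int[P]_w (\1_F w * gap m j.+1 w ^+ 2)%:E <=
   \int[P]_w (\1_F w * gap m j w ^+ 2)%:E +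
     (l (m + j)%N ^+ 2 * (2 * M + 2 * s2))%:E)%E.
Proof.
move=> kI mF dM; set k := (m + j)%N.
have kI' : `I_k `<=` I by move=> i /= ik; apply: kI; exact: ltnW.
have mFO := past_measurable mF; have s20 := variance_bound_ge0.
apply: (@le_trans _ _ (\int[P]_w (\1_F w * (`|X k w - shadow m j w| ^+ 2 +
     l k ^+ 2 * (2 * `|X k w - p| ^+ 2 + 2 * s2)))%:E)%E).
  have h := stochastic_step kI (hmeasurable_past_shadow j (leq_addr j m)) mF; apply: (le_trans _ h).
  apply: ae_ge0_le_integral => [w|w|].
  - by rewrite lee_fin mulr_ge0// sqr_ge0.
  - by rewrite lee_fin mulr_ge0// addr_ge0 ?sqr_ge0// mulr_ge0 ?stepsize_ge0// sqr_ge0.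
  apply: nearW => w; rewrite lee_fin ler_wpM2l// /gap addnS.
  by rewrite lerDl mulr_ge0 ?stepsize_ge0// sqr_ge0.
have lk0 : 0 <= l k ^+ 2 by exact: sqr_ge0.
have c0 : 0 <= l k ^+ 2 * (2 * s2) by rewrite mulr_ge0// mulr_ge0.
have c1 : 0 <= l k ^+ 2 * 2 by rewrite mulr_ge0.
have cd w : 0 <= l k ^+ 2 * 2 * `|X k w - p| ^+ 2 by rewrite mulr_ge0// sqr_ge0.
have g0 w : 0 <= \1_F w * gap m j w ^+ 2 by rewrite mulr_ge0// sqr_ge0.
apply: (@le_trans _ _ (\int[P]_w ((\1_F w * gap m j w ^+ 2)%:E +
   ((l k ^+ 2 * 2)%:E * (`|X k w - p| ^+ 2)%:E + (l k ^+ 2 * (2 * s2))%:E)))%E).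
  apply: ae_ge0_le_integral => [w|w|].
  - by rewrite lee_fin mulr_ge0// addr_ge0 ?sqr_ge0// mulr_ge0// addr_ge0 ?mulr_ge0.
  - by rewrite -EFinM -!EFinD lee_fin addr_ge0// addr_ge0.
  apply: nearW => w; rewrite -EFinM -!EFinD lee_fin mulrDr lerD2l.
  have -> : l k ^+ 2 * (2 * `|X k w - p| ^+ 2 + 2 * s2) =
    l k ^+ 2 * 2 * `|X k w - p| ^+ 2 + l k ^+ 2 * (2 * s2) by ring.
  by rewrite ler_piMl ?addr_ge0// indicE lern1; case: (w \in F).
have md := measurable_sqdist k.
have mc : measurable_fun setT (fun w => (l k ^+ 2 * 2)%:E * (`|X k w - p| ^+ 2)%:E)%E.
  exact: measurable_funeM.
rewrite ge0_integralD//; last 4 first.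
- by move=> w _; rewrite lee_fin.
- exact: measurable_gap.
- by move=> w _; rewrite -EFinM -EFinD lee_fin addr_ge0.
- by apply: emeasurable_funD.
rewrite leeD2l// ge0_integralD//; last by move=> w _; rewrite -EFinM lee_fin.
rewrite integral_cst_probability ge0_integralZl//.
rewrite -[X in (_ * X)%E](fineK (sqdist_fin kI')) -EFinM -EFinD lee_fin.
by have := ler_wpM2l c1 dM; lra.
Qed.

(** A stopping event: it is determined by the samples before time [m + j], so it can be the event
    [F] of [stochastic_step]. *)
Let tracks m e j := [set w | forall i, (i <= j)%N -> gap m i w < e].

Lemma gap0 m w : gap m 0 w = 0.
Proof. by rewrite /gap /shadow /= addn0 subrr normr0. Qed.

Lemma measurable_past_tracks m e j : measurable (tracks m e j : set (past xi (m + j))).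
Proof.
have -> : tracks m e j = \bigcap_(i in `I_j.+1) [set w | gap m i w < e].
  by apply/seteqP; split => w h i; exact: (h i).
apply: bigcap_measurableType => i /= ij.
have mg : hmeasurable ((fun w => X (m + i)%N w - shadow m i w) : past xi (m + j) -> H).
  apply: (hmeasurableB Hsep); first by apply: hmeasurable_past_km; rewrite leq_add2l.
  by apply: hmeasurable_past_shadow; exact: leq_addr.
by have := hmeasurable_ball 0 e mg; under eq_set do rewrite subr0.
Qed.

Lemma measurable_tracks m e j : measurable (tracks m e j).
Proof. by apply: (@past_measurable _ _ _ _ P _ xi (m + j)); exact: measurable_past_tracks. Qed.

Lemma measurable_gap_lt m e j : measurable [set w | gap m j w < e].
Proof.
by have := hmeasurable_ball 0 e (@hmeasurable_gap m j); under eq_set do rewrite subr0.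
Qed.

Lemma tracksS m e j : tracks m e j.+1 = tracks m e j `&` [set w | gap m j.+1 w < e].
Proof.
apply/seteqP; split => [w h|w [h1 h2] i].
  by split; [move=> i ij; apply: h; exact: leqW|exact: h].
by rewrite leq_eqVlt => /orP[/eqP ->//|/h1].
Qed.

(** Kolmogorov's maximal inequality, proved by induction on a potential: the squared gap where
    tracking has not failed yet, frozen at [e^2] from the first failure on. At that failure the
    squared gap is at least [e^2], so the part leaving the integral pays for the growth of the first
    term, and only the noise of [shadow_step] is added. *)
Lemma shadow_maximal m j e M : 0 < e -> `I_(m + j) `<=` I ->
  (forall k, (m <= k < m + j)%N -> fine (sqdist k) <= M) ->
  ((e ^+ 2)%:E * P (~` tracks m e j) + \int[P]_w (\1_(tracks m e j) w * gap m j w ^+ 2)%:E <=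
   (\sum_(m <= k < m + j) l k ^+ 2 * (2 * M + 2 * s2))%:E)%E.
Proof.
move=> e0; have e20 : 0 <= e ^+ 2 by exact: sqr_ge0.
elim: j => [|j IH] kI dM.
  have -> : tracks m e 0 = setT.
    by apply/seteqP; split => // w _ i; rewrite leqn0 => /eqP ->; rewrite gap0.
  rewrite setCT measure0 mule0 add0e addn0 big_geq//.
  under eq_integral do rewrite gap0 expr0n mulr0.
  by rewrite integral0.
rewrite addnS in kI dM *.
have jI : `I_(m + j) `<=` I by move=> i /= ij; apply: kI; exact: ltnW.
have {}IH := IH jI (fun k h => dM k ltac:(by case/andP: h => -> /ltnW)).
rewrite big_nat_recr ?leq_addr//= EFinD.
set S := (\sum_(_ <= _ < _) _)%:E in IH *; set B := tracks m e j in IH *.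
pose C := [set w | gap m j.+1 w < e].
have mB : measurable B by exact: measurable_tracks.
have mC : measurable C by exact: measurable_gap_lt.
have mBC : measurable (B `\` C) by exact: measurableD.
have mBC' : measurable (B `&` C) by exact: measurableI.
have dMj : fine (sqdist (m + j)) <= M by apply: dM; rewrite leq_addr ltnSn.
have step := shadow_step kI (@measurable_past_tracks m e j) dMj.
rewrite tracksS -/B -/C.
have -> : P (~` (B `&` C)) = (P (~` B) + P (B `\` C))%E.
  rewrite -measureU//; last 2 first.
  - exact: measurableC.
  - by rewrite setDE setIA setICl set0I.
  congr (P _); apply/seteqP; split => w /=; last by move=> [nB [//]|[_ nC []]].
  move=> nBC; have [Bw|] := pselect (B w); last by left.
  by right; split=> // Cw; apply: nBC.
rewrite ge0_muleDr// -addeA.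
apply: (@le_trans _ _ ((e ^+ 2)%:E * P (~` B) + \int[P]_w (\1_B w * gap m j.+1 w ^+ 2)%:E)%E).
  apply: leeD2l.
  have -> : ((e ^+ 2)%:E * P (B `\` C) = \int[P]_w ((e ^+ 2)%:E * (\1_(B `\` C) w)%:E))%E.
    rewrite ge0_integralZl//; first by rewrite integral_indic// setIT.
    by apply/measurable_EFinP; exact: measurable_indic.
  rewrite -ge0_integralD//; last 4 first.
  - by move=> w _; rewrite -EFinM lee_fin mulr_ge0.
  - by apply: measurable_funeM; apply/measurable_EFinP; exact: measurable_indic.
  - by move=> w _; rewrite lee_fin mulr_ge0// sqr_ge0.
  - exact: measurable_gap.
  apply: ae_ge0_le_integral => [w|w|].
  - by rewrite -EFinM -EFinD lee_fin addr_ge0// mulr_ge0// sqr_ge0.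
  - by rewrite lee_fin mulr_ge0// sqr_ge0.
  apply: nearW => w; rewrite -EFinM -EFinD lee_fin !indicE in_setD in_setI.
  have [Bw|Bw] := boolP (w \in B); rewrite ?mulr0 ?mul0r ?addr0 ?andbF//=.
  have [Cw|Cw] := boolP (w \in C); rewrite /= ?mulr0 ?mul0r ?mul1r ?mulr1 ?addr0 ?add0r//.
  have eg : e <= gap m j.+1 w.
    by rewrite leNgt; apply/negP => Cw'; move/negP : Cw; apply; rewrite inE.
  by rewrite ler_sqr ?nnegrE ?(ltW e0) ?(le_trans (ltW e0) eg).
apply: (le_trans (leeD2l _ step)); rewrite addeA; apply: leeD2r; exact: IH.
Qed.

Lemma shadow_sqr_mean m j M : `I_(m + j) `<=` I ->
  (forall k, (m <= k < m + j)%N -> fine (sqdist k) <= M) ->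
  (\int[P]_w (gap m j w ^+ 2)%:E <=
   (\sum_(m <= k < m + j) l k ^+ 2 * (2 * M + 2 * s2))%:E)%E.
Proof.
elim: j => [|j IH] kI dM.
  under eq_integral do rewrite gap0 expr0n.
  by rewrite integral0 addn0 big_geq.
rewrite addnS in kI dM *.
have jI : `I_(m + j) `<=` I by move=> i /= ij; apply: kI; exact: ltnW.
have {}IH := IH jI (fun k h => dM k ltac:(by case/andP: h => -> /ltnW)).
have dMj : fine (sqdist (m + j)) <= M by apply: dM; rewrite leq_addr ltnSn.
have := shadow_step kI measurableT dMj.
under eq_integral do rewrite indicT mul1r.
under [X in (_ <= X + _)%E]eq_integral do rewrite indicT mul1r.
move=> /le_trans; apply; rewrite big_nat_recr ?leq_addr//= EFinD.
exact: leeD2r.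
Qed.

(** The factors 2 and 8 come from squaring [residual_lipschitz]: [(c + 2 b)^2 <= 2 c^2 + 8 b^2],
    with [c] the residual of the shadow and [b] the gap. *)
Lemma residual_sqr_mean_last m j M : `I_(m + j) `<=` I ->
  (forall k, (m <= k <= m + j)%N -> fine (sqdist k) <= M) ->
  0 < \sum_(m <= k < m + j) l k * (1 - l k) ->
  fine (sqres (m + j)) <= 2 * (M / \sum_(m <= k < m + j) l k * (1 - l k)) +
    8 * \sum_(m <= k < m + j) l k ^+ 2 * (2 * M + 2 * s2).
Proof.
set S := \sum_(_ <= _ < _) _; set Q := \sum_(_ <= _ < _) _ => kI dM S0.
have kIm : `I_m `<=` I by move=> i /= im; apply: kI => /=; rewrite ltn_addr.
rewrite -lee_fin (fineK (sqres_fin kI)).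
have gapQ : (\int[P]_w (gap m j w ^+ 2)%:E <= Q%:E)%E.
  by apply: shadow_sqr_mean => // k /andP[mk kmj]; apply: dM; rewrite mk ltnW.
have g0 w : 0 <= gap m j w by exact: normr_ge0.
have mg2 : measurable_fun setT (fun w => (gap m j w ^+ 2)%:E).
  by apply: measurable_normsq; exact: hmeasurable_gap.
have S2 : 0 <= 2 / S by rewrite divr_ge0// ltW.
apply: (@le_trans _ _ (\int[P]_w ((2 / S)%:E * (`|X m w - p| ^+ 2)%:E +
    8%:E * (gap m j w ^+ 2)%:E))%E).
  apply: ae_ge0_le_integral => [w|w|].
  - by rewrite lee_fin sqr_ge0.
  - by rewrite -!EFinM -EFinD lee_fin addr_ge0// mulr_ge0// sqr_ge0.
  apply: nearW => w; rewrite -!EFinM -EFinD lee_fin.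
  have h1 := residual_lipschitz ipH Tbarne (X (m + j)%N w) (shadow m j w).
  have := km_iter_residual ipH Tbarne m (X m w) j Tp l01.
  rewrite -/S -/(shadow m j w) => h2.
  have {}h2 : `|Tbar (shadow m j w) - shadow m j w| ^+ 2 <= `|X m w - p| ^+ 2 / S.
    rewrite ler_pdivlMr// mulrC (le_trans _ h2)// lerDr sqr_ge0//.
  move: h1 h2 (g0 w); rewrite /gap; move: (normr_ge0 (Tbar (X (m + j)%N w) - X (m + j)%N w)).
  move: (`|Tbar (X (m + j)%N w) - X (m + j)%N w|) (`|X (m + j)%N w - _|) => a b.
  move: (`|Tbar _ - _|) (normr_ge0 (Tbar (shadow m j w) - shadow m j w)) => c c0 a0 h1 h2 b0.
  rewrite (mulrAC 2) -(mulrA 2).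
  have : a ^+ 2 <= (c + 2 * b) ^+ 2 by rewrite ler_sqr ?nnegrE// (le_trans a0).
  have := sqr_ge0 (c - 2 * b); lra.
rewrite ge0_integralD//; last 4 first.
- by move=> w _; rewrite -EFinM lee_fin mulr_ge0// sqr_ge0.
- by apply: measurable_funeM; exact: measurable_sqdist.
- by move=> w _; rewrite -EFinM lee_fin mulr_ge0// sqr_ge0.
- exact: measurable_funeM.
rewrite !ge0_integralZl//; [|by move=> w _; rewrite lee_fin sqr_ge0|exact: measurable_sqdist].
rewrite [leRHS]EFinD; apply: leeD; last by rewrite EFinM; apply: lee_wpmul2l.
rewrite -[X in (_ * X)%E](fineK (sqdist_fin kIm)) -EFinM lee_fin mulrA mulrAC.
by rewrite ler_pM2r ?invr_gt0// ler_pM2l// dM// leqnn leq_addr.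
Qed.

(** * Mean residuals and the random index *)

Lemma measurable_residual k : measurable_fun setT (fun w => `|Tbar (X k w) - X k w|%:E).
Proof.
apply/measurable_EFinP; apply: hmeasurable_norm; apply: (hmeasurableB Hsep); last exact: hmeasurable_km.
by apply: hmeasurable_nonexpansive => //; exact: hmeasurable_km.
Qed.

(** From [2 a <= t a^2 + 1 / t]. The parameter will be the inverse of the rate, so that a mean
    square of order [v^2] gives a mean of order [v]. *)
Lemma residual_mean_le k t : `I_k `<=` I -> 0 < t ->
  (\int[P]_w `|Tbar (X k w) - X k w|%:E <= ((t * fine (sqres k) + t^-1) / 2)%:E)%E.
Proof.
move=> kI t0; have t2 : 0 <= t / 2 by rewrite divr_ge0// ltW.
have t3 : 0 <= t^-1 / 2 by rewrite divr_ge0// invr_ge0 ltW.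
apply: (@le_trans _ _ (\int[P]_w ((t / 2)%:E * (`|Tbar (X k w) - X k w| ^+ 2)%:E +
    (t^-1 / 2)%:E))%E).
  apply: ae_ge0_le_integral => [w|w|].
  - by rewrite lee_fin.
  - by rewrite -EFinM -EFinD lee_fin addr_ge0// mulr_ge0// sqr_ge0.
  apply: nearW => w; rewrite -EFinM -EFinD lee_fin; move: `|_| => a.
  have : 0 <= t^-1 * (t * a - 1) ^+ 2 by rewrite mulr_ge0 ?sqr_ge0// invr_ge0 ltW.
  have -> : t^-1 * (t * a - 1) ^+ 2 = t * a ^+ 2 - 2 * a + t^-1.
    by field; rewrite gt_eqF.
  lra.
rewrite ge0_integralD//; last 2 first.
- by move=> w _; rewrite -EFinM lee_fin mulr_ge0// sqr_ge0.
- by apply: measurable_funeM; exact: measurable_sqres.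
rewrite integral_cst_probability ge0_integralZl//; last exact: measurable_sqres.
rewrite -[X in (_ * X)%E](fineK (sqres_fin kI)) -EFinM -EFinD lee_fin; lra.
Qed.

(** Freezing again: [X k] is determined by the past, of which [N] is independent, so [N] plays the
    fresh variable. *)
Lemma integral_index_residual (N : {RV P >-> nat}) k : independent_of I xi N -> `I_k `<=` I ->
  (\int[P]_w ((N w == k)%:R * `|Tbar (X k w) - X k w|)%:E =
   P (N @^-1` [set k]) * \int[P]_w `|Tbar (X k w) - X k w|%:E)%E.
Proof.
move=> Nindep kI.
have mX : hmeasurable (X k : past xi k -> H) by exact: hmeasurable_past_km.
have mRX : hmeasurable ((fun w => Tbar (X k w) - X k w) : past xi k -> H).
  by apply: (hmeasurableB Hsep) => //; exact: hmeasurable_nonexpansive.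
pose f (z : past xi k * nat) : \bar R := ((z.2 == k)%:R * `|Tbar (X k z.1) - X k z.1|)%:E.
have f0 z : (0 <= f z)%E by rewrite lee_fin mulr_ge0.
have mf : measurable_fun setT f.
  apply/measurable_EFinP; apply: measurable_funM.
    by apply: (@measurableT_comp _ _ _ _ _ _ (fun n : nat => (n == k)%:R : R)) measurable_snd.
  by apply: hmeasurable_norm; exact: (hmeasurable_precomp measurable_fst mRX).
have := @integral_independent R _ _ _ Omega P (past xi k) nat (past_id xi k) N _ f mf f0.
rewrite /= => ->; last first.
  move=> F E mF _; apply: Nindep; exact: measurable_past_subset mF.
have PN0 : 0 <= fine (P (N @^-1` [set k])) by rewrite fine_ge0.
have PNE : (fine (P (N @^-1` [set k])))%:E = P (N @^-1` [set k]).
  by rewrite fineK// fin_num_measure//; exact: measurable_funPTI.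
rewrite -PNE -ge0_integralZl//; last exact: measurable_residual.
apply: eq_integral => w _; rewrite /f /=.
under eq_integral do rewrite mulrC EFinM.
rewrite ge0_integralZl//.
rewrite muleC PNE; congr (_ * _)%E.
have -> : (fun y : nat => (y == k)%:R%:E) = (fun y => (\1_[set k] y)%:E : \bar R).
  apply/funext => y; rewrite indicE; congr (_%:R%:E).
  by congr nat_of_bool; apply/idP/idP => [/eqP yk|/set_mem ->]; [exact: mem_set|exact: eqxx].
by rewrite integral_indic// setIT.
Qed.

Lemma random_index_residual K (N : {RV P >-> nat}) t : `I_K `<=` I -> (0 < K)%N -> 0 < t ->
  random_index I xi l K N -> 0 < \sum_(k < K) index_weight l k ->
  (forall k, (k < K)%N -> 0 <= index_weight l k) ->
  (\int[P]_w `|Tbar (X (N w) w) - X (N w) w|%:E <=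
   ((t * ((`|x0 - p| ^+ 2 + 2 * s2 * \sum_(k < K) l k ^+ 2) /
     \sum_(k < K) index_weight l k) + t^-1) / 2)%:E)%E.
Proof.
move=> KI K0 t0 [NK Nindep NP] W0 w0; set W := \sum_(k < K) index_weight l k in W0 NP *.
have kI k : (k < K)%N -> `I_k `<=` I.
  by move=> kK j /= jk; apply: KI; exact: ltn_trans jk kK.
have -> : (fun w => `|Tbar (X (N w) w) - X (N w) w|%:E) =
    (fun w => \sum_(k < K) ((N w == k :> nat)%:R * `|Tbar (X k w) - X k w|)%:E)%E.
  apply/funext => w; rewrite (bigD1 (Ordinal (NK w)))//= eqxx mul1r big1 ?adde0// => i iN.
  by rewrite (_ : N w == i = false) ?mul0r//; apply/negbTE; rewrite eq_sym.
rewrite ge0_integral_sum//; last first.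
  move=> k; apply/measurable_EFinP; apply: measurable_funM.
    by apply: (@measurableT_comp _ _ _ _ _ _ (fun n : nat => (n == k)%:R : R)) => //; exact: measurable_funPT.
  by apply/measurable_EFinP; exact: measurable_residual.
apply: (@le_trans _ _ (\sum_(k < K) (index_weight l k / W * ((t * fine (sqres k) + t^-1) / 2))%:E)%E).
  apply: lee_sum => k _; rewrite integral_index_residual//; last exact: kI.
  rewrite NP// [leRHS]EFinM; apply: lee_wpmul2l; first by rewrite lee_fin divr_ge0 ?w0// ltW.
  by apply: residual_mean_le => //; exact: kI.
rewrite sumEFin lee_fin.
have -> : \sum_(k < K) index_weight l k / W * ((t * fine (sqres k) + t^-1) / 2) =
   (t * ((\sum_(k < K) index_weight l k * fine (sqres k)) / W) + t^-1) / 2.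
  transitivity (\sum_(k < K) (t / 2 / W * (index_weight l k * fine (sqres k)) + t^-1 / 2 / W * index_weight l k)).
    by apply: eq_bigr => k _; rewrite !(mulrDl, mulrDr); congr (_ + _); ring.
  rewrite big_split /= -!mulr_sumr -/W.
  by field; rewrite !gt_eqF.
rewrite ler_pM2r ?invr_gt0// lerD2r ler_pM2l// ler_pM2r ?invr_gt0//.
exact: weighted_residual_sum.
Qed.

(** * Almost sure shadowing *)

Lemma measure_bigcup_le (F : nat -> set Omega) (c : \bar R) :
  (forall n, measurable (F n)) -> nondecreasing_seq F -> (forall n, P (F n) <= c)%E ->
  (P (\bigcup_n F n) <= c)%E.
Proof.
move=> mF ndF Fc.
have h := nondecreasing_cvg_mu (mu := P) mF (bigcupT_measurable _ mF) ndF.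
rewrite -(cvg_lim _ h)//; apply: lime_le; last exact: nearW.
exact: cvgP h.
Qed.

(** For the accuracy [1 / (n + 1)] the bad event is that, for every [m], the shadow started at [m]
    is lost at some time. By the maximal inequality its probability is below a multiple of every
    tail sum of the [l k ^+ 2], hence it is 0; then take the union over [n]. *)
Lemma ae_shadowing M : I = setT -> (forall k, fine (sqdist k) <= M) ->
  (forall e, 0 < e -> exists m, forall j, \sum_(m <= k < m + j) l k ^+ 2 <= e) ->
  {ae P, forall w, forall e, 0 < e -> exists m, forall j, gap m j w <= e}.
Proof.
move=> IT dM tail.
have M0 : 0 <= M by rewrite (le_trans _ (dM 0%N))// sqdist0.
have s20 := variance_bound_ge0.
pose U m n := \bigcup_j ~` tracks m n.+1%:R^-1 j.
have mU m n : measurable (U m n).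
  by apply: bigcupT_measurable => j; apply: measurableC; exact: measurable_tracks.
have PU m n : forall c, (forall j, \sum_(m <= k < m + j) l k ^+ 2 <= c) ->
    (P (U m n) <= (n.+1%:R ^+ 2 * (c * (2 * M + 2 * s2)))%:E)%E.
  move=> c cm; apply: measure_bigcup_le.
  - by move=> j; apply: measurableC; exact: measurable_tracks.
  - move=> i j ij; apply/subsetPset => w /= nt tr; apply: nt => k ki.
    by apply: tr; exact: leq_trans ki ij.
  - move=> j; have n0 : 0 < n.+1%:R^-1 :> R by rewrite invr_gt0.
    have := @shadow_maximal m j _ M n0 ltac:(by rewrite IT) (fun k _ => dM k).
    set A := P _; set B := (\int[P]_w _)%E => h.
    have B0 : (0 <= B)%E.
      by apply: integral_ge0 => w _; rewrite lee_fin mulr_ge0// sqr_ge0.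
    have finA : A \is a fin_num.
      by rewrite fin_num_measure//; apply: measurableC; exact: measurable_tracks.
    have : (((n.+1%:R^-1) ^+ 2)%:E * A <= (c * (2 * M + 2 * s2))%:E)%E.
      apply: (le_trans (leeDl _ B0)); apply: (le_trans h); rewrite lee_fin.
      by rewrite -mulr_suml ler_wpM2r// addr_ge0// mulr_ge0.
    rewrite -(fineK finA) -EFinM !lee_fin exprVn mulrC ler_pdivrMr ?exprn_gt0//.
    by rewrite mulrC.
have negU n : P.-negligible (\bigcap_m U m n).
  exists (\bigcap_m U m n); split=> //; first by apply: bigcapT_measurable => m.
  apply/eqP; rewrite eq_le measure_ge0 andbT; apply/lee_addgt0Pr => e e0; rewrite add0e.
  pose K := n.+1%:R ^+ 2 * (2 * M + 2 * s2) + 1.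
  have K0 : 0 < K by rewrite ltr_wpDl// mulr_ge0 ?sqr_ge0// addr_ge0// mulr_ge0.
  have [m Hm] := tail (e / K) (divr_gt0 e0 K0).
  apply: (@le_trans _ _ (P (U m n))).
    by apply: le_measure; rewrite ?inE//; [apply: bigcapT_measurable|move=> w; apply].
  apply: (le_trans (PU m n _ Hm)); rewrite lee_fin.
  rewrite mulrCA mulrAC ler_pdivrMr// ler_pM2l//.
  by rewrite /K lerDl.
have := negligible_bigcup negU; apply: negligibleS => w /= nw.
apply: contrapT => nU; apply: nw => e e0.
have [n _ /(_ n (leqnn n)) /= ne] := near_infty_natSinv_lt (PosNum e0).
have /existsNP[m /existsNP [_ nUm]] : ~ (\bigcap_m U m n) w.
  by move=> h; apply: nU; exists n.
exists m => j; rewrite (le_trans _ (ltW ne))//; rewrite leNgt; apply/negP => lt.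
apply: nUm; exists j => //= /(_ j (leqnn j)).
by move=> /(lt_trans lt); rewrite ltxx.
Qed.

End StochasticKM.

(** * Step sizes *)

Section Schedules.
Context (R : realType).
Implicit Types (l phi : nat -> R) (s c lbar x a : R).

Lemma powR_expn x a n : (x `^ a) ^+ n = x `^ (a * n%:R).
Proof. by rewrite -powR_mulrn ?powR_ge0// powRrM. Qed.

(** A potential [phi] stands for the comparison with an integral and yields the total sum and the
    tails at once. The index 0 is excluded because [power_potential] vanishes there: a nonzero power
    of 0 is 0. *)
Lemma telescoping_sum_le l phi m n : (0 < m)%N -> (forall k, 0 <= phi k) ->
  (forall k, (0 < k)%N -> l k ^+ 2 <= phi k - phi k.+1) ->
  \sum_(m <= k < n) l k ^+ 2 <= phi m.
Proof.
move=> m0 phi0 lphi; have [mn|nm] := leqP m n; last by rewrite big_geq// ltnW.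
apply: (@le_trans _ _ (phi m - phi n)); last by rewrite gerBl.
rewrite -(subnKC mn); elim: (n - m)%N => [|j IH]; first by rewrite addn0 big_geq// subrr.
rewrite addnS big_nat_recr ?leq_addr//=.
by have := lphi (m + j)%N (ltn_addr _ m0); move: IH; lra.
Qed.

Lemma tail_sum_small l phi : (forall k, 0 <= phi k) ->
  (forall k, (0 < k)%N -> l k ^+ 2 <= phi k - phi k.+1) -> phi n @[n --> \oo] --> 0 ->
  forall e, 0 < e -> exists m, forall j, \sum_(m <= k < m + j) l k ^+ 2 <= e.
Proof.
move=> phi0 lphi /cvgrPdist_le phic e /phic[N _ HN]; exists N.+1 => j.
apply: (le_trans (telescoping_sum_le _ _ phi0 lphi)) => //.
by have := HN N.+1 (leqnSn N); rewrite sub0r normrN ger0_norm.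
Qed.

Lemma sqr_sum_le l phi n : (forall k, 0 <= phi k) ->
  (forall k, (0 < k)%N -> l k ^+ 2 <= phi k - phi k.+1) ->
  \sum_(k < n) l k ^+ 2 <= l 0%N ^+ 2 + phi 1%N.
Proof.
move=> phi0 lphi; case: n => [|n].
  by rewrite big_ord0 addr_ge0// sqr_ge0.
rewrite -(big_mkord xpredT (fun k => l k ^+ 2)) big_ltn// lerD2l.
exact: (telescoping_sum_le _ _ phi0 lphi).
Qed.

Lemma prod_le_expR l n s : \sum_(i < n) l i ^+ 2 <= s ->
  \prod_(i < n) (1 + 2 * l i ^+ 2) <= expR (2 * s).
Proof.
move=> ls; apply: (@le_trans _ _ (expR (2 * \sum_(i < n) l i ^+ 2))); last first.
  by rewrite ler_expR ler_pM2l.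
elim: n {ls} => [|n IH]; first by rewrite !big_ord0 mulr0 expR0.
rewrite !big_ord_recr /= (mulrDr 2) expRD ler_pM ?expR_ge1Dx//.
- by rewrite prodr_ge0// => i _; rewrite addr_ge0// mulr_ge0// sqr_ge0.
- by rewrite addr_ge0// mulr_ge0// sqr_ge0.
Qed.

Lemma Lambda_ge l n s : \sum_(i < n) l i ^+ 2 <= s -> expR (- (2 * s)) <= Lambda l n.
Proof.
move=> ls; rewrite /Lambda prodfV expRN lef_pV2 ?posrE ?expR_gt0 ?prod_le_expR//.
by apply: prodr_gt0 => i _; rewrite ltr_wpDr// mulr_ge0// sqr_ge0.
Qed.

Lemma index_weight_ge l K s lbar k : lbar < 1 -> (forall i, 0 <= l i <= lbar) ->
  \sum_(i < K) l i ^+ 2 <= s -> (k < K)%N ->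
  expR (- (2 * s)) * (1 - lbar) * l k <= index_weight l k.
Proof.
move=> lb1 l01 ls kK; have /andP[lk0 lk1] := l01 k.
rewrite /index_weight -mulrA (mulrC (1 - _)) mulrA ler_pM ?mulr_ge0 ?expR_ge0 ?subr_ge0//.
- exact: ltW.
- rewrite ler_wpM2r//; apply: Lambda_ge; apply: le_trans ls.
  rewrite -!(big_mkord xpredT (fun k => l k ^+ 2)).
  rewrite [leRHS](big_cat_nat (n := k.+1))//= lerDl.
  by apply: sumr_ge0 => i _; exact: sqr_ge0.
- by rewrite lerD2l lerN2.
Qed.

(** Were the sums from [m] bounded by [M], the harmonic series would be bounded, as
    [l k * (1 - l k)] is at least [c (1 - lbar) / (k + 1)]. *)
Lemma harmonic_divergent_sum l lbar c : 0 < c -> lbar < 1 -> (forall i, 0 <= l i <= lbar) ->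
  (forall k, c / k.+1%:R <= l k) ->
  forall m (M : R), exists j, M <= \sum_(m <= k < m + j) l k * (1 - l k).
Proof.
move=> c0 lb1 l01 lc m M; apply: contrapT => /forallNP h.
pose f n := \sum_(0 <= k < n) (k.+1%:R^-1 : R).
have cb : 0 < c * (1 - lbar) by rewrite mulr_gt0// subr_gt0.
apply: (@dvg_harmonic R); rewrite /series /=.
apply: nondecreasing_is_cvgn.
  by apply/nondecreasing_seqP => n; rewrite big_nat_recr//= lerDl invr_ge0.
exists (f m + M / (c * (1 - lbar))) => _ [n _ <-] /=.
have [nm|/ltnW mn] := leqP n m.
  rewrite (le_trans (_ : _ <= f m))//.
    rewrite /f [leRHS](big_cat_nat (n := n))//= lerDl.
    by apply: sumr_ge0 => i _; rewrite invr_ge0.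
  rewrite lerDl divr_ge0 ?(ltW cb)//; have /negP := h 0%N.
  by rewrite -ltNge addn0 big_geq// => /ltW.
rewrite (big_cat_nat (n := m))//= lerD2l ler_pdivlMr//.
have /negP := h (n - m)%N; rewrite -ltNge subnKC// => /ltW; apply: le_trans.
rewrite mulr_suml; apply: ler_sum => k _.
have /andP[lk0 lk1] := l01 k.
rewrite mulrCA mulrA ler_pM ?divr_ge0 ?(ltW c0) ?subr_ge0 ?(ltW lb1)//.
by rewrite lerD2l lerN2.
Qed.

End Schedules.

(** * Estimates for the four parameter sequences *)

Section ConcreteSchedules.
Context (R : realType) (lbar : R).
Hypotheses (lbar0 : 0 < lbar) (lbar1 : lbar < 1).
Local Notation e1 := (expR 1 : R).

Definition log_schedule k : R := lbar * k.+1%:R `^ (- (1 / 2)) * (ln (k%:R + e1))^-1.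
Definition power_schedule k : R := lbar * k.+1%:R `^ (- (2 / 3)).

(* Decreasing potentials whose increments dominate the squared step sizes. *)
Definition log_potential k : R := e1 * lbar ^+ 2 / ln (k%:R - 1 + e1).
Definition power_potential k : R := 3 * lbar ^+ 2 * k%:R `^ (- (1 / 3)).

Lemma powR_le1 (x a : R) : 1 <= x -> a <= 0 -> x `^ a <= 1.
Proof. by move=> x1 a0; rewrite -(powRr0 x) ler_powR. Qed.

Lemma expR1_gt2 : 2 <= e1.
Proof. by have := expR_ge1Dx (1 : R); lra. Qed.

Lemma expR1_le4 : e1 <= 4.
Proof.
have h : 2^-1 <= expR (- (1 / 2)) :> R by have := expR_ge1Dx (- (1 / 2) : R); lra.
have -> : e1 = (expR (- (1 / 2)) ^+ 2)^-1.
  by rewrite -expRM_natr -expRN; congr expR; field.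
have -> : 4 = ((2^-1) ^+ 2)^-1 :> R by field.
by rewrite lef_pV2 ?posrE ?exprn_gt0 ?expR_gt0 ?invr_gt0// ler_pXn2r ?nnegrE ?expR_ge0 ?invr_ge0.
Qed.

Lemma ln_ge1 (x : R) : e1 <= x -> 1 <= ln x.
Proof.
by move=> ex; rewrite -[1]expRK ler_ln ?posrE ?expR_gt0// (lt_le_trans _ ex) ?expR_gt0.
Qed.

Lemma power_schedule_bounds k : 0 <= power_schedule k <= lbar.
Proof.
rewrite /power_schedule mulr_ge0 ?powR_ge0 ?(ltW lbar0)//= ler_piMr ?(ltW lbar0)//.
by rewrite powR_le1 ?ler1n//; lra.
Qed.

Lemma log_schedule_bounds k : 0 <= log_schedule k <= lbar.
Proof.
have lk1 : 1 <= ln (k%:R + e1) by rewrite ln_ge1// lerDr.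
have lk0 : 0 <= (ln (k%:R + e1))^-1 by rewrite invr_ge0 (le_trans ler01).
rewrite /log_schedule mulr_ge0 ?mulr_ge0 ?powR_ge0 ?(ltW lbar0)//=.
rewrite -mulrA ler_piMr ?(ltW lbar0)// mulr_ile1 ?powR_ge0//.
  by rewrite powR_le1 ?ler1n//; lra.
by rewrite invf_le1// (lt_le_trans ltr01).
Qed.

Lemma power_potential_ge0 k : 0 <= power_potential k.
Proof. by rewrite /power_potential mulr_ge0 ?powR_ge0// mulr_ge0// sqr_ge0. Qed.

Lemma log_potential_ge0 k : 0 <= log_potential k.
Proof.
rewrite /log_potential divr_ge0 ?(mulr_ge0 (expR_ge0 _) (sqr_ge0 _))//.
by apply: ln_ge0; have := expR1_gt2; have := ler0n R k; lra.
Qed.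

Lemma powR_inv_expn (x : R) (n : nat) : 0 <= x -> (0 < n)%N ->
  (x `^ (- (n%:R^-1))) ^+ n = x^-1.
Proof.
move=> x0 n0; rewrite powR_expn mulNr mulVf ?pnatr_eq0 -?lt0n//.
by rewrite powR_inv1.
Qed.

(** The mean value inequality for the power -1/3, done algebraically: for [p], [q] the powers -1/3
    of [k] and [k + 1], [p^3 - q^3 = p^3 q^3], and factoring the left side reduces the claim
    [q^4 <= 3 (p - q)] to [q (p^2 + p q + q^2) <= 3 p^3], which follows from [q <= p]. *)
Lemma power_potential_step k : (0 < k)%N ->
  power_schedule k ^+ 2 <= power_potential k - power_potential k.+1.
Proof.
move=> k0; rewrite /power_schedule /power_potential exprMn.
have -> : (k.+1%:R `^ (- (2 / 3)) : R) ^+ 2 = (k.+1%:R `^ (- (1 / 3))) ^+ 4.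
  by rewrite !powR_expn; congr (_ `^ _); field.
set q : R := k.+1%:R `^ _; set p : R := k%:R `^ _.
have q3 : q ^+ 3 = k.+1%:R^-1 by rewrite -(@powR_inv_expn k.+1%:R 3)// /q div1r.
have p3 : p ^+ 3 = k%:R^-1 by rewrite -(@powR_inv_expn k%:R 3)// /p div1r.
have q0 : 0 < q by rewrite powR_gt0// ltr0n.
have p0 : 0 < p by rewrite powR_gt0// ltr0n.
have pq3 : p ^+ 3 - q ^+ 3 = p ^+ 3 * q ^+ 3.
  rewrite q3 p3 -addn1 natrD; field.
  by rewrite natr1 !pnatr_eq0 /= -lt0n.
have qp : q <= p.
  rewrite leNgt; apply/negP => pq; have := mulr_gt0 (exprn_gt0 3 p0) (exprn_gt0 3 q0).
  by rewrite -pq3 subr_gt0 ltr_pXn2r ?nnegrE ?ltW// ltNge ltW.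
suff h : q ^+ 4 <= 3 * (p - q).
  have := ler_wpM2l (sqr_ge0 lbar) h; lra.
have s0 : 0 < p ^+ 2 + p * q + q ^+ 2 by rewrite !addr_gt0 ?mulr_gt0 ?exprn_gt0.
rewrite -(ler_pM2r s0).
have -> : 3 * (p - q) * (p ^+ 2 + p * q + q ^+ 2) = 3 * (p ^+ 3 - q ^+ 3) by ring.
rewrite pq3.
have -> : 3 * (p ^+ 3 * q ^+ 3) = q ^+ 3 * (3 * p ^+ 3) by ring.
have -> : q ^+ 4 * (p ^+ 2 + p * q + q ^+ 2) = q ^+ 3 * (q * p ^+ 2 + p * q ^+ 2 + q ^+ 3) by ring.
rewrite ler_pM2l ?exprn_gt0//.
have h1 : q * p ^+ 2 <= p ^+ 3 by rewrite exprS ler_wpM2r// sqr_ge0.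
have h2 : q ^+ 2 <= p ^+ 2 by rewrite ler_pXn2r ?nnegrE ?(ltW q0) ?(ltW p0).
have h3 : p * q ^+ 2 <= p ^+ 3 by rewrite [X in _ <= X]exprS ler_pM2l.
have h4 : q ^+ 3 <= p ^+ 3 by rewrite ler_pXn2r ?nnegrE ?(ltW q0) ?(ltW p0).
lra.
Qed.

(** The mean value inequality for [1 / ln] between [a] and [b = a + 1]: [ln b - ln a >= 1 / b]. The
    factor [e1] of the potential compares [1 / (k + 1)] with [1 / (k + e1)], and its shift by 1
    makes [ln b] the logarithm of the step size. *)
Lemma log_potential_step k : (0 < k)%N ->
  log_schedule k ^+ 2 <= log_potential k - log_potential k.+1.
Proof.
move=> k0; rewrite /log_schedule /log_potential.
have -> : k.+1%:R - 1 + e1 = k%:R + e1 by rewrite -natr1 addrK.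
set b := k%:R + e1; set a := k%:R - 1 + e1.
have k1 : 1 <= k%:R :> R by rewrite ler1n.
have e2 := expR1_gt2.
have ae : e1 <= a by rewrite /a; lra.
have ba : b = a + 1 by rewrite /a /b; lra.
have a0 : 0 < a by rewrite (lt_le_trans _ ae)// expR_gt0.
have b0 : 0 < b by rewrite ba addr_gt0.
have la1 : 1 <= ln a by exact: ln_ge1.
have lab : ln a <= ln b by rewrite ler_ln ?posrE// ba lerDl.
have la0 : 0 < ln a by rewrite (lt_le_trans ltr01).
have lb0 : 0 < ln b by rewrite (lt_le_trans la0).
rewrite !exprMn powR_expn.
have -> : - (1 / 2) * 2%:R = -1 :> R by field.
have L0 : 0 < lbar ^+ 2 by rewrite exprn_gt0.
rewrite powR_inv1//; move: (lbar ^+ 2) L0 => L L0.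
rewrite -mulrBr -!mulrA [X in _ <= X]mulrCA ler_pM2l//.
have h1 : b^-1 <= ln b - ln a.
  have : ln (a / b) <= a / b - 1.
    by rewrite -ler_expR lnK ?posrE ?divr_gt0// (le_trans _ (expR_ge1Dx _))// addrC subrK.
  rewrite ln_div ?posrE// => h; have : a / b = 1 - b^-1 by rewrite ba; field; lra.
  lra.
have h2 : k.+1%:R^-1 <= e1 / b.
  rewrite -[leLHS]div1r ler_pdivrMr ?ltr0n// mulrAC ler_pdivlMr// mul1r /b -natr1.
  by nra.
have -> : (ln a)^-1 - (ln b)^-1 = (ln b - ln a) / (ln a * ln b).
  by field; rewrite !gt_eqF.
have lab2 : 0 <= (ln a * ln b)^-1 by rewrite invr_ge0 mulr_ge0// ltW.
have h3 : (ln b)^-1 ^+ 2 <= (ln a * ln b)^-1.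
  by rewrite exprVn lef_pV2 ?posrE ?exprn_gt0 ?mulr_gt0// expr2 ler_pM2r.
have eb0 : 0 <= e1 / b by rewrite divr_ge0 ?expR_ge0 ?(ltW b0).
apply: (@le_trans _ _ (e1 / b * (ln a * ln b)^-1)).
  by apply: ler_pM => //; exact: sqr_ge0.
by rewrite -mulrA ler_pM2l ?expR_gt0// ler_wpM2r.
Qed.

Lemma power_potential_cvg : power_potential n @[n --> \oo] --> 0.
Proof.
apply/cvgrPdist_le => e e0; have c0 : 0 < (e / 3) ^+ 3 by rewrite exprn_gt0// divr_gt0.
have [N _ HN] := near_infty_natSinv_lt (PosNum c0).
exists N.+1 => // n /= Nn; rewrite sub0r normrN ger0_norm ?power_potential_ge0//.
have n0 : (0 < n)%N by exact: leq_trans Nn.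
rewrite /power_potential; set p : R := n%:R `^ _.
have p3 : p ^+ 3 = n%:R^-1 by rewrite -(@powR_inv_expn n%:R 3)// /p div1r.
have pe : p <= e / 3.
  rewrite -(ler_pXn2r (n := 3)) ?nnegrE ?powR_ge0 ?divr_ge0 ?(ltW e0)// p3.
  rewrite -(prednK n0); apply: ltW; apply: HN => /=.
  by rewrite -ltnS prednK.
have : lbar ^+ 2 <= 1 by rewrite expr_le1// ltW.
have : 0 <= p by exact: powR_ge0.
have := sqr_ge0 lbar; nra.
Qed.

Lemma log_potential_cvg : log_potential n @[n --> \oo] --> 0.
Proof.
apply/cvgrPdist_le => e e0; near=> n.
rewrite sub0r normrN ger0_norm ?log_potential_ge0// /log_potential.
have n1 : expR (e1 / e) + 1 <= n%:R by near: n; exact: nbhs_infty_ger.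
have e2 := expR1_gt2.
have x0 : 0 < n%:R - 1 + e1.
  by rewrite addr_gt0 ?expR_gt0// subr_gt0 (lt_le_trans _ n1)// ltrDr expR_gt0.
have h : e1 / e <= ln (n%:R - 1 + e1).
  rewrite -[leLHS]expRK ler_ln ?posrE ?expR_gt0//.
  by have := expR_gt0 (1 : R); lra.
have l0 : 0 < ln (n%:R - 1 + e1) by rewrite (lt_le_trans _ h)// divr_gt0 ?expR_gt0.
rewrite ler_pdivrMr//; move: h; rewrite ler_pdivrMr// mulrC => h.
apply: le_trans h; rewrite ler_piMr ?expR_ge0// expr_le1 ?ltW//.
Unshelve. all: by end_near. Qed.

Lemma power_schedule_ge k : lbar / k.+1%:R <= power_schedule k.
Proof.
rewrite /power_schedule ler_pM2l// -powR_inv1// ler_powR ?ler1n//; lra.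
Qed.

Lemma log_schedule_ge k : lbar / 4 / k.+1%:R <= log_schedule k.
Proof.
have e4 := expR1_le4; have k1 : 1 <= k.+1%:R :> R by rewrite ler1n.
have x0 : 0 < k%:R + e1 by rewrite ltr_wpDl// expR_gt0.
have lx1 : 1 <= ln (k%:R + e1) by rewrite ln_ge1// lerDr.
set q : R := k.+1%:R `^ (1 / 2).
have q0 : 0 < q by rewrite powR_gt0// ltr0n.
have q2 : q ^+ 2 = k.+1%:R by rewrite /q powR_expn divfK ?pnatr_eq0// powRr1// ler0n.
(* With [p] the square root of [k + e1], the logarithm is [2 ln p <= 2 p], and [p <= 2 q] since
   [e1 <= 4]. *)
have lx : ln (k%:R + e1) <= 4 * q.
  set p : R := (k%:R + e1) `^ (1 / 2).
  have p0 : 0 < p by rewrite powR_gt0.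
  have p2 : p ^+ 2 = k%:R + e1 by rewrite /p powR_expn divfK ?pnatr_eq0// powRr1// ltW.
  have pq : p <= 2 * q.
    rewrite -(ler_pXn2r (n := 2)) ?nnegrE ?(mulr_ge0 _ (ltW q0)) ?(ltW p0)//.
    rewrite exprMn p2 q2 -[k.+1%:R]natr1.
    by have := ler0n R k; lra.
  have -> : ln (k%:R + e1) = 2 * ln p by rewrite /p ln_powR; field.
  have : ln p <= p by rewrite -ler_expR lnK ?posrE// (le_trans _ (expR_ge1Dx _))// lerDr.
  lra.
rewrite /log_schedule powRN -/q -q2.
have -> : lbar / 4 / q ^+ 2 = lbar / q * (4 * q)^-1 by field; rewrite gt_eqF.
rewrite ler_pM2l ?divr_gt0// lef_pV2 ?posrE ?mulr_gt0// (lt_le_trans ltr01)//.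
Qed.


Definition sqrt_schedule K (_ : nat) : R := lbar * K%:R `^ (- (1 / 2)).
Definition constant_power_schedule K (_ : nat) : R := lbar * K%:R `^ (- (2 / 3)).

Let lbar_sqr : lbar ^+ 2 <= 1.
Proof. by rewrite expr_le1// ltW. Qed.

Lemma constant_schedule_bounds a K (k : nat) : (0 < K)%N -> a <= 0 ->
  0 <= lbar * K%:R `^ a <= lbar.
Proof.
move=> K0 a0; rewrite mulr_ge0 ?powR_ge0 ?(ltW lbar0)//= ler_piMr ?(ltW lbar0)//.
by rewrite powR_le1// ler1n.
Qed.

Lemma sqrt_schedule_bounds K k : (0 < K)%N -> 0 <= sqrt_schedule K k <= lbar.
Proof. by move=> K0; apply: constant_schedule_bounds => //; lra. Qed.

Lemma constant_power_schedule_bounds K k : (0 < K)%N ->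
  0 <= constant_power_schedule K k <= lbar.
Proof. by move=> K0; apply: constant_schedule_bounds => //; lra. Qed.

Let powR_half K : (K%:R `^ (- (1 / 2)) : R) ^+ 2 = K%:R^-1.
Proof. by rewrite div1r powR_inv_expn. Qed.

Lemma sqrt_schedule_sqr_sum K : (0 < K)%N -> \sum_(k < K) sqrt_schedule K k ^+ 2 <= 1.
Proof.
move=> K0; rewrite /sqrt_schedule sumr_const card_ord -[X in X <= _]mulr_natl exprMn mulrCA.
by rewrite powR_half divff ?mulr1 ?lbar_sqr// pnatr_eq0 -lt0n.
Qed.

Lemma sqrt_schedule_sum K : (0 < K)%N ->
  lbar / (K%:R `^ (- (1 / 4))) ^+ 2 <= \sum_(k < K) sqrt_schedule K k.
Proof.
move=> K0; rewrite /sqrt_schedule sumr_const card_ord -[X in _ <= X]mulr_natl mulrCA ler_pM2l//.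
have -> : (K%:R `^ (- (1 / 4)) : R) ^+ 2 = K%:R `^ (- (1 / 2)).
  by rewrite powR_expn; congr (_ `^ _); field.
have := powR_half K.
have : 0 < (K%:R `^ (- (1 / 2)) : R) by rewrite powR_gt0// ltr0n.
move: (_ `^ _) => h h0 h2.
have Kp : K%:R != 0 :> R by rewrite pnatr_eq0 -lt0n.
have -> : K%:R * h = (K%:R * h ^+ 2) / h by field; rewrite gt_eqF.
by rewrite h2 divff// div1r.
Qed.

Lemma log_schedule_sum K : (3 <= K)%N ->
  lbar / 2 / (ln K%:R `^ (1 / 2) * K%:R `^ (- (1 / 4))) ^+ 2 <= \sum_(k < K) log_schedule k.
Proof.
move=> K3; have K0 : (0 < K)%N by exact: ltn_trans K3.
have K3R : 3 <= K%:R :> R by rewrite ler_nat.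
have lK0 : 0 < ln K%:R :> R by rewrite ln_gt0//; lra.
rewrite exprMn !powR_expn.
have -> : 1 / 2 * 2%:R = 1 :> R by field.
have -> : - (1 / 4) * 2%:R = - (1 / 2) :> R by field.
rewrite powRr1 ?(ltW lK0)//.
have h2 := powR_half K.
have h0 : 0 < (K%:R `^ (- (1 / 2)) : R) by rewrite powR_gt0// ltr0n.
apply: (@le_trans _ _ (\sum_(k < K) lbar * K%:R `^ (- (1 / 2)) * (2 * ln K%:R)^-1)).
  rewrite sumr_const card_ord -[X in _ <= X]mulr_natl.
  move: h0 h2; move: (_ `^ _) => h h0 h2.
  have -> : K%:R * (lbar * h * (2 * ln K%:R)^-1) = lbar / 2 / (ln K%:R * h) * (K%:R * h ^+ 2).
    by field; rewrite !gt_eqF.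
  by rewrite h2 divff ?mulr1// pnatr_eq0 -lt0n.
(* Term by term: [k + 1 <= K] for the power, and [k + e1 <= K^2] for the logarithm, which is where
   [K >= 3] enters. *)
apply: ler_sum => -[k kK] _ /=; rewrite /log_schedule -!mulrA ler_pM2l//.
have x0 : 0 < k%:R + e1 by rewrite ltr_wpDl// expR_gt0.
apply: ler_pM; rewrite ?powR_ge0 ?invr_ge0 ?mulr_ge0 ?(ltW lK0)//.
  rewrite !powRN lef_pV2 ?posrE ?powR_gt0 ?ltr0n//.
  by rewrite ge0_ler_powR ?nnegrE ?ler_nat//; lra.
rewrite lef_pV2 ?posrE ?mulr_gt0//; last by rewrite (lt_le_trans ltr01)// ln_ge1// lerDr.
have -> : 2 * ln K%:R = ln (K%:R ^+ 2) :> R by rewrite lnXn ?ltr0n// mulr_natl.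
rewrite ler_ln ?posrE ?exprn_gt0 ?ltr0n//.
have : k%:R + 1 <= K%:R :> R by rewrite natr1 ler_nat.
by have := expR1_le4; nra.
Qed.

(** Every power of [K] in the estimates below is a power of [q], so that they become polynomial
    identities modulo [K q^6 = 1]. *)
Let sixth K : (0 < K)%N -> exists q : R, [/\ 0 < q, q <= 1, K%:R `^ (- (1 / 6)) = q,
  K%:R `^ (- (2 / 3)) = q ^+ 4 & q ^+ 6 = K%:R^-1].
Proof.
move=> K0; exists (K%:R `^ (- (1 / 6))); split=> //.
- by rewrite powR_gt0// ltr0n.
- by rewrite powR_le1 ?ler1n//; lra.
- by rewrite powR_expn; congr (_ `^ _); field.
- by rewrite div1r powR_inv_expn.
Qed.

Lemma constant_power_schedule_sqr_sum K : (0 < K)%N ->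
  \sum_(0 <= k < 0 + K) constant_power_schedule K k ^+ 2 <= 1 * (K%:R `^ (- (1 / 6))) ^+ 2.
Proof.
move=> K0; rewrite /constant_power_schedule big_const_nat iter_addr_0 add0n subn0 -[X in X <= _]mulr_natl.
have [q [q0 q1 -> -> q6]] := sixth K0.
have -> : K%:R * (lbar * q ^+ 4) ^+ 2 = lbar ^+ 2 * (q ^+ 2 * (K%:R * q ^+ 6)) by ring.
rewrite q6 divff ?pnatr_eq0 -?lt0n// mulr1 ler_wpM2r ?sqr_ge0//.
Qed.

Lemma constant_power_schedule_sum K : (0 < K)%N ->
  lbar * (1 - lbar) / (K%:R `^ (- (1 / 6))) ^+ 2 <=
  \sum_(0 <= k < 0 + K) constant_power_schedule K k * (1 - constant_power_schedule K k).
Proof.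
move=> K0; rewrite /constant_power_schedule big_const_nat iter_addr_0 add0n subn0 -[X in _ <= X]mulr_natl.
rewrite -/(constant_power_schedule K 0).
have /andP[_ lb] := constant_power_schedule_bounds 0 K0.
apply: (@le_trans _ _ (K%:R * (constant_power_schedule K 0 * (1 - lbar)))); last first.
  rewrite ler_pM2l ?ltr0n// ler_wpM2l ?mulr_ge0 ?powR_ge0 ?(ltW lbar0)//.
  by rewrite lerD2l lerN2.
rewrite /constant_power_schedule.
have [q [q0 q1 -> -> q6]] := sixth K0.
have -> : K%:R * (lbar * q ^+ 4 * (1 - lbar)) = lbar * (1 - lbar) / q ^+ 2 * (K%:R * q ^+ 6).
  by field; rewrite gt_eqF.
by rewrite q6 divff ?mulr1// pnatr_eq0 -lt0n.
Qed.

(** The window starts at [K / 2] because from 0 the sum of squares is at least [lbar^2]; on the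
    window each square is at most the eighth power of [r], the power -1/6 of [K./2 + 1]. The
    rounding [uphalf] makes the window end exactly at [K]. *)
Lemma power_schedule_sqr_sum K : (0 < K)%N ->
  \sum_(K./2 <= k < K./2 + uphalf K) power_schedule k ^+ 2 <= 2 * (K%:R `^ (- (1 / 6))) ^+ 2.
Proof.
move=> K0; have [q [q0 q1 -> _ q6]] := sixth K0.
have [r [r0 r1 _ r4 r6]] := sixth (ltn0Sn K./2).
apply: (@le_trans _ _ (\sum_(K./2 <= k < K./2 + uphalf K) r ^+ 8)).
  apply: ler_sum_nat => k /andP[mk _].
  apply: (@le_trans _ _ ((k.+1%:R `^ (- (2 / 3))) ^+ 2)).
    by rewrite exprMn ler_piMl ?sqr_ge0.
  have -> : r ^+ 8 = (r ^+ 4) ^+ 2 by ring.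
  rewrite -r4 ler_sqr ?nnegrE ?powR_ge0// !powRN lef_pV2 ?posrE ?powR_gt0 ?ltr0n//.
  by rewrite ge0_ler_powR ?nnegrE ?ler_nat//; lra.
rewrite big_const_nat iter_addr_0 addKn -[X in X <= _]mulr_natl.
have m0 : 0 < (K./2.+1)%:R :> R by rewrite ltr0n.
have mr : (K./2.+1)%:R * r ^+ 6 = 1 by rewrite r6 divff ?gt_eqF.
have um : (uphalf K)%:R <= (K./2.+1)%:R :> R.
  by rewrite ler_nat uphalf_half; case: odd.
have Km : K%:R <= 2 * (K./2.+1)%:R :> R.
  by rewrite -natrM ler_nat mul2n -{1}(odd_double_half K) doubleS -addn2 addnC leq_add2l; case: odd.
apply: (@le_trans _ _ (r ^+ 2)).
  have -> : (uphalf K)%:R * r ^+ 8 = r ^+ 2 * ((uphalf K)%:R * r ^+ 6) by ring.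
  rewrite ler_piMr ?sqr_ge0// -[leRHS]mr ler_wpM2r//.
  by rewrite exprn_ge0// ltW.
have rq : r ^+ 6 <= 8 * q ^+ 6.
  rewrite r6 q6 -[leLHS]div1r ler_pdivrMr// -ler_pdivrMl ?mulr_gt0 ?invr_gt0 ?ltr0n//.
  rewrite mulr1 invfM invrK.
  by have := ler0n R K; lra.
rewrite -(ler_pXn2r (n := 3)) ?nnegrE ?sqr_ge0 ?(mulr_ge0 _ (sqr_ge0 _))//.
have -> : (2 * q ^+ 2) ^+ 3 = 8 * q ^+ 6 by ring.
by rewrite -exprM.
Qed.

Lemma power_schedule_sum K : (0 < K)%N ->
  lbar * (1 - lbar) / 2 / (K%:R `^ (- (1 / 6))) ^+ 2 <=
  \sum_(K./2 <= k < K./2 + uphalf K) power_schedule k * (1 - power_schedule k).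
Proof.
move=> K0; have [q [q0 q1 -> q4 q6]] := sixth K0.
have KE : (K./2 + uphalf K)%N = K by rewrite uphalf_half addnCA addnn odd_double_half.
have b0 : 0 < lbar * (1 - lbar) by rewrite mulr_gt0// subr_gt0.
apply: (@le_trans _ _ (\sum_(K./2 <= k < K./2 + uphalf K) lbar * (1 - lbar) * q ^+ 4)).
  rewrite big_const_nat iter_addr_0 addKn -[X in _ <= X]mulr_natl.
  have uK : K%:R / 2 <= (uphalf K)%:R :> R.
    rewrite ler_pdivrMr// -natrM ler_nat muln2 uphalf_half doubleD.
    by rewrite -{1}(odd_double_half K) leq_add2r; case: odd.
  apply: (le_trans _ (ler_wpM2r _ uK)); last by rewrite mulr_ge0 ?(ltW b0)// exprn_ge0 ?ltW.
  have -> : K%:R / 2 * (lbar * (1 - lbar) * q ^+ 4) =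
      lbar * (1 - lbar) / 2 / q ^+ 2 * (K%:R * q ^+ 6).
    by field; rewrite gt_eqF.
  by rewrite q6 divff ?mulr1// pnatr_eq0 -lt0n.
apply: ler_sum_nat => k /andP[_]; rewrite KE => kK.
have /andP[_ lb] := power_schedule_bounds k.
rewrite mulrAC ler_pM//; rewrite ?mulr_ge0 ?(ltW lbar0) ?exprn_ge0 ?(ltW q0) ?subr_ge0 ?(ltW lbar1)//.
  rewrite ler_pM2l// -q4 !powRN lef_pV2 ?posrE ?powR_gt0 ?ltr0n//.
  by rewrite ge0_ler_powR ?nnegrE ?ler_nat//; lra.
by rewrite lerD2l lerN2.
Qed.

End ConcreteSchedules.

(** * Rates and almost sure convergence *)

Section Rates.
Context (R : realType) (H : completeNormedModType R) (ip : {dot H for idfun}).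
Hypothesis ipH : hilbert_norm ip.
Hypothesis Hsep : separable H.
Context (dO dX : measure_display) (Omega : measurableType dO) (P : probability Omega R).
Context (Xi : measurableType dX) (D : probability Xi R).
Variables (T : Xi -> H -> H) (Tbar : H -> H) (p : H) (s2 : R).
Hypothesis Tne : forall xi, nonexpansive (T xi).
Hypothesis Tm : forall x, hmeasurable (T ^~ x).
Hypothesis Tbarne : nonexpansive Tbar.
Hypothesis TE : forall x u, D.-integrable setT (fun xi => (ip (T xi x) u)%:E) /\
  (\int[D]_xi (ip (T xi x) u)%:E = (ip (Tbar x) u)%:E)%E.
Hypothesis Tp : Tbar p = p.
Hypothesis Tvar : (\int[D]_xi (`|T xi p - p| ^+ 2)%:E <= s2%:E)%E.
Variables (lbar : R) (l : nat -> R) (x0 : H) (xi : nat -> {RV P >-> Xi}) (I : set nat).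
Hypothesis lbar1 : lbar < 1.
Hypothesis lb : forall k, 0 <= l k <= lbar.
Hypothesis iidxi : iid D I xi.

Let X k (w : Omega) := stochastic_km T l x0 (fun j => xi j w) k.
Let sqdist k := (\int[P]_w (`|X k w - p| ^+ 2)%:E)%E.

Let l01 k : 0 <= l k <= 1.
Proof. by have /andP[-> /le_trans ->] := lb k; rewrite // ltW. Qed.

(** Here [v] is the rate: step sizes with bounded sum of squares and sum of order [v^-2] give a mean
    squared residual of order [v^2]. The sum of squares also keeps [Lambda], hence the weights,
    bounded below in terms of [l]. *)
Lemma random_index_rate s a v K (N : {RV P >-> nat}) : `I_K `<=` I -> (0 < K)%N ->
  random_index I xi l K N -> \sum_(k < K) l k ^+ 2 <= s -> 0 < a -> 0 < v ->
  a / v ^+ 2 <= \sum_(k < K) l k ->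
  (\int[P]_w `|Tbar (X (N w) w) - X (N w) w|%:E <=
   (((`|x0 - p| ^+ 2 + 2 * s2 * s) / (expR (- (2 * s)) * (1 - lbar) * a) + 1) / 2 * v)%:E)%E.
Proof.
move=> KI K0 NI ls a0 v0 la; set c1 := expR _ * _; set C0 := `|x0 - p| ^+ 2 + _.
have c10 : 0 < c1 by rewrite mulr_gt0 ?expR_gt0// subr_gt0.
have s20 : 0 <= s2 := variance_bound_ge0 Tvar.
have wge k : (k < K)%N -> c1 * l k <= index_weight l k := index_weight_ge lbar1 lb ls.
have w0 k : (k < K)%N -> 0 <= index_weight l k.
  by move=> /wge; apply: le_trans; have /andP[? _] := lb k; rewrite mulr_ge0// ltW.
have W : c1 * (a / v ^+ 2) <= \sum_(k < K) index_weight l k.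
  apply: le_trans (ler_wpM2l (ltW c10) la) _; rewrite mulr_sumr.
  by apply: ler_sum => k _; exact: wge.
have v20 : 0 < v ^+ 2 by rewrite exprn_gt0.
have c0 : 0 < c1 * (a / v ^+ 2) by rewrite mulr_gt0// divr_gt0.
have W0 := lt_le_trans c0 W; have vi : 0 < v^-1 by rewrite invr_gt0.
apply: le_trans (random_index_residual ipH Hsep Tne Tm Tbarne TE Tp Tvar x0 l01 iidxi KI K0 vi NI W0 w0) _.
rewrite lee_fin invrK [leRHS]mulrAC ler_pM2r ?invr_gt0//.
have -> : (C0 / (c1 * a) + 1) * v = v^-1 * (C0 / (c1 * (a / v ^+ 2))) + v.
  by field; rewrite !gt_eqF.
rewrite lerD2r ler_pM2l ?invr_gt0//; apply: ler_pM.
- by rewrite addr_ge0 ?sqr_ge0// mulr_ge0 ?mulr_ge0// sumr_ge0// => k _; exact: sqr_ge0.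
- by rewrite invr_ge0 ltW.
- by rewrite lerD2l ler_wpM2l// mulr_ge0.
- by rewrite lef_pV2 ?posrE.
Qed.

Lemma moment_bound_uniform s k : `I_k `<=` I -> \sum_(i < k) l i ^+ 2 <= s ->
  fine (sqdist k) <= expR (2 * s) * (`|x0 - p| ^+ 2 + 2 * s2 * s).
Proof.
move=> kI ls; have s20 : 0 <= s2 := variance_bound_ge0 Tvar.
apply: le_trans (moment_bound ipH Hsep Tne Tm Tbarne TE Tp Tvar x0 l01 iidxi kI) _.
apply: ler_pM.
- by rewrite prodr_ge0// => i _; rewrite addr_ge0// mulr_ge0// sqr_ge0.
- by rewrite addr_ge0 ?sqr_ge0// mulr_ge0 ?mulr_ge0// sumr_ge0// => i _; exact: sqr_ge0.
- exact: prod_le_expR.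
- by rewrite lerD2l ler_wpM2l// mulr_ge0.
Qed.

(** The rate [v] balances the residual of the shadow, of order [v^2] when the step sizes sum to
    [v^-2], and the tracking error, of order [v^2] when their squares do. Constant steps of order
    [K] to the power -2/3 achieve both with [v] of order [K] to the power -1/6. *)
Lemma last_iterate_rate s a b v m j
    (M := expR (2 * s) * (`|x0 - p| ^+ 2 + 2 * s2 * s)) : `I_(m + j) `<=` I ->
  \sum_(k < m + j) l k ^+ 2 <= s -> 0 < a -> 0 < v ->
  a / v ^+ 2 <= \sum_(m <= k < m + j) l k * (1 - l k) ->
  \sum_(m <= k < m + j) l k ^+ 2 <= b * v ^+ 2 ->
  (\int[P]_w `|Tbar (X (m + j) w) - X (m + j) w|%:E <=
   ((2 * (M / a) + 8 * (b * (2 * M + 2 * s2)) + 1) / 2 * v)%:E)%E.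
Proof.
move=> mI ls a0 v0 la lb2; have s20 : 0 <= s2 := variance_bound_ge0 Tvar.
have v20 : 0 < v ^+ 2 by rewrite exprn_gt0.
have dM k : (m <= k <= m + j)%N -> fine (sqdist k) <= M.
  move=> /andP[_ kmj]; apply: moment_bound_uniform.
    by move=> i /= ik; apply: mI; exact: leq_trans kmj.
  apply: le_trans ls; rewrite -!(big_mkord xpredT (fun k => l k ^+ 2)).
  rewrite [leRHS](big_cat_nat (n := k))//= lerDl.
  by apply: sumr_ge0 => i _; exact: sqr_ge0.
have s0 : 0 <= s by apply: le_trans ls; rewrite sumr_ge0// => i _; exact: sqr_ge0.
have M0 : 0 <= M by rewrite mulr_ge0 ?expR_ge0// addr_ge0 ?sqr_ge0// !mulr_ge0.
have S0 := lt_le_trans (divr_gt0 a0 v20) la.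
have vi : 0 < v^-1 by rewrite invr_gt0.
apply: le_trans (residual_mean_le ipH Hsep Tne Tm Tbarne TE Tp Tvar x0 l01 iidxi mI vi) _.
rewrite lee_fin invrK [leRHS]mulrAC ler_pM2r ?invr_gt0//.
have -> : (2 * (M / a) + 8 * (b * (2 * M + 2 * s2)) + 1) * v =
    v^-1 * (2 * (M / (a / v ^+ 2)) + 8 * (b * v ^+ 2 * (2 * M + 2 * s2))) + v.
  by field; rewrite !gt_eqF.
rewrite lerD2r ler_pM2l//.
apply: le_trans (residual_sqr_mean_last ipH Hsep Tne Tm Tbarne TE Tp Tvar l01 iidxi mI dM S0) _.
apply: lerD; rewrite ler_pM2l//.
  by apply: ler_wpM2l => //; rewrite lef_pV2 ?posrE// divr_gt0.
by rewrite -mulr_suml ler_wpM2r// addr_ge0// mulr_ge0.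
Qed.

Lemma ae_convergence phi c : I = setT -> 0 < c -> (forall k, c / k.+1%:R <= l k) ->
  (forall k, 0 <= phi k) -> (forall k, (0 < k)%N -> l k ^+ 2 <= phi k - phi k.+1) ->
  phi n @[n --> \oo] --> 0 ->
  {ae P, forall w, `|Tbar (X n w) - X n w| @[n --> \oo] --> 0 /\
    exists q, Tbar q = q /\ weakly_converges ip (X ^~ w) q}.
Proof.
move=> IT c0 lc phi0 lphi phic.
have := ae_shadowing ipH Hsep Tne Tm Tbarne TE Tp Tvar (x0 := x0) l01 iidxi IT
  (M := expR (2 * (l 0 ^+ 2 + phi 1)) * (`|x0 - p| ^+ 2 + 2 * s2 * (l 0 ^+ 2 + phi 1)))
  _ (tail_sum_small phi0 lphi phic).
have dM k := moment_bound_uniform (k := k) _ (sqr_sum_le k phi0 lphi).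
move=> /(_ (dM ltac:(by rewrite IT))); apply: filterS => w sh.
by apply: (shadowing_cvg ipH Tbarne Tp l01 (harmonic_divergent_sum c0 lbar1 lb lc)).
Qed.

End Rates.

(** * Sampled Davis-Yin operators *)

Section SampledDavisYin.
Context (R : realType) (H : completeNormedModType R) (ip : {dot H for idfun}).
Hypothesis ipH : hilbert_norm ip.
Hypothesis Hsep : separable H.
Context (dX : measure_display) (Xi : measurableType dX) (D : probability Xi R).
Variables (A B : H -> set H) (C : H -> H) (Cxi Cv : Xi -> H -> H) (rho : R) (N : set Xi).
Hypothesis Bm : maximally_monotone ip B.
Hypothesis Bconvex : convex_set (graph B).
Hypothesis rho0 : 0 < rho.
Hypothesis Cint : forall x, bochner_integrable D (Cxi ^~ x).
Hypothesis Cmean : forall x, C x = bochner_integral D (Cxi ^~ x).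
Hypotheses (mN : measurable N) (N0 : D N = 0).
Hypothesis CvN : forall xi, ~ N xi -> Cv xi = Cxi xi.
Hypothesis Cvm : forall x, hmeasurable (Cv ^~ x).
Local Notation JA := (resolvent rho A).
Local Notation JB := (resolvent rho B).
Local Notation S := (davis_yin A B rho).
(** For a fixed [x], the sampled operator depends on [xi] only through [z], the sample of [C] at
    [JA x]. The sample thus goes through [JB] but not through [JA], so convexity is asked of the
    graph of [B] alone. *)
Let F x z := x - JA x + JB (2 *: JA x - x - rho *: z).

Let version_ae : {ae D, forall xi, Cv xi = Cxi xi}.
Proof.
by exists N; split=> // xi /= nC; apply: contrapT => /CvN.
Qed.

Lemma davis_yin_argument_lipschitz x z z' : `|F x z - F x z'| <= rho * `|z - z'|.
Proof.
rewrite /F opprD addrACA subrr add0r (le_trans (resolvent_nonexpansive ipH Bm rho0 _ _))//.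
by rewrite opprB [X in `|X|]addrC subrKA -scalerBr normrZ gtr0_norm// distrC.
Qed.

Lemma davis_yin_argument_affine x : affine_map (F x).
Proof.
move=> t z z' t0 t1; rewrite /F; set a := x - JA x; set b := 2 *: JA x - x.
have -> : b - rho *: (t *: z + (1 - t) *: z') =
    t *: (b - rho *: z) + (1 - t) *: (b - rho *: z').
  by vec ipH.
rewrite (resolvent_affine ipH Bm rho0 Bconvex)//.
by move: (JB _) (JB _) => u v; vec ipH.
Qed.

Lemma hmeasurable_davis_yin x : hmeasurable (fun xi => S (Cv xi) x).
Proof.
apply: (hmeasurable_comp Hsep (f := fun xi => Cv xi (JA x)) (F := F x)) => //.
exact: lipschitz_continuous (ltW rho0) (davis_yin_argument_lipschitz x).
Qed.

Lemma davis_yin_has_bochner_integral x :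
  has_bochner_integral D (fun xi => S (Cv xi) x) (S C x).
Proof.
apply: (has_bochner_integral_comp ipH Hsep (f := fun xi => Cv xi (JA x)) (F := F x) _ _ (ltW rho0)) => //.
- exact: davis_yin_argument_affine.
- exact: davis_yin_argument_lipschitz.
apply: (@has_bochner_integral_ae _ _ _ _ _ (fun xi => Cxi xi (JA x))).
  by apply: filterS version_ae => xi ->.
by rewrite Cmean; exact: (has_bochner_integralP ipH Hsep).
Qed.

Lemma T_meanE : T_mean A B Cxi rho D = S C.
Proof.
apply/funext => x; apply: (bochner_integralE ipH Hsep).
apply: has_bochner_integral_ae (davis_yin_has_bochner_integral x).
by apply: filterS version_ae => xi ->.
Qed.

Lemma davis_yin_weak_mean x u :
  D.-integrable setT (fun xi => (ip (S (Cv xi) x) u)%:E) /\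
  (\int[D]_xi (ip (S (Cv xi) x) u)%:E = (ip (S C x) u)%:E)%E.
Proof.
have [_ h] := has_bochner_integral_weak ipH Hsep (@hmeasurable_davis_yin x)
  (davis_yin_has_bochner_integral x).
exact: h.
Qed.

Lemma davis_yin_variance p sigma : S C p = p ->
  (\int[D]_xi (`|C (JA p) - Cxi xi (JA p)| ^+ 2)%:E <= (sigma ^+ 2)%:E)%E ->
  (\int[D]_xi (`|S (Cv xi) p - p| ^+ 2)%:E <= ((rho * sigma) ^+ 2)%:E)%E.
Proof.
move=> Sp Csigma; have r2 : 0 <= rho ^+ 2 by exact: sqr_ge0.
have mC : measurable_fun setT (fun xi => (`|C (JA p) - Cv xi (JA p)| ^+ 2)%:E).
  by apply: measurable_normsq; apply: (hmeasurableB Hsep) => //; exact: hmeasurable_cst.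
apply: (@le_trans _ _ ((rho ^+ 2)%:E * \int[D]_xi (`|C (JA p) - Cv xi (JA p)| ^+ 2)%:E)%E).
  rewrite -ge0_integralZl//.
  apply: ae_ge0_le_integral => [xi|xi|].
  - by rewrite lee_fin sqr_ge0.
  - by rewrite -EFinM lee_fin mulr_ge0// sqr_ge0.
  apply: nearW => xi; rewrite -EFinM lee_fin -exprMn -{2}Sp.
  rewrite ler_sqr ?nnegrE ?mulr_ge0 ?(ltW rho0)// (distrC (C _)).
  exact: davis_yin_argument_lipschitz.
rewrite exprMn [leRHS]EFinM; apply: lee_wpmul2l; first by rewrite lee_fin.
apply: le_trans Csigma; apply: ae_ge0_le_integral => [xi|xi|]; rewrite ?lee_fin ?sqr_ge0//.
by apply: filterS version_ae => xi ->.
Qed.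

Lemma iterate_version x0 l (s : nat -> Xi) k : (forall j, (j < k)%N -> ~ N (s j)) ->
  iterate A B Cxi rho x0 l s k = stochastic_km (fun xi => S (Cv xi)) l x0 s k.
Proof.
elim: k => [//|k IH] sN; rewrite [LHS]/= [RHS]/= IH; last by move=> j /ltnW; exact: sN.
rewrite /km /davis_yin CvN; last exact: sN.
by congr (_ - _ *: _); rewrite opprD addrA subKr.
Qed.

Context (dO : measure_display) (Omega : measurableType dO) (P : probability Omega R).

Lemma ae_version (I : set nat) (xi : nat -> {RV P >-> Xi}) : iid D I xi ->
  {ae P, forall w, forall k, I k -> ~ N (xi k w)}.
Proof.
move=> iidxi.
have neg k : P.-negligible [set w | I k /\ N (xi k w)].
  have [Ik|nIk] := pselect (I k); last first.
    by rewrite (_ : [set _ | _] = set0); [exact: negligible_set0|apply/seteqP; split=> w []].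
  apply: (@negligibleS _ _ _ _ (xi k @^-1` N)); first by move=> w [].
  apply/negligibleP; first exact: measurable_funPTI.
  exact: etrans (iid_distribution iidxi Ik mN) N0.
have := negligible_bigcup neg; apply: negligibleS => w /= nw.
by apply: contrapT => h; apply: nw => k Ik Nk; apply: h; exists k.
Qed.

(** The index [n] is any bounded function of the outcome, so as to cover both the random index and
    the last iterate. *)
Lemma expectation_version (I : set nat) (xi : nat -> {RV P >-> Xi}) x0 l K (n : Omega -> nat) :
  iid D I xi -> `I_K `<=` I -> (forall w, (n w <= K)%N) ->
  let X w := iterate A B Cxi rho x0 l (fun k => xi k w) (n w) in
  let Y w := stochastic_km (fun xi => S (Cv xi)) l x0 (fun k => xi k w) (n w) in
  ('E_P[fun w => (`|T_mean A B Cxi rho D (X w) - X w|)%R] = \int[P]_w `|S C (Y w) - Y w|%:E)%E.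
Proof.
move=> iidxi KI nK X Y; rewrite unlock T_meanE.
apply: ae_eq_ge0_integral => [w|w|]; rewrite ?lee_fin//.
apply: filterS (ae_version iidxi) => w wN; rewrite /X iterate_version// => j jn.
by apply: wN; apply: KI => /=; exact: leq_trans (nK w).
Qed.

End SampledDavisYin.

Theorem mainTheorem8 (R : realType) (H : completeNormedModType R)
  (ip : {dot H for idfun})
  (dX dO : measure_display)
  (Xi : measurableType dX) (D : probability Xi R)
  (Omega : measurableType dO) (P : probability Omega R)
  (A B : H -> set H) (C : H -> H) (Cxi : Xi -> H -> H)
  (tau rho sigma : R) (p0 x0 : H)
  (H_hilbert : hilbert_norm ip) (H_separable : separable H)
  (A_maxmono : maximally_monotone ip A)
  (B_maxmono : maximally_monotone ip B)
  (B_convex : convex_set (graph B))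
  (tau_gt0 : 0 < tau)
  (C_cocoercive : cocoercive ip tau C)
  (Cxi_integrable : forall x, bochner_integrable D (fun xi => Cxi xi x))
  (C_mean : forall x, C x = bochner_integral D (fun xi => Cxi xi x))
  (Cxi_cocoercive : {ae D, forall xi, cocoercive ip tau (Cxi xi)})
  (zer_nonempty : zer (op_add (op_add A B) (op_fun C)) !=set0)
  (rho_gt0 : 0 < rho) (rho_lt : rho < 2 * tau) :
  let JA := resolvent rho A in
  let T := T_mean A B Cxi rho D in
  let X l s k := iterate A B Cxi rho x0 l s k in
  let E_residual (Y : Omega -> H) := ('E_P[fun w => `|T (Y w) - Y w|%R])%E in
  fix_set T p0 ->
  ('E_D[fun xi => (`|C (JA p0) - Cxi xi (JA p0)| ^+ 2)%R] <=
     (sigma ^+ 2)%:E)%E ->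
  forall lbar : R, 0 < lbar -> lbar < 1 ->
  let l1 (K k : nat) := lbar * K%:R `^ (- (1 / 2)) in
  let l2 (k : nat) :=
    lbar * k.+1%:R `^ (- (1 / 2)) * (ln (k%:R + expR 1))^-1 in
  let l3 (K k : nat) := lbar * K%:R `^ (- (2 / 3)) in
  let l4 (k : nat) := lbar * k.+1%:R `^ (- (2 / 3)) in
  (* for l1 and l3, xi K and N K are the samples and the index of the run of
     horizon K; for l2 and l4 there is a single run *)
  [/\ forall (xi : nat -> nat -> {RV P >-> Xi}) (N : nat -> {RV P >-> nat}),
        (forall K, (0 < K)%N ->
           iid D `I_K (xi K) /\ random_index `I_K (xi K) (l1 K) K (N K)) ->
        le_bigO
          (fun K => E_residual (fun w => X (l1 K) (fun k => xi K k w) (N K w)))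
          (fun K => K%:R `^ (- (1 / 4))),
      forall (xi : nat -> {RV P >-> Xi}) (N : nat -> {RV P >-> nat}),
        iid D setT xi ->
        (forall K, (0 < K)%N -> random_index setT xi l2 K (N K)) ->
        le_bigO
          (fun K => E_residual (fun w => X l2 (fun k => xi k w) (N K w)))
          (fun K => ln K%:R `^ (1 / 2) * K%:R `^ (- (1 / 4))),
      forall xi : nat -> nat -> {RV P >-> Xi},
        (forall K, (0 < K)%N -> iid D `I_K (xi K)) ->
        le_bigO
          (fun K => E_residual (fun w => X (l3 K) (fun k => xi K k w) K))
          (fun K => K%:R `^ (- (1 / 6))),
      forall xi : nat -> {RV P >-> Xi},
        iid D setT xi ->
        le_bigO
          (fun K => E_residual (fun w => X l4 (fun k => xi k w) K))
          (fun K => ln K%:R `^ (1 / 2) * K%:R `^ (- (1 / 6)))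
    & forall l : nat -> R, l = l2 \/ l = l4 ->
      forall xi : nat -> {RV P >-> Xi},
        iid D setT xi ->
        {ae P, forall w,
          exists p : H,
            [/\ weakly_converges ip (fun k => X l (fun k => xi k w) k) p,
                fix_set T p
              & zer (op_add (op_add A B) (op_fun C)) (JA p)]} /\
        {ae P, forall w,
          (`|T (X l (fun k => xi k w) k) - X l (fun k => xi k w) k| : R) @[k --> \oo] --> 0}].
Proof.
move=> JA T X E_residual Tp0 Csigma lbar lbar0 lbar1 l1 l2 l3 l4.
have rho2 := ltW rho_lt.
have [N [Cv [mN N0 CvN Cvc Cvm]]] :=
  cocoercive_version H_hilbert H_separable tau_gt0 Cxi_integrable Cxi_cocoercive.
pose S := davis_yin A B rho C; pose Ts xi := davis_yin A B rho (Cv xi).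
have TS : T = S.
  exact: (T_meanE H_hilbert H_separable A B_maxmono B_convex rho_gt0 Cxi_integrable C_mean mN N0 CvN Cvm).
have Sp : S p0 = p0 by rewrite -TS.
have Tsne xi : nonexpansive (Ts xi).
  exact: (davis_yin_nonexpansive H_hilbert A_maxmono B_maxmono rho_gt0 rho2 (Cvc xi)).
have Sne : nonexpansive S.
  exact: (davis_yin_nonexpansive H_hilbert A_maxmono B_maxmono rho_gt0 rho2 C_cocoercive).
have Tsm x : hmeasurable (Ts ^~ x).
  exact: (hmeasurable_davis_yin H_hilbert H_separable A B_maxmono rho_gt0 Cvm).
have TE x u : D.-integrable setT (fun xi => (ip (Ts xi x) u)%:E) /\
    (\int[D]_xi (ip (Ts xi x) u)%:E = (ip (S x) u)%:E)%E.
  exact: (davis_yin_weak_mean H_hilbert H_separable A B_maxmono B_convex rho_gt0 Cxi_integrable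
    C_mean mN N0 CvN Cvm).
have Tvar : (\int[D]_xi (`|Ts xi p0 - p0| ^+ 2)%:E <= ((rho * sigma) ^+ 2)%:E)%E.
  apply: (davis_yin_variance H_hilbert H_separable B_maxmono rho_gt0 mN N0 CvN Cvm Sp).
  by move: Csigma; rewrite unlock.
have transfer I (xi : nat -> {RV P >-> Xi}) l K (n : Omega -> nat) c :
    iid D I xi -> `I_K `<=` I -> (forall w, (n w <= K)%N) ->
    let Y w := stochastic_km Ts l x0 (fun k => xi k w) (n w) in
    (\int[P]_w `|S (Y w) - Y w|%:E <= c ->
     E_residual (fun w => X l (fun k => xi k w) (n w)) <= c)%E.
  move=> iidxi KI nK Y; apply: le_trans; rewrite le_eqVlt; apply/orP; left; apply/eqP.
  exact: (expectation_version H_hilbert H_separable A B_maxmono B_convex rho_gt0 Cxi_integrable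
    C_mean mN N0 CvN Cvm x0 l iidxi KI nK).
split.
- move=> xi n h; eexists; exists 1%N => // K /= K0.
  have [iidK nI] := h K K0; have [nK _ _] := nI.
  apply: (transfer _ _ _ _ _ _ iidK (@subset_refl _ _) (fun w => ltnW (nK w))).
  apply: (random_index_rate H_hilbert H_separable Tsne Tsm Sne TE Sp Tvar x0 lbar1
    (fun k => sqrt_schedule_bounds lbar0 k K0) iidK (@subset_refl _ _) K0 nI
    (sqrt_schedule_sqr_sum lbar0 lbar1 K0) lbar0 _ (sqrt_schedule_sum lbar0 K0)).
  by rewrite powR_gt0// ltr0n.
- move=> xi n iidxi h; eexists; exists 3%N => // K /= K3.
  have K0 : (0 < K)%N by exact: ltn_trans K3.
  have nI := h K K0; have [nK _ _] := nI.
  apply: (transfer _ _ _ _ _ _ iidxi (@subsetT _ _) (fun w => ltnW (nK w))).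
  apply: (random_index_rate H_hilbert H_separable Tsne Tsm Sne TE Sp Tvar x0 lbar1
    (log_schedule_bounds lbar0) iidxi (@subsetT _ _) K0 nI
    (sqr_sum_le K (log_potential_ge0 lbar) (log_potential_step lbar0)) _ _ (log_schedule_sum lbar0 K3)).
    by rewrite divr_gt0.
  have K3R : 3 <= K%:R :> R by rewrite ler_nat.
  by rewrite mulr_gt0// powR_gt0 ?ltr0n// ln_gt0//; lra.
- move=> xi h; eexists; exists 1%N => // K /= K0.
  have iidK := h K K0; have v0 : 0 < (K%:R `^ (- (1 / 6)) : R) by rewrite powR_gt0// ltr0n.
  apply: (transfer _ _ _ _ (fun=> K) _ iidK (@subset_refl _ _) (fun=> leqnn K)).
  have ls : \sum_(k < 0 + K) constant_power_schedule lbar K k ^+ 2 <= 1.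
    rewrite -(big_mkord xpredT (fun k => constant_power_schedule lbar K k ^+ 2)).
    apply: le_trans (constant_power_schedule_sqr_sum lbar0 lbar1 K0) _.
    by rewrite mul1r expr_le1 ?(ltW v0)// powR_le1 ?ler1n//; lra.
  have a0 : 0 < lbar * (1 - lbar) by rewrite mulr_gt0// subr_gt0.
  exact: (last_iterate_rate H_hilbert H_separable Tsne Tsm Sne TE Sp Tvar x0 lbar1
    (fun k => constant_power_schedule_bounds lbar0 k K0) iidK (m := 0) (@subset_refl _ _) ls a0 v0
    (constant_power_schedule_sum lbar0 K0) (constant_power_schedule_sqr_sum lbar0 lbar1 K0)).
- move=> xi iidxi; eexists; exists 4%N => // K /= K4.
  have K0 : (0 < K)%N by exact: ltn_trans K4.
  have K4R : 4 <= K%:R :> R by rewrite ler_nat.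
  have v0 : 0 < (K%:R `^ (- (1 / 6)) : R) by rewrite powR_gt0// ltr0n.
  have a0 : 0 < lbar * (1 - lbar) / 2 by rewrite divr_gt0// mulr_gt0// subr_gt0.
  apply: (transfer _ _ _ K (fun=> K) _ iidxi (@subsetT _ _) (fun=> leqnn K)).
  have := last_iterate_rate H_hilbert H_separable Tsne Tsm Sne TE Sp Tvar x0 lbar1
    (power_schedule_bounds lbar0) iidxi (@subsetT _ _)
    (sqr_sum_le _ (power_potential_ge0 lbar) (power_potential_step lbar)) a0 v0
    (power_schedule_sum lbar0 lbar1 K0) (power_schedule_sqr_sum lbar0 lbar1 K0).
  rewrite uphalf_half addnCA addnn odd_double_half => h; apply: (le_trans h).
  (* The bound [h] has no logarithm; [K >= 4 >= e] makes the logarithmic factor of the claim at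
     least 1. *)
  rewrite lee_fin [leRHS]mulrCA; apply: ler_peMl.
    by rewrite -lee_fin (le_trans _ h)// integral_ge0// => w _; rewrite lee_fin.
  rewrite -[leLHS](powRr0 (ln K%:R)) ler_powR//.
  by rewrite ln_ge1// (le_trans (expR1_le4 R)).
- move=> l lE xi iidxi.
  suff h : {ae P, forall w, let Y := stochastic_km Ts l x0 (xi ^~ w) in
      `|S (Y n) - Y n| @[n --> \oo] --> 0 /\ exists q, S q = q /\ weakly_converges ip Y q}.
    have XY : {ae P, forall w, X l (xi ^~ w) = stochastic_km Ts l x0 (xi ^~ w)}.
      apply: filterS (ae_version mN N0 iidxi) => w wN; apply/funext => k.
      by apply: (iterate_version A B rho CvN) => j _; exact: wN.
    rewrite TS; split; apply: filterS2 h XY => w [hr [q [Sq Yq]]] XYw.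
      by exists q; rewrite XYw; split=> //; exact: (zer_davis_yin H_hilbert A_maxmono B_maxmono rho_gt0 Sq).
    by rewrite XYw.
  have [-> | ->] := lE.
    exact: (ae_convergence H_hilbert H_separable Tsne Tsm Sne TE Sp Tvar x0 lbar1
      (log_schedule_bounds lbar0) iidxi erefl (divr_gt0 lbar0 _) (log_schedule_ge lbar0)
      (log_potential_ge0 lbar) (log_potential_step lbar0) (log_potential_cvg lbar0 lbar1)).
  exact: (ae_convergence H_hilbert H_separable Tsne Tsm Sne TE Sp Tvar x0 lbar1
      (power_schedule_bounds lbar0) iidxi erefl lbar0 (power_schedule_ge lbar0)
      (power_potential_ge0 lbar) (power_potential_step lbar) (power_potential_cvg lbar0 lbar1)).
Qed.
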